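(* There is an algorithm that, given two matroids $\mathbf M_1=(S,\mathcal I_1)$, $\mathbf M_2=(S,\mathcal I_2)$ on a ground set of size $n$ given by independence oracles, enumerates all inclusion-wise maximal common independent sets of $\mathbf M_1$ and $\mathbf M_2$ in non-increasing order of cardinality, each exactly once, such that for every $i$ not exceeding the number of such sets, the first $i$ solutions are output within $O(i\cdot n^7Q)$ time, and which uses space polynomial in $n+\hat Q$ (in particular it is a linear incremental-time, polynomial-space algorithm).
   Context: A common independent set is a set in $\mathcal I_1\cap\mathcal I_2$. Each independence-oracle call takes $Q$ time and $\hat Q$ space. An enumeration algorithm is linear incremental-time if for every $i$ at most the number $N$ of solutions it outputs at least $i$ solutions within $O(i\cdot\mathrm{poly}(n))$ time (here polynomial in $n+Q$). *)

(* Defs.v *)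
From mathcomp Require Import all_boot.
Set Implicit Arguments.
Unset Strict Implicit.
Unset Printing Implicit Defensive.

Record matroid (T : finType) := Matroid {
  indep :> {set T} -> bool;
  indep0 : indep set0;
  indepS : forall I J : {set T}, I \subset J -> indep J -> indep I;
  indep_aug : forall I J : {set T}, indep I -> indep J -> #|I| < #|J| ->
    exists2 x, x \in J :\: I & indep (x |: I)
}.

Definition common_indep (T : finType) (M1 M2 : matroid T) : pred {set T} :=
  fun I => M1 I && M2 I.

Definition mcis (T : finType) (M1 M2 : matroid T) : {set {set T}} :=
  [set I : {set T} | maxset (common_indep M1 M2) I].

(** The model of computation is a random access machine with two independence
  oracles. Programs are finite syntactic objects, independent of the input size [n].
  They act on a memory of natural numbers; the variables of a program are the
  cells at constant addresses. A subset of the ground set ['I_n] is passed to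
  an oracle, or output, as the block of [n] consecutive cells starting at a
  given address that holds its characteristic vector (any nonzero number
  stands for membership).

  A machine word has [O(log n)] bits and word operations take unit time.
  Numbers that do not fit in one word are allowed, but an operation on them is
  charged for all the words it has to process. *)

Inductive binop := Add | Sub | Mul | Div | Mod | Eq | Lt.

Inductive expr :=
  | Const of nat
  | Cell of expr
  | Bin of binop & expr & expr.

Inductive cmd :=
  | Skip
  | Store of expr & expr            (* address, value *)
  | Query of bool & expr & expr     (* oracle, address of the answer, block *)
  | Output of expr                  (* block *)
  | Seq of cmd & cmd
  | If of expr & cmd & cmd
  | While of expr & cmd.

Definition algorithm := cmd.

Definition binop_sem (o : binop) (u v : nat) : nat :=
  match o with
  | Add => u + v
  | Sub => u - v
  | Mul => u * v
  | Div => u %/ v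
  | Mod => u %% v
  | Eq => u == v
  | Lt => u < v
  end.

Fixpoint eval (m : nat -> nat) (e : expr) : nat :=
  match e with
  | Const c => c
  | Cell a => m (eval m a)
  | Bin o a b => binop_sem o (eval m a) (eval m b)
  end.

(** The number of digits of [v] in base [n.+2], hence the number of words it
  occupies. *)
Definition wlen (n v : nat) : nat := (trunc_log n.+2 v).+1.

(** The charge for a binary operation is that of schoolbook multiplication. *)
Fixpoint ecost (n : nat) (m : nat -> nat) (e : expr) : nat :=
  match e with
  | Const c => wlen n c
  | Cell a => ecost n m a + wlen n (m (eval m a))
  | Bin _ a b =>
      ecost n m a + ecost n m b + wlen n (eval m a) * wlen n (eval m b)
  end.

(** The size in bits of the first [u] cells, each one taking at least a bit. *)
Definition bits (m : nat -> nat) (u : nat) : nat :=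
  \sum_(a < u) (trunc_log 2 (m a)).+1.

(** [used] is one more than the largest address written so far (a cell that
  was never written holds 0, except for the input); [peak] is the largest size
  in bits that the used part of the memory has had so far; [log] lists the
  sets output so far in chronological order, each with the time at which its
  output was completed. *)
Record state (n : nat) := State {
  mem : nat -> nat;
  used : nat;
  peak : nat;
  clock : nat;
  log : seq (nat * {set 'I_n})
}.

Definition block (n : nat) (m : nat -> nat) (a : nat) : {set 'I_n} :=
  [set i : 'I_n | m (a + i) != 0].

Definition tick n (t : nat) (s : state n) : state n :=
  State (mem s) (used s) (peak s) (clock s + t) (log s).

Definition store n (a v : nat) (s : state n) : state n :=
  let m := fun b => if b == a then v else mem s b in
  let u := maxn (used s) a.+1 in
  State m u (maxn (peak s) (bits m u)) (clock s) (log s).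

Definition emit n (a : nat) (s : state n) : state n :=
  State (mem s) (used s) (peak s) (clock s)
        (rcons (log s) (clock s, block n (mem s) a)).

Section Semantics.

Variables (n Q : nat) (oracle : bool -> {set 'I_n} -> bool).

Local Notation value s e := (eval (mem s) e).
Local Notation cost s e := (ecost n (mem s) e).

(** On top of the evaluation of the expressions involved, an oracle call
  takes time [Q], and an output takes time [n]. *)
Inductive exec : cmd -> state n -> state n -> Prop :=
  | ExSkip s : exec Skip s (tick 1 s)
  | ExStore a e s :
      exec (Store a e) s
        (store (value s a) (value s e) (tick (cost s a + cost s e).+1 s))
  | ExQuery b a e s :
      exec (Query b a e) s
        (store (value s a) (oracle b (block n (mem s) (value s e)))
           (tick ((cost s a + cost s e).+1 + Q) s))
  | ExOutput e s :
      exec (Output e) s (emit (value s e) (tick ((cost s e).+1 + n) s))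
  | ExSeq p q s s1 s2 :
      exec p s s1 -> exec q s1 s2 -> exec (Seq p q) s s2
  | ExIf e p q s s1 :
      exec (if value s e != 0 then p else q) (tick (cost s e).+1 s) s1 ->
      exec (If e p q) s s1
  | ExWhileStop e p s :
      value s e = 0 -> exec (While e p) s (tick (cost s e).+1 s)
  | ExWhileLoop e p s s1 s2 :
      value s e <> 0 ->
      exec p (tick (cost s e).+1 s) s1 -> exec (While e p) s1 s2 ->
      exec (While e p) s s2.

Lemma exec_det p s s1 s2 : exec p s s1 -> exec p s s2 -> s1 = s2.
Proof.
move=> H; elim: H s2 => {p s s1}.
- by move=> s s2 H; inversion H.
- by move=> a e s s2 H; inversion H.
- by move=> b a e s s2 H; inversion H.
- by move=> e s s2 H; inversion H.
- move=> p q s s1 s2 _ IHp _ IHq s3 H; inversion H as [| | | |? ? ? t ? H1 H2| | |].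
  by rewrite -(IHp _ H1) in H2; exact: IHq.
- by move=> e p q s s1 _ IH s2 H; inversion H; exact: IH.
- by move=> e p s H0 s2 H; inversion H.
- move=> e p s s1 s2 nz _ IHp _ IHw s3 H.
  inversion H as [| | | | | | |? ? ? t ? ? H1 H2] => //.
  by rewrite -(IHp _ H1) in H2; exact: IHw.
Qed.

End Semantics.

(** The input consists of the number [n], in cell 0, and the two oracles. *)
Definition init_state (n : nat) : state n :=
  let m := fun a => if a == 0 then n else 0 in
  State m 1 (bits m 1) 0 [::].

(** [run A M1 M2 Q s]: when oracle calls take time [Q], the algorithm [A]
  halts on [(M1, M2)] in the final state [s], which is unique by [exec_det]. *)
Definition run (A : algorithm) n (M1 M2 : matroid 'I_n) (Q : nat)
    (s : state n) : Prop :=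
  exec Q (fun b : bool => indep (if b then M2 else M1)) A (init_state n) s.

Definition outputs n (s : state n) : seq {set 'I_n} := [seq e.2 | e <- log s].

Definition outputs_by n (s : state n) (t : nat) : nat :=
  count (fun e => e.1 <= t) (log s).

(** [Qhat] is the space taken by an oracle call. *)
Definition space n (s : state n) (Qhat : nat) : nat := peak s + Qhat.

Definition enumerates_mcis_by_size (A : algorithm) : Prop :=
  forall n (M1 M2 : matroid 'I_n) (Q : nat), 0 < Q ->
  exists2 s : state n, run A M1 M2 Q s &
    [/\ uniq (outputs s),
        outputs s =i mcis M1 M2
      & sorted (fun I J : {set 'I_n} => #|J| <= #|I|) (outputs s)].

(** A function of [x] is polynomially bounded if it is at most
  [c * x.+1 ^ d] for some constants [c] and [d]. *)
Definition linear_incremental_time (A : algorithm) : Prop :=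
  exists c d : nat, forall n (M1 M2 : matroid 'I_n) (Q : nat) (s : state n),
  0 < Q -> run A M1 M2 Q s ->
  forall i, i <= #|mcis M1 M2| ->
  i <= outputs_by s (i * (c * (n + Q).+1 ^ d)).

Definition polynomial_space (A : algorithm) : Prop :=
  exists c d : nat,
  forall n (M1 M2 : matroid 'I_n) (Q Qhat : nat) (s : state n),
  0 < Q -> run A M1 M2 Q s -> space s Qhat <= c * (n + Qhat).+1 ^ d.

(* Main.v *)
(** The sets of maximum cardinality [r] are listed in lexicographic order: a
  prefix can be completed iff matroid intersection, run on the undecided
  elements, reaches cardinality [r].

  For every threshold [tau = r - 1, ..., 0], all maximal common independent
  sets with at least [tau] elements are then visited by reverse search, and
  those with exactly [tau] elements are output. Let [R] be a fixed maximum set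
  and [G_j = R :|: {i | i < j}]. The nodes of the search tree are the pairs
  [(j, I)] with [I] maximal in [G_j] and [tau <= #|I|]; the root is [(0, R)] and
  the nodes with [j = n] are the solutions. The parent of [(j.+1, I)] is
  [(j, I)] if [I] is still admissible at level [j]; otherwise [I] contains [j],
  and if [#|I| > tau] the parent is the greedy completion of [I :\ j] at level
  [j]. If [#|I| = tau], removing [j] could fall below the threshold. But then
  [I] is not maximum in [G_(j.+1)], and exchanging [I] along the first two
  vertices of a shortest augmenting path gives a common independent set of the
  same cardinality with a shorter augmenting path; its greedy completion is the
  parent. In all cases parent and child differ by at most three elements, so
  the children of a node are found among polynomially many candidates, and no
  stack is needed.

  Every node at a level [j < n] has a child at level [j.+1], which is visited
  first; hence among [n.+1] consecutively visited nodes there is a solution.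
  As all solutions visited with threshold [tau] have been output or are about
  to be, the number of steps before the [i]-th output is [O(n ^ 2 * i)]. One
  step scans [O(n ^ 3)] candidates, each checked with [O(n ^ 2)] queries. *)
Require Import Defs.
From mathcomp Require Import all_boot zify.
Set Implicit Arguments.
Unset Strict Implicit.
Unset Printing Implicit Defensive.

(** * The exchange graph of two matroids *)

(** A single exchange is the only primitive of matroid intersection used here. Instead of augmenting
    along a whole path, [improve] swaps its first two vertices, which keeps the cardinality and
    strictly shortens the path, until a single vertex can simply be added. So the same operation
    computes maximum sets, by a potential argument, and defines parents at the threshold. A full
    augmentation could change many elements, and the children would no longer be found among
    polynomially many candidates; the decreasing path length is what keeps the parent relation
    well-founded.

    The argument lives on three levels. An abstract machine on sets carries the combinatorics and
    the amortised count of steps. A small structured language has a denotational semantics and a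
    static cost, essentially the nesting depth of its loops. A simulation theorem transfers both to
    the random access machine, so that the running time reduces to two facts: the depth 5 of one
    round and the quadratic number of rounds per output. *)

Section Matroids.

Variables (T : finType) (M : matroid T).
Implicit Types (I J A B F : {set T}).

(** [J] lies in the span of [I] and has the same size, so both span the same flat, and being
    independent over one means being independent over the other. *)
Lemma indep_transfer I J z :
  M I -> M J -> #|I| = #|J| ->
  {in J :\: I, forall y, ~~ M (y |: I)} ->
  z \notin I -> M (z |: I) -> M (z |: J).
Proof.
move=> MI MJ IJ Jfull zI MzI.
have [|w] := indep_aug MJ MzI; first by rewrite cardsU1 zI IJ.
rewrite !inE => /andP[wJ /orP[/eqP-> //|wI] MwJ].
have [|y] := indep_aug MI MwJ; first by rewrite cardsU1 wJ IJ.
rewrite !inE => /andP[yI /orP[/eqP yw|yJ] MyI]; first by rewrite yw wI in yI.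
by have := Jfull y; rewrite !inE yI yJ MyI => /(_ isT).
Qed.

Lemma indep_extend A I :
  M A -> M I -> #|A| <= #|I| ->
  exists B, [/\ A \subset B, B \subset A :|: I, #|B| = #|I| & M B].
Proof.
move=> + MI; have [k] := ubnP (#|I| - #|A|); elim: k A => // k IHk A ltk MA.
rewrite leq_eqVlt => /predU1P[cA|ltA].
  by exists A; split=> //; apply: subsetUl.
have [x] := indep_aug MA MI ltA; rewrite !inE => /andP[xA xI] MxA.
have cxA : #|x |: A| = #|A|.+1 by rewrite cardsU1 xA.
have [|//||B [xAB BxAI cB MB]] := IHk (x |: A); rewrite ?cxA //.
  by rewrite subnS; move: ltA ltk; rewrite -subn_gt0; case: (#|I| - #|A|).
exists B; split=> //; first exact: subset_trans (subsetUr _ _) xAB.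
apply: subset_trans BxAI _; rewrite -setUA subUset subxx andbT.
by rewrite sub1set !inE xI orbT.
Qed.

(* The fundamental circuit of [y] in [I] avoids [F]. *)
Lemma dep_setD I F y :
  M I -> y \notin I -> ~~ M (y |: I) -> F \subset I ->
  {in F, forall f, ~~ M (y |: I :\ f)} -> ~~ M (y |: I :\: F).
Proof.
move=> MI yI NyI FI NF; apply/negP => MyF.
have [F0|[f fF]] := set_0Vmem F; first by rewrite F0 setD0 (negPf NyI) in MyF.
have cF : #|I :\: F| < #|I|.
  by rewrite cardsD (setIidPr FI) ltn_subrL !card_gt0; apply/andP; split; apply/set0Pn; exists f => //; exact: (subsetP FI).
(* [B] contains [y], lies in [y |: I] and has the size of [I], so it misses exactly one element [g]
   of [I]. Since [I :\: F] is inside [B], this [g] is in [F], against the hypothesis on [F]. *)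
have [|B [sB Bs cB MB]] := indep_extend MyF MI.
  by rewrite cardsU1 !inE (negPf yI) andbF.
have yB : y \in B by apply: (subsetP sB); rewrite !inE eqxx.
have BI : B \subset y |: I.
  apply: subset_trans Bs _; rewrite -setUA setUS //.
  by rewrite subUset subsetDl subxx.
have [g gI gB] : exists2 g, g \in I & g \notin B.
  apply/subsetPn; apply/negP => IB.
  have : y |: I \subset B by rewrite subUset sub1set yB.
  by move/subset_leq_card; rewrite cardsU1 yI cB ltnn.
have gF : g \in F.
  apply: contraNT gB => gF; apply: (subsetP sB).
  by rewrite !inE gF gI orbT.
have yg : y != g by apply: contraNneq yI => ->.
have EB : B = y |: I :\ g.
  apply/eqP; rewrite eqEcard; apply/andP; split; last first.
    by rewrite cardsU1 !inE (negPf yI) andbF /= cB (cardsD1 g I) gI.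
  apply/subsetP => z zB; have := subsetP BI z zB; rewrite !inE.
  case/orP=> [->//|zI]; apply/orP; right; rewrite zI andbT.
  by apply: contraNneq gB => <-.
by have := NF g gF; rewrite -EB MB.
Qed.

(** The larger set has one element more than [I], and only [a] and [b] are outside [I]. This is what
    limits the number of new elements in a greedy completion. *)
Lemma indep_two_added I f a b :
  M I -> f \in I -> a \notin I -> b \notin I -> a != b ->
  M (a |: (b |: I :\ f)) -> M (a |: I) || M (b |: I).
Proof.
move=> MI fI aI bI ab MJ; have [|z] := indep_aug MI MJ.
  by rewrite !cardsU1 !inE (negPf ab) (negPf aI) (negPf bI) !andbF /= (cardsD1 f I) fI.
rewrite !inE => /andP[zI]; case/or3P=> [/eqP->->//|/eqP->->|]; first by rewrite orbT.
by rewrite (negPf zI) andbF.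
Qed.

(** The circuit of [y] in [I] passes through [f] and remains the circuit of [y] in the larger
    independent set [x |: I]; removing [f] breaks it. *)
Lemma indep_exchange I x y f :
  M (x |: I) -> M (y |: I :\ f) -> ~~ M (y |: I) ->
  f \in I -> x \notin I -> y \notin I -> M (y |: (x |: I) :\ f).
Proof.
move=> MxI Myf NyI fI xI yI; have [|z] := indep_aug Myf MxI.
  by rewrite !cardsU1 !inE xI (negPf yI) andbF /= (cardsD1 f I) fI.
rewrite !inE negb_or negb_and negbK => /andP[/andP[zy zf]] zxI Mz.
have [zI|zI] := boolP (z \in I).
  move: zf; rewrite zI orbF => /eqP zf; rewrite zf in Mz.
  have E : f |: (y |: I :\ f) = y |: I by rewrite setUCA setD1K.
  by rewrite -E Mz in NyI.
move: zxI; rewrite (negPf zI) orbF => /eqP zx; rewrite zx in Mz.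
by apply: indepS Mz; apply/subsetP => w; rewrite !inE; do 3![case: eqP] => //=.
Qed.

End Matroids.

Definition tog (T : finType) (x : T) (X : {set T}) :=
  if x \in X then X :\ x else x |: X.

Section ExchangeGraph.

Variables (T : finType) (M : bool -> matroid T) (G : {set T}).
Implicit Types (I J X : {set T}) (u v x y f : T).

Definition cis I := M false I && M true I.

(** The side of [v] selects the matroid: in [M true] an outer [u] replaces [v], in [M false] an
    outer [v] replaces [u]. Toggling both vertices expresses the two cases by one formula, and the
    program tests them by the same code. *)
Definition edge I v u :=
  [&& u \in G, (u \in I) != (v \in I) & M (v \in I) (tog v (tog u I))].

Definition ends b I := [set u in G | (u \notin I) && M b (u |: I)].

(** Layers grow backwards, from [ends true]. Hence the first vertex of [ends false] that is met,
    together with its predecessor, forms the beginning of a shortest augmenting path, the part which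
    an exchange uses. *)
Definition grow I X := ends true I :|: X :|: [set u | [exists v in X, edge I v u]].

Definition layer I k := iter k (grow I) set0.

(** The number of vertices of a shortest augmenting path, since layer 1 is [ends true]. The default
    of [find], here [#|T|.+1], means that there is no such path. *)
Definition dist I :=
  find (fun k => ends false I :&: layer I k != set0) (iota 0 #|T|.+1).

Lemma cisS I J : I \subset J -> cis J -> cis I.
Proof. by move=> sIJ /andP[? ?]; rewrite /cis !(indepS sIJ). Qed.

Lemma cis_indep b I : cis I -> M b I.
Proof. by case/andP; case: b. Qed.

Lemma tog2 I f y : f \in I -> y \notin I ->
  tog f (tog y I) = y |: I :\ f /\ tog y (tog f I) = y |: I :\ f.
Proof.
move=> fI yI; have fy : f != y by apply: contraNneq yI => <-.
rewrite /tog fI (negPf yI) !inE fI orbT (negPf yI) andbF; split=> //.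
by apply/setP=> z; rewrite !inE; case: (z =P y) => [->|//]; rewrite eq_sym fy.
Qed.

Lemma edge_out I v u : v \notin I -> u \in I ->
  edge I v u = (u \in G) && M false (v |: I :\ u).
Proof. by move=> vI uI; rewrite /edge uI (negPf vI) (tog2 uI vI).2. Qed.

Lemma edge_in I v u : v \in I -> u \notin I ->
  edge I v u = (u \in G) && M true (u |: I :\ v).
Proof. by move=> vI uI; rewrite /edge vI (negPf uI) (tog2 vI uI).1. Qed.

Lemma edge_side I v u : edge I v u -> (u \in I) = (v \notin I).
Proof. by case/and3P=> _; case: (u \in I); case: (v \in I). Qed.

Lemma layerS I k : layer I k.+1 = grow I (layer I k).
Proof. by []. Qed.

Lemma layer_subS I k : layer I k \subset layer I k.+1.
Proof. by rewrite layerS /grow -setUA setUC -setUA subsetUl. Qed.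

Lemma layer_sub I k m : k <= m -> layer I k \subset layer I m.
Proof.
move/subnK <-; elim: (m - k) => [|d IH]; first by rewrite add0n.
by rewrite addSn; apply: subset_trans IH (layer_subS _ _).
Qed.

Lemma layer_ends I k u : u \in ends true I -> u \in layer I k.+1.
Proof. by move=> uE; rewrite layerS /grow !in_setU uE. Qed.

Lemma layer_edge I k u v : v \in layer I k -> edge I v u -> u \in layer I k.+1.
Proof.
move=> vL e; rewrite layerS /grow !inE; apply/orP; right.
by apply/existsP; exists v; rewrite vL.
Qed.

Lemma layer_ind I (P : nat -> T -> Prop) :
  (forall k u, u \in ends true I -> P k.+1 u) ->
  (forall k u v, v \in layer I k -> P k v -> edge I v u -> P k.+1 u) ->
  (forall k u, P k u -> P k.+1 u) ->
  forall k u, u \in layer I k -> P k u.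
Proof.
move=> Pe Ps Pm; elim=> [|k IH] u; first by rewrite inE.
rewrite layerS !in_setU => /orP[/orP[/Pe//|/IH/Pm//]|].
by rewrite inE => /exists_inP[v vL]; apply: Ps => //; apply: IH.
Qed.

Lemma layer_ground I k : layer I k \subset G.
Proof.
apply/subsetP => u uL; apply: (layer_ind (P := fun _ u => u \in G)) uL => // {u}k u.
  by rewrite inE => /andP[].
by move=> v _ _ /and3P[].
Qed.

(** [grow I] is monotone, so its iteration from the empty set is stationary after [#|T|] rounds. *)
Lemma layer_stable I k : layer I k \subset layer I #|T|.
Proof.
have mono : {homo grow I : X Y / X \subset Y}.
  move=> X Y XY; rewrite /grow setUSS ?setUS //; apply/subsetP => u.
  rewrite !inE => /exists_inP[v vX e]; apply/exists_inP; exists v => //.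
  exact: (subsetP XY).
have -> : layer I #|T| = fixset (grow I) by [].
exact: iter_sub_fix.
Qed.

Lemma dist_le I k u : u \in ends false I -> u \in layer I k -> dist I <= k.
Proof.
move=> uE uL; rewrite leqNgt; apply/negP => kd.
have h : has (fun k => ends false I :&: layer I k != set0) (iota 0 #|T|.+1).
  apply/hasP; exists #|T|; first by rewrite mem_iota add0n leqnn.
  by apply/set0Pn; exists u; rewrite in_setI uE (subsetP (layer_stable I k)).
have kT : k < #|T|.+1 by apply: leq_trans kd _; rewrite -[X in _ <= X](size_iota 0) find_size.
have := before_find 0 kd; rewrite nth_iota // add0n => /negbT/negPn/eqP/setP/(_ u).
by rewrite in_setI uE uL inE.
Qed.

Lemma dist_bound I : dist I <= #|T|.+1.
Proof. by rewrite /dist -[X in _ <= X](size_iota 0) find_size. Qed.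

Lemma dist_max I u k : u \in ends false I -> u \in layer I k -> dist I <= #|T|.
Proof. by move=> uE uL; apply: (dist_le uE); apply: (subsetP (layer_stable I k)). Qed.

Lemma dist_gt I k : dist I <= #|T| -> ends false I :&: layer I k = set0 -> k < dist I.
Proof.
move=> dT E; rewrite ltnNge; apply/negP => dk.
have h : has (fun k => ends false I :&: layer I k != set0) (iota 0 #|T|.+1).
  by rewrite has_find size_iota.
have := nth_find 0 h; rewrite -/(dist I) nth_iota // add0n => /set0Pn[u].
rewrite inE => /andP[uE uL].
by have /setP/(_ u) := E; rewrite in_setI uE (subsetP (layer_sub I dk)) // inE.
Qed.

(** * The effect of one exchange on the layers *)

Section Walk.

Variables (I : {set T}) (k : nat) (f x : T).
Hypotheses (cI : cis I) (E : ends false I :&: layer I k = set0).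
Hypotheses (fL : f \in layer I k) (fI : f \in I) (xE : x \in ends false I).
Hypothesis (efx : edge I f x).

Let I' := x |: I :\ f.

Let xI : x \notin I. Proof. by move: xE; rewrite !inE => /and3P[]. Qed.
Let xf : x != f. Proof. by apply: contraNneq xI => ->. Qed.
Let MxI : M false (x |: I). Proof. by move: xE; rewrite !inE => /and3P[]. Qed.
Let Mf : M true I'. Proof. by move: efx; rewrite edge_in // => /andP[]. Qed.

Let notin y : y \in layer I k -> y != x.
Proof.
move=> yL; apply/negP => /eqP yx; rewrite yx in yL.
by have /setP/(_ x) := E; rewrite in_setI xE yL inE.
Qed.

Let not_end y : y \in layer I k -> y \notin I -> ~~ M false (y |: I).
Proof.
move=> yL yI; apply/negP => My; have /setP/(_ y) := E.
by rewrite in_setI yL inE yI My (subsetP (layer_ground I k)) // inE.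
Qed.

Lemma exchange_cis : cis I'.
Proof.
rewrite /cis Mf andbT; apply: indepS MxI.
by rewrite setUS // subsetDl.
Qed.

Lemma exchange_card : #|I'| = #|I|.
Proof. by rewrite cardsU1 !inE (negPf xI) andbF (cardsD1 f I) fI. Qed.

(** Otherwise [y] would lead to [x], and [x] would already belong to [layer I k]. *)
Let not_back m y : m < k -> y \in layer I m -> y \in I ->
  ~~ M true (x |: I :\ y) /\ y != f.
Proof.
move=> mk yL yI; have N : ~~ M true (x |: I :\ y).
  apply/negP => My; have /notin : x \in layer I k.
    apply: (subsetP (layer_sub I mk)); apply: layer_edge yL _.
    by rewrite edge_in // My; move: xE; rewrite inE => /andP[->].
  by rewrite eqxx.
by split=> //; apply: contraNneq N => ->.
Qed.

(** Arcs below layer [k] survive the exchange. In [M true], [x] depends on [I] and on [I :\ v] for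
    the vertices [v] of [I] in these layers, or it would have been reached earlier; so old and new
    set span the same flat and [indep_transfer] applies. In [M false], [x |: I] is independent while
    the outer vertices of these layers cannot be added to [I], so [indep_exchange] applies. *)
Lemma layer_exchange m y : m < k -> y \in layer I m -> y \in layer I' m.
Proof.
move=> mk yL; move: mk; apply: (layer_ind (P := fun m y => m < k -> y \in layer I' m)) yL
    => {m y} [m y yE mk|m y v vL IH e mk|m y IH mk]; last first.
- by apply: (subsetP (layer_subS I' m)); apply: IH; apply: ltnW.
- have mk' := ltnW mk; have vk := subsetP (layer_sub I (ltnW mk')) v vL.
  have yL := layer_edge vL e; have yk := subsetP (layer_sub I (ltnW mk)) y yL.
  apply: (layer_edge (IH mk')).
  have [vI|vI] := boolP (v \in I).
    have yI : y \notin I by rewrite (edge_side e) vI.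
    have [Nx vf] := not_back mk' vL vI.
    have vI' : v \in I' by rewrite !inE vI vf orbT.
    have yI' : y \notin I' by rewrite !inE (negPf yI) (negPf (notin yk)) andbF.
    move: e; rewrite edge_in // edge_in // => /andP[-> My] /=.
    have yv : y != v by apply: contraNneq yI => ->.
    have cvI : M true (I :\ v) by apply: indepS (cis_indep true cI); apply: subsetDl.
    apply: (indep_transfer cvI _ _ _ _ My).
    + by apply: indepS Mf; apply: subsetDl.
    + have := exchange_card; rewrite (cardsD1 v I') vI' (cardsD1 v I) vI.
      by move=> [].
    + move=> z; rewrite !inE; case: (z =P x) => [-> _ //|/= _].
      by do 2![case: eqP] => //=; case: (z \in I).
    + by rewrite !inE (negPf yI) andbF.
  have yI : y \in I by rewrite (edge_side e) vI.
  have [Nx yf] := not_back (mk) yL yI.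
  have yI' : y \in I' by rewrite !inE yI yf orbT.
  have vI' : v \notin I' by rewrite !inE (negPf vI) (negPf (notin vk)) andbF.
  move: e; rewrite edge_out // edge_out // => /andP[-> My] /=.
  have := indep_exchange MxI My (not_end vk vI) yI xI vI.
  apply: indepS; apply/subsetP => z; rewrite !inE.
  by case: eqP => //= _ /andP[->] /=; case: eqP => //= _ /andP[].
have /and3P[yG yI My] : [&& y \in G, y \notin I & M true (y |: I)].
  by move: yE; rewrite inE.
have yk1 : y \in layer I k by apply: (subsetP (layer_sub I (ltnW mk))); apply: layer_ends.
apply: layer_ends; rewrite !inE yG (negPf yI) andbF (negPf (notin yk1)) /=.
apply: (indep_transfer (cis_indep true cI) Mf _ _ yI My); first by rewrite exchange_card.
move=> z; rewrite !inE; case: (z =P x) => [-> _|/= _].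
  apply/negP => Mx; have /notin : x \in layer I k.
    apply: (subsetP (layer_sub I (ltnW mk))); apply: layer_ends.
    by move: xE; rewrite !inE Mx xI => /andP[->].
  by rewrite eqxx.
by case: (z \in I) => //; rewrite andbF.
Qed.

(** The vertex [y] before [f] in the search becomes addable in [M false], because removing [f]
    breaks its circuit. It lies in an early layer, which [layer_exchange] preserves, so the path can
    now begin at [y]. *)
Lemma dist_exchange : dist I' < dist I.
Proof.
have xG : x \in G by move: xE; rewrite inE => /andP[].
case: k E fL notin not_end layer_exchange => [|k'] E0 fL0 nt ne le.
  by rewrite inE in fL0.
have dT : dist I <= #|T| by apply: (dist_max xE (layer_edge fL efx)).
have : k'.+1 < dist I by apply: dist_gt.
apply: leq_ltn_trans.
(* Being in [I], [f] is not in [ends true]; if it were in the previous layer, [x] would be in layer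
   [k]. So [f] was reached through an arc from some [y] outside [I]. *)
have : exists2 y, y \in layer I k' & y \notin I /\ M false (y |: I :\ f).
  move: fL0; rewrite layerS !in_setU => /orP[/orP[|fL1]|].
  - by rewrite inE fI andbF.
  - by have := nt _ (layer_edge fL1 efx); rewrite eqxx.
  - rewrite inE => /exists_inP[y yL e]; exists y => //.
    have yI : y \notin I by move: (edge_side e); rewrite fI; case: (y \in I).
    by move: e; rewrite edge_out // => /andP[].
case=> y yL [yI My].
have yL1 : y \in layer I k'.+1 by apply: (subsetP (layer_subS I k')).
apply: (@dist_le I' _ y); last first.
  by apply: (subsetP (layer_subS I' k')); apply: le.
have yG := subsetP (layer_ground I k') y yL.
rewrite !inE yG (negPf yI) andbF (negPf (nt y yL1)) /=.
have := indep_exchange MxI My (ne y yL1 yI) fI xI yI.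
apply: indepS; apply/subsetP => z; rewrite !inE.
by case: eqP => //= zy; case: eqP => // -> _; rewrite (negPf xf).
Qed.
End Walk.

(* [X] and its complement certify optimality in the min-max theorem:
   [I :&: X] spans [X] in the first matroid, [I :\: X] spans the rest in the
   second one. *)
Lemma closed_max I J X :
  cis I -> cis J -> I :\: G \subset J -> J \subset I :|: G ->
  X \subset G -> ends true I \subset X -> [disjoint ends false I & X] ->
  (forall u v, v \in X -> edge I v u -> u \in X) -> #|J| <= #|I|.
Proof.
move=> cI cJ IJ JG XG EX dX closed.
(* Arcs end in [G] only, so closedness of [X] says nothing about elements of [I] outside [G], which
   may lie on a circuit in the first matroid. They belong to [J] too, so adding them to [X] raises
   both sides of the first count equally. *)
pose U := X :|: (I :\: G).
have out y : y \in X -> y \notin I -> ~~ M false (y |: I :&: U).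
  move=> yX yI; have -> : I :&: U = I :\: (I :\: U) by rewrite setDDr setDv set0U.
  apply: dep_setD => //; first exact: (cis_indep false cI).
  - apply/negP => My; move/pred0Pn: dX; apply; exists y => /=.
    by rewrite yX andbT inE yI My (subsetP XG).
  - exact: subsetDl.
  move=> f; rewrite !inE negb_or => /andP[/andP[fX]].
  rewrite negb_and negbK => fGI fI; move: fGI; rewrite fI orbF => fG.
  apply/negP => Mf; case/negP: fX; apply: (closed _ y) => //.
  by rewrite edge_out // fG.
have inn y : y \in G -> y \notin X -> y \notin I -> ~~ M true (y |: I :\: X).
  move=> yG yX yI; have -> : I :\: X = I :\: (I :&: X) by rewrite setDIr setDv set0U.
  apply: dep_setD => //; first exact: (cis_indep true cI).
  - apply/negP => My; case/negP: yX; apply: (subsetP EX).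
    by rewrite inE yG yI.
  - exact: subsetIl.
  move=> f; rewrite inE => /andP[fI fX]; apply/negP => Mf.
  case/negP: yX; apply: (closed _ f) => //.
  by rewrite edge_in // yG.
have c1 : #|J :&: U| <= #|I :&: U|.
  rewrite leqNgt; apply/negP => lt.
  have MI : M false (I :&: U) by apply: indepS (cis_indep false cI); apply: subsetIl.
  have MJ : M false (J :&: U) by apply: indepS (cis_indep false cJ); apply: subsetIl.
  have [z] := indep_aug MI MJ lt.
  rewrite !inE => /andP[zIU /andP[zJ zU]] Mz.
  have zI : z \notin I by apply: contra zIU => zI; rewrite zI; move: zU; rewrite zI.

  have zX : z \in X by move: zU; rewrite (negPf zI) andbF orbF.
  by have := out z zX zI; rewrite Mz.
have c2 : #|J :\: X| <= #|I :\: X|.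
  rewrite leqNgt; apply/negP => lt.
  have MI : M true (I :\: X) by apply: indepS (cis_indep true cI); apply: subsetDl.
  have MJ : M true (J :\: X) by apply: indepS (cis_indep true cJ); apply: subsetDl.
  have [z] := indep_aug MI MJ lt.
  rewrite !inE => /andP[zIX /andP[zX zJ]] Mz.
  have zI : z \notin I by apply: contra zIX => ->; rewrite andbT.
  have zG : z \in G by have := subsetP JG z zJ; rewrite inE (negPf zI).
  by have := inn z zG zX zI; rewrite Mz.
have split (K : {set T}) : I :\: G \subset K -> #|K :&: U| = #|K :&: X| + #|I :\: G|.
  move=> sK; rewrite /U setIUr (setIidPr sK) cardsU.
  have -> : K :&: X :&: (I :\: G) = set0.
    apply/setP=> z; rewrite !inE; case zX: (z \in X); rewrite ?andbF //.
    by rewrite (subsetP XG) ?andbF.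
  by rewrite cards0 subn0.
rewrite -(cardsID X J) -(cardsID X I); apply: leq_add => //.
by rewrite -(leq_add2r #|I :\: G|) -!split // subsetDl.
Qed.

End ExchangeGraph.

(** * Breadth-first search in the exchange graph *)

Lemma foldl_ind A S (P : seq A -> S -> Prop) (f : S -> A -> S) z l :
  P [::] z -> (forall s a st, P s st -> P (rcons s a) (f st a)) ->
  P l (foldl f z l).
Proof.
move=> P0 PS; elim/last_ind: l => //= s a IH.
by rewrite -cats1 foldl_cat /= cats1; apply: PS.
Qed.

Lemma foldl_iota_ind S (P : nat -> S -> Prop) (f : S -> nat -> S) z m :
  P 0 z -> (forall h st, h < m -> P h st -> P h.+1 (f st h)) ->
  P m (foldl f z (iota 0 m)).
Proof.
move=> P0 PS; have: forall k, k <= m -> P k (foldl f z (iota 0 k)).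
  elim=> // k IH km; rewrite -addn1 iotaD foldl_cat /= add0n addn1.
  by apply: PS => //; apply: IH; apply: ltnW.
exact.
Qed.

Definition oadd (T : finType) (o : option T) (X : {set T}) :=
  if o is Some x then x |: X else X.

Definition odel (T : finType) (o : option T) (X : {set T}) :=
  if o is Some x then X :\ x else X.

Lemma in_oadd (T : finType) (o : option T) X x : (x \in oadd o X) = (Some x == o) || (x \in X).
Proof. by case: o => [y|] //=; rewrite !inE. Qed.

Lemma in_odel (T : finType) (o : option T) X x : (x \in odel o X) = (Some x != o) && (x \in X).
Proof. by case: o => [y|] //=; rewrite !inE. Qed.

Section Search.

Variables (T : finType) (M : bool -> matroid T) (G : {set T}).
Implicit Types (I J : {set T}) (u v x f : T).

Notation edge := (edge M G).
Notation ends := (ends M G).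
Notation layer := (layer M G).
Notation cis := (cis M).
Notation dist := (dist M G).

(* A state is the queue and the exchange found so far (none if the first
   component is [None]; a pair [(Some x, None)] means that [x] can be added). *)
Definition sstate := (seq T * (option T * option T))%type.

Definition push I (st : sstate) u p : sstate :=
  (rcons st.1 u,
   if [&& ~~ isSome st.2.1, u \notin I & M false (u |: I)] then (Some u, p) else st.2).

Definition seed I st u :=
  if [&& u \notin st.1, u \in G, u \notin I & M true (u |: I)] then push I st u None else st.

Definition scan I v (st : sstate) u :=
  if [&& ~~ isSome st.2.1, u \notin st.1 & edge I v u] then push I st u (Some v) else st.

Definition visit I (st : sstate) h :=
  if onth st.1 h is Some v then foldl (scan I v) st (enum T) else st.

Definition seeds I : sstate := foldl (seed I) ([::], (None, None)) (enum T).

(** The queue has no repetitions, so [#|T|] visits process all of it; visits past its end do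
    nothing. *)
Definition step I := (foldl (visit I) (seeds I) (iota 0 #|T|)).2.

(** The last case collects the hypotheses of section [Walk], so that [exchange_cis] and
    [dist_exchange] apply to the pair found. *)
Definition sound I (r : option T * option T) :=
  match r with
  | (None, f) => f = None
  | (Some x, None) => x \in ends false I /\ x \in ends true I
  | (Some x, Some f) => exists k,
      [/\ ends false I :&: layer I k = set0, f \in layer I k, f \in I,
          x \in ends false I & edge I f x]
  end.

(** As long as no exchange is found, the queue is a complete layer followed by part of the next one,
    its first [h] entries have been scanned, and it contains no vertex of [ends false]. The
    disjunction covers the visits made after the queue has run empty. *)
Definition search_inv I h (st : sstate) :=
  [/\ uniq st.1, sound I st.2 &
  st.2.1 = None -> exists k qa qb,
    [/\ st.1 = qa ++ qb, qa =i layer I k, {subset qb <= layer I k.+1},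
        (h <= size qa) || (size st.1 <= size qa) &
    [/\ forall v u, v \in take h st.1 -> edge I v u -> u \in st.1,
        {in st.1, forall u, u \notin ends false I} &
        {subset ends true I <= st.1}]]].

Lemma seeds_inv I : search_inv I 0 (seeds I).
Proof.
have : [/\ uniq (seeds I).1, sound I (seeds I).2,
  (seeds I).2.1 = None -> {in (seeds I).1, forall u, u \notin ends false I} &
  (seeds I).1 =i ends true I].
  have enumE := mem_enum T; rewrite /seeds.
  suff : let st := foldl (seed I) ([::], (None, None)) (enum T) in
    [/\ uniq st.1, sound I st.2,
      st.2.1 = None -> {in st.1, forall u, u \notin ends false I} &
      forall u, (u \in st.1) = (u \in enum T) && (u \in ends true I)].
    case=> ? ? ? H; split=> // u; rewrite H enumE //.
  have: uniq (enum T) by apply: enum_uniq.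
  elim/foldl_ind: (foldl _ _ _) => //= s a st IH.
  rewrite rcons_uniq => /andP[aS /IH[Uq Sd NE Eq]].
  rewrite /seed Eq (negPf aS) /=; case: ifPn => [/and3P[aG aI Ma]|Na]; last first.
    split=> // u; rewrite mem_rcons inE Eq; case: eqP => // ->.
    by rewrite (negPf aS) inE (negPf Na).
  have aE : a \in ends true I by rewrite inE aG aI.
  rewrite /push aI /=; split=> //=.
  - by rewrite rcons_uniq Uq Eq (negPf aS).
  - case: ifP => // /andP[_ Mf]; split=> //.
    by rewrite inE aG aI.
  - move=> H u; rewrite mem_rcons inE => /predU1P[->|uq].
      move: H; case: ifP => // /negbT; rewrite negb_and negbK => H1 H2.
      by move: H1; rewrite H2 /= => N; rewrite inE (negPf N) !andbF.
    by move: H; case: ifP => // _ /NE; apply.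
  - move=> u; rewrite !mem_rcons !inE Eq inE; case: eqP => //= ->.
    by rewrite aG aI Ma.
case=> Uq Sd NE Eq; split=> // rN; exists 0, [::], (seeds I).1; split=> //.
- by move=> u; rewrite !inE.
- by move=> u uq; apply: layer_ends; rewrite -Eq.
split=> //; first by rewrite take0.
- exact: NE.
- by move=> u; rewrite Eq.
Qed.

(** The queue contains all of [layer I k] and nothing of [ends false], so an exchange found from [v]
    satisfies the minimality clause of [sound] with this very [k]. *)
Lemma scan_inv I v q0 st0 k :
  st0 = (q0, (None, None)) -> uniq q0 -> {in q0, forall u, u \notin ends false I} ->
  v \in layer I k -> {subset layer I k <= q0} ->
  let st := foldl (scan I v) st0 (enum T) in
  [/\ uniq st.1, sound I st.2, exists q1, st.1 = q0 ++ q1 /\ {in q1, forall u, edge I v u} &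
      st.2.1 = None -> {in st.1, forall u, u \notin ends false I} /\
         (forall u, edge I v u -> u \in st.1)].
Proof.
move=> -> Uq0 N0 vL Lq.
have E0 : ends false I :&: layer I k = set0.
  apply/setP=> z; rewrite in_setI [RHS]inE; apply/negP => /andP[zE /Lq zq].
  by have := N0 z zq; rewrite zE.
suff : let st := foldl (scan I v) (q0, (None, None)) (enum T) in
  [/\ uniq st.1, sound I st.2,
      exists q1, st.1 = q0 ++ q1 /\ {in q1, forall u, edge I v u} &
      st.2.1 = None -> {in st.1, forall u, u \notin ends false I} /\
         (forall u, u \in enum T -> edge I v u -> u \in st.1)].
  move=> [? ? ? H]; split=> // /H[? H2]; split=> // u; apply: H2.
  by rewrite mem_enum.
elim/foldl_ind: (foldl _ _ _) => /=.
  split=> //; exists [::]; split; rewrite ?cats0 //.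
move=> s a st [Uq Sd [q1 [Eq Hq1]] Hn].
rewrite /scan; case: ifPn => [/and3P[rN aq e]|Na]; last first.
  split=> //; first by exists q1.
  move=> rN; have [? H] := Hn rN; split=> // u; rewrite mem_rcons inE.
  case/predU1P=> [->|us]; last exact: H.
  by move=> e; move: Na; rewrite rN e andbT negbK.
have rN' : st.2.1 = None by case: (st.2.1) rN.
rewrite /push rN /=; split=> //=.
- by rewrite rcons_uniq aq.
- case: ifP => // /andP[aI Mf]; exists k; split=> //.
    by have := edge_side e; rewrite (negPf aI); case: (v \in I).
  by rewrite inE aI Mf; case/and3P: e => ->.
- exists (rcons q1 a); split; first by rewrite Eq rcons_cat.
  by move=> u; rewrite mem_rcons inE => /predU1P[->//|]; apply: Hq1.
have [H1 H2] := Hn rN'; case: ifPn => // NE _; split.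
  move=> u; rewrite mem_rcons inE => /predU1P[->|]; last exact: H1.
  by rewrite inE; apply: contra NE => /andP[].
move=> u; rewrite !mem_rcons !inE => /predU1P[->|us e']; first by rewrite eqxx.
by rewrite (H2 u us e') orbT.
Qed.

Lemma visit_inv I h st : search_inv I h st -> search_inv I h.+1 (visit I st h).
Proof.
case=> Uq Sd Hn; rewrite /visit; case Eh: (onth st.1 h) => [v|]; last first.
  have hs : size st.1 <= h by rewrite -onthNE Eh.
  split=> // /Hn[k [qa [qb [Eq Ea Eb Eh' [H1 H2 H3]]]]].
  exists k, qa, qb; split=> //.
    case/orP: Eh' => [hq|->]; last by rewrite orbT.
    by rewrite (leq_trans hs hq) orbT.
  by split=> // v u; rewrite (take_oversize (leqW hs)) => vq; apply: H1; rewrite take_oversize.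
have hs : h < size st.1 by rewrite -onthTE Eh.
have Ev : v = nth v st.1 h by rewrite (onth_nth _ _ _ _ Eh).
case rN : (st.2.1) => [x|].
  have -> : foldl (scan I v) st (enum T) = st.
    by elim: (enum T) => //= a s IH; rewrite {2}/scan rN /= IH.
  by split=> //; rewrite rN.
have [k [qa [qb [Eq Ea Eb Eh' [H1 H2 H3]]]]] := Hn rN.
have Est : st = (st.1, (None, None)).
  by case: st rN Sd {Hn Uq Eh hs Ev Eq Eh' H1 H2 H3} => q [rx rf] /= -> /= ->.
(* once the current layer is exhausted, the queue holds exactly the next one *)
have {Hn Eb Eh' Ea Eq qa qb} [k' [qa [qb [Eq Ea Eb ha]]]] : exists k qa qb,
   [/\ st.1 = qa ++ qb, qa =i layer I k, {subset qb <= layer I k.+1} & h < size qa].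
  case: (ltnP h (size qa)) => [?|qah]; first by exists k, qa, qb.
  have hE : size qa = h.
    apply/eqP; rewrite eqn_leq qah; case/orP: Eh' => //.
    by move/(leq_trans hs); rewrite ltnNge qah.
  exists k.+1, st.1, [::]; rewrite cats0; split=> // u; apply/idP/idP.
    rewrite Eq mem_cat => /orP[|/Eb//]; rewrite Ea.
    exact: (subsetP (layer_subS _ _ _ _)).
  rewrite layerS /grow !in_setU => /orP[/orP[/H3//|]|].
    by rewrite -Ea Eq mem_cat => ->.
  rewrite inE => /exists_inP[w wL e]; apply: H1 e.
  by rewrite Eq -hE take_size_cat // Ea.
have vL : v \in layer I k' by rewrite -Ea Ev Eq nth_cat ha mem_nth.
have Lq : {subset layer I k' <= st.1} by move=> u; rewrite -Ea Eq mem_cat => ->.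
have [] := scan_inv Est Uq H2 vL Lq.
set st' := foldl _ _ _ => Uq' Sd' [q1 [Eq' Hq1]] Hn'; split=> // /Hn'[H2' H4].
exists k', qa, (qb ++ q1); split=> //.
- by rewrite Eq' Eq catA.
- by move=> u; rewrite mem_cat => /orP[/Eb//|/Hq1]; apply: layer_edge vL.
- by rewrite ha.
split=> //; last by move=> u /H3; rewrite Eq' mem_cat => ->.
move=> w u; rewrite Eq' takel_cat // (take_nth v hs) -Ev mem_rcons inE => /predU1P[->|wq] e.
  by rewrite -Eq'; apply: H4.
by rewrite mem_cat (H1 _ _ wq e).
Qed.

Lemma search_invP I h : let st := foldl (visit I) (seeds I) (iota 0 h) in
  search_inv I h st.
Proof.
apply: foldl_iota_ind; first exact: seeds_inv.
by move=> ? ? _; apply: visit_inv.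
Qed.

Lemma step_sound I : sound I (step I).
Proof. by have [] := search_invP I #|T|. Qed.

(** A fully scanned queue is closed under arcs, contains [ends true] and avoids [ends false]: it is
    the certificate [X] demanded by [closed_max]. *)
Lemma step_none I J : cis I -> (step I).1 = None ->
  cis J -> I :\: G \subset J -> J \subset I :|: G -> #|J| <= #|I|.
Proof.
move=> cI sN cJ IJ JG; have := search_invP I #|T|.
move: sN; rewrite /step; set st := foldl _ _ _ => sN [Uq _ /(_ sN)].
case=> k [qa [qb [Eq Ea Eb _ [H1 H2 H3]]]].
apply: (closed_max (X := [set u in st.1]) cI cJ IJ JG).
- apply/subsetP => u; rewrite inE Eq mem_cat => /orP[|/Eb]; rewrite ?Ea; apply/subsetP/layer_ground.
- by apply/subsetP => u /H3; rewrite inE.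
- by apply/pred0P => u /=; apply/andP => -[uE]; rewrite inE => /H2; rewrite uE.
- move=> u v; rewrite !in_set => vq; apply: H1; rewrite take_oversize //.
  by rewrite -(card_uniqP Uq) max_card.
Qed.

End Search.

(** * Maximum sets by single exchanges, and greedy completion *)

Definition update (T : finType) (r : option T * option T) (I : {set T}) :=
  odel r.2 (oadd r.1 I).

Lemma setU1D1 (T : finType) (x f : T) I : x != f -> (x |: I) :\ f = x |: I :\ f.
Proof. by move=> xf; apply/setP=> z; rewrite !inE; case: (z =P x) => [->|] //; rewrite xf. Qed.

Section Improve.

Variables (T : finType) (M : bool -> matroid T) (G : {set T}).
Implicit Types (I J A : {set T}) (u v x f : T).

Notation cis := (cis M).
Notation dist := (dist M G).
Notation step := (step M G).

Variant step_spec I : option T * option T -> Prop :=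
| StepNone : (forall J, cis J -> I :\: G \subset J -> J \subset I :|: G -> #|J| <= #|I|) ->
    step_spec I (None, None)
| StepAdd x : x \in G -> x \notin I -> cis (x |: I) -> step_spec I (Some x, None)
| StepExchange x f : x \in G -> x \notin I -> f \in G -> f \in I ->
    cis (x |: I :\ f) -> dist (x |: I :\ f) < dist I <= #|T| ->
    step_spec I (Some x, Some f).

Lemma stepP I : cis I -> step_spec I (step I).
Proof.
move=> cI; have := step_sound M G I; have := @step_none _ M G I _ cI.
case: (step I) => [[x|] [f|]] //= sN.
- move=> [k [E fL fI xE e]].
  have [xG xI] : x \in G /\ x \notin I by move: xE; rewrite inE => /and3P[].
  constructor=> //.
  + exact: (subsetP (layer_ground _ _ _ _)) fL.
  + exact: (exchange_cis fI xE e).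
  + rewrite (dist_exchange cI E) //=.
    by apply: (dist_max xE (layer_edge fL e)).
- case; rewrite !inE => /and3P[xG xI M1] /and3P[_ _ M2].
  by constructor; rewrite // /cis M1.
- by move=> _; constructor=> J cJ; apply: sN.
Qed.

Definition improve I := update (step I) I.

(** The number of rounds exceeds every value of the potential in [improve_progress], which is at
    most [#|T| * #|T|.+1 + #|T|]. *)
Definition augmented I := iter (#|T|.+1 * #|T|.+1) improve I.

Lemma improve_cis I : cis I -> cis (improve I).
Proof.
move=> cI; rewrite /improve /update; case: (stepP cI) => //= x f xG xI fG fI cI' _.
by rewrite setU1D1 //; apply: contraNneq xI => ->.
Qed.

Lemma improve_bounds I : cis I ->
  I :\: G \subset improve I /\ improve I \subset I :|: G.
Proof.
move=> cI; rewrite /improve /update; case: (stepP cI) => [_|x xG xI _|x f xG xI fG fI _ _] /=.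
- by rewrite subsetDl subsetUl.
- split; last by rewrite setUC setUS // sub1set.
  by apply: subset_trans (subsetDl _ _) (subsetUr _ _).
- split; apply/subsetP=> z; rewrite !inE.
    by case/andP=> zG ->; rewrite orbT andbT; apply: contraNneq zG => ->.
  by case/andP=> _ /predU1P[->|->] //; rewrite xG orbT.
Qed.

Lemma improve_iter_bounds I k : cis I -> 
  [/\ cis (iter k improve I), I :\: G \subset iter k improve I &
      iter k improve I \subset I :|: G].
Proof.
move=> cI; elim: k => [|k [ck s1 s2]] /=; first by rewrite subsetDl subsetUl.
have [t1 t2] := improve_bounds ck; split; first exact: improve_cis.
  apply/subsetP => z zI; apply: (subsetP t1); rewrite inE (subsetP s1) // andbT.
  by case/setDP: zI.
apply: subset_trans t2 _; rewrite subUset s2; apply: subsetUr.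
Qed.

(** A lexicographic potential: cardinality first, shortness of the path second. An added element
    outweighs any loss in the second term, which is at most [#|T|]; an exchange keeps the
    cardinality and lowers [dist], which was at most [#|T|], so the truncated difference really
    grows. *)
Lemma improve_progress I : cis I -> (step I).1 <> None ->
  #|I| * #|T|.+1 + (#|T| - dist I) <
  #|improve I| * #|T|.+1 + (#|T| - dist (improve I)).
Proof.
move=> cI; rewrite /improve /update; case: (stepP cI) => [//|x xG xI _|x f xG xI fG fI _ dd] /= _.
  rewrite cardsU1 xI /= add1n mulSn addnAC.
  by rewrite addnC ltn_add2r ltn_addr // ltnS leq_subr.
have xf : x != f by apply: contraNneq xI => ->.
rewrite setU1D1 //.
have -> : #|x |: I :\ f| = #|I|.
  by rewrite cardsU1 !inE (negPf xI) andbF (cardsD1 f I) fI.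
by rewrite ltn_add2l; case/andP: dd => d1 d2; rewrite ltn_sub2l // (leq_trans d1).
Qed.

(** Once [step] finds nothing the iteration is stationary; until then each round raises the
    potential, which cannot reach the number of rounds. Elements outside [G] never change, so
    optimality is relative to sets that agree with [I] there. *)
Lemma augmented_max I J : cis I ->
  cis J -> I :\: G \subset J -> J \subset I :|: G -> #|J| <= #|augmented I|.
Proof.
move=> cI cJ IJ JG; set N := #|T|.+1.
have key k : (step (iter k improve I)).1 = None \/
    k <= #|iter k improve I| * N + (#|T| - dist (iter k improve I)).
  elim: k => [|k IH]; first by right.
  have [ck _ _] := improve_iter_bounds k cI.
  case E: ((step (iter k improve I)).1) IH => [x|] IH.
    right; case: IH => // IH; apply: leq_ltn_trans IH _.
    by rewrite iterS; apply: improve_progress => //; rewrite E.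
  left; rewrite iterS /improve.
  have -> : step (iter k improve I) = (None, None) by move: E; case: (stepP ck).
  by rewrite /update /= -/improve E.
have [ck s1 s2] := improve_iter_bounds (N * N) cI.
have {key} [sN|] := key (N * N); last first.
  have := max_card (mem (iter (N * N) improve I)); rewrite /N => c1.
  set c := #|_| in c1 *; set d := dist _; nia.
apply: (step_none ck sN cJ).
  apply/subsetP=> z /setDP[zI zG]; apply: (subsetP IJ); rewrite inE zG.
  by have := subsetP s2 z zI; rewrite inE (negPf zG) orbF.
apply/subsetP=> z /(subsetP JG); rewrite !inE => /orP[zI|->]; last exact: orbT.
by case zG: (z \in G); rewrite ?orbT // (subsetP s1) // inE zG.
Qed.

(** The fixed scanning order makes the completion a function of [I], so parents can be recomputed
    from their children. *)
Definition complete I :=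
  foldl (fun X i => if (i \in G) && cis (i |: X) then i |: X else X) I (enum T).

Lemma complete_inv I :
  [/\ I \subset complete I, cis I -> cis (complete I), complete I \subset I :|: G &
    {in G, forall i, cis (i |: complete I) -> i \in complete I}].
Proof.
suff : [/\ I \subset complete I, cis I -> cis (complete I), complete I \subset I :|: G &
    {in G, forall i, i \in enum T -> cis (i |: complete I) -> i \in complete I}].
  by case=> ? ? ? H; split=> // i iG; apply: H; rewrite // mem_enum.
rewrite /complete; elim/foldl_ind: (foldl _ _ _) => [|s a X [s1 s2 s3 s4]].
  by split=> //; apply: subsetUl.
case: ifP => [/andP[aG cX]|Na].
  split=> //; first exact: subset_trans s1 (subsetUr _ _).
    by rewrite subUset s3 sub1set inE aG orbT.
  move=> i iG; rewrite mem_rcons inE => /predU1P[->|iS] ci; first by rewrite !inE eqxx.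
  rewrite inE s4 ?orbT //; apply: cisS ci; apply: setUS; apply: subsetUr.
split=> // i iG; rewrite mem_rcons inE => /predU1P[ia|iS]; last exact: s4.
by rewrite ia in iG *; rewrite iG /= in Na; rewrite Na.
Qed.

Lemma complete_id I : (forall i, i \in G -> cis (i |: I) -> i \in I) -> complete I = I.
Proof.
move=> H; rewrite /complete; elim/foldl_ind: (foldl _ _ _) => // s a X ->.
case: ifP => // /andP[aG ca]; apply/setUidPr; rewrite sub1set; exact: H.
Qed.

End Improve.

(** * Lexicographic enumeration of the maximum sets *)

Lemma foldl_enum_ind n S (P : nat -> S -> Prop) (f : S -> 'I_n -> S) z :
  P 0 z -> (forall (i : 'I_n) st, P i st -> P i.+1 (f st i)) ->
  P n (foldl f z (enum 'I_n)).
Proof.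
move=> P0 PS.
have -> : foldl f z (enum 'I_n) =
    foldl (fun st k => if insub k is Some i then f st i else st) z (iota 0 n).
  rewrite -val_enum_ord; elim: (enum 'I_n) z {P0} => //= i s IH z.
  by rewrite IH valK.
apply: foldl_iota_ind => // k st kn Pk.
by rewrite insubT; apply: (PS (Ordinal kn)).
Qed.

Section Lex.

Variables (n : nat) (M : bool -> matroid 'I_n) (r : nat).
Implicit Types (A B C X : {set 'I_n}) (i q : 'I_n).

Notation cis := (cis M).

Definition maximum B := cis B && (#|B| == r).

Hypothesis r_max : forall B, cis B -> #|B| <= r.

Definition feasible G A := cis A && (#|augmented M G A| == r).

Definition from p : {set 'I_n} := [set i : 'I_n | p <= i].

Definition below B p := B :&: [set i : 'I_n | i < p].

(** An element is left out whenever the prefix without it can still be completed. One test per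
    element is enough: if the prefix is completable but leaving [q] out is not, then [q] belongs to
    every completion. *)
Definition fill lo X :=
  foldl (fun X q => if (lo <= q) && ~~ feasible (from q.+1) X then q |: X else X) X (enum 'I_n).

(** The last index outside [B] at which a maximum set can depart from [B] by containing it. Later
    finds overwrite earlier ones, hence the successor of [B] shares the longest possible prefix with
    it. *)
Definition branch B :=
  foldl (fun pos i => if (i \notin B) && feasible (from i.+1) (i |: below B i)
                      then Some i else pos) None (enum 'I_n).

Definition next_max B :=
  if branch B is Some i then Some (fill i.+1 (i |: below B i)) else None.

(** Lexicographic order of characteristic vectors, with absence before presence. *)
Definition lexlt B C := exists i, [/\ i \notin B, i \in C & below B i = below C i].

Lemma belowP B C p : (forall i, i < p -> (i \in B) = (i \in C)) <-> below B p = below C p.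
Proof.
split=> [H|/setP H i ip]; last by have := H i; rewrite !inE ip !andbT.
by apply/setP=> i; rewrite !inE; case ip: (i < p); rewrite ?andbF // H.
Qed.

Lemma lexlt_irr B : ~ lexlt B B.
Proof. by case=> i [/negPf->]. Qed.

Lemma lexlt_trans B C D : lexlt B C -> lexlt C D -> lexlt B D.
Proof.
case=> i [iB iC /belowP BC] [j [jC jD /belowP CD]].
have [ij|ji|/val_inj ij] := ltngtP i j; last by rewrite -ij iC in jC.
  exists i; split; rewrite -?CD //; apply/belowP => k ki.
  by rewrite BC // CD // (ltn_trans ki).
exists j; split; rewrite ?BC //; apply/belowP => k kj.
by rewrite BC ?CD // (ltn_trans kj).
Qed.

(** Augmentation inside [from p] never touches the prefix [X], so a result of cardinality [r] is
    itself a completion; conversely a completion is one of the competitors in [augmented_max]. *)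
Lemma feasibleP p X : X \subset ~: from p ->
  reflect (exists2 C, maximum C & below C p = X) (feasible (from p) X).
Proof.
move=> Xp; apply: (iffP andP) => [[cX /eqP cr]|[C /andP[cC /eqP rC] CX]].
  have [cA s1 s2] := improve_iter_bounds (from p) (#|'I_n|.+1 * #|'I_n|.+1) cX.
  exists (augmented M (from p) X); first by rewrite /maximum cA cr eqxx.
  apply/setP=> i; rewrite inE [i \in [set _ | _]]inE ltnNge.
  apply/andP/idP => [[/(subsetP s2)]|iX].
    by rewrite inE inE; case: (p <= i); rewrite ?orbT // orbF.
  have := subsetP Xp i iX; rewrite !inE => pi; split=> //.
  by apply: (subsetP s1); rewrite inE iX inE pi.
have cX : cis X by apply: cisS cC; rewrite -CX subsetIl.
split=> //; rewrite eqn_leq -{2}rC; have [cA s1 s2] := improve_iter_bounds (from p) (#|'I_n|.+1 * #|'I_n|.+1) cX.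
rewrite r_max //=; apply: augmented_max => //.
  by rewrite -CX; apply: subset_trans (subsetDl _ _) (subsetIl _ _).
apply/subsetP => i iC; rewrite -CX !inE iC ltnNge /=.
by case: (p <= i).
Qed.

Lemma below_sub B p (q : nat) : p <= q -> below (below B q) p = below B p.
Proof.
move=> pq; apply/setP=> i; rewrite !inE -andbA; congr (_ && _).
by case ip: (i < p); rewrite ?andbF // (leq_trans ip).
Qed.

Lemma prefix_from B i : i |: below B i \subset ~: from i.+1.
Proof.
rewrite subUset sub1set !inE ltnn /=; apply/subsetP => j.
by rewrite !inE -ltnNge ltnS => /andP[_ /ltnW].
Qed.

Lemma belowS B (i : 'I_n) : below B i.+1 = if i \in B then i |: below B i else below B i.
Proof.
apply/setP=> j; have E : (j <= i) = (j == i) || (j < i) by rewrite leq_eqVlt.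
rewrite [in RHS]fun_if; case iB: (i \in B); rewrite !inE ltnS E;
  by case: (j =P i) => // ->; rewrite ?iB ?ltnn.
Qed.

Lemma below_add B (i : 'I_n) p : p <= i -> below (i |: B) p = below B p.
Proof.
move=> pi; apply/belowP => j jp; rewrite !inE.
by case: eqP => // ji; rewrite ji ltnNge pi in jp.
Qed.

Lemma below_all B : below B n = B.
Proof. by apply/setP=> i; rewrite !inE ltn_ord andbT. Qed.

Lemma fill_spec lo X : X \subset ~: from lo -> lo <= n -> 
  (exists2 C, maximum C & below C lo = X) ->
  [/\ maximum (fill lo X), below (fill lo X) lo = X &
  forall C, maximum C -> below C lo = X -> C = fill lo X \/ lexlt (fill lo X) C].
Proof.
move=> Xlo lon exC.
(* The loop runs over all indices but decides only those from [lo] on, so after [k] rounds the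
   decided prefix has length [maxn lo k]. A set that left the construction earlier did so by
   containing an element that was left out. *)
pose P k (Y : {set 'I_n}) := [/\ Y \subset ~: from (maxn lo k), below Y lo = X,
  exists2 C, maximum C & below C (maxn lo k) = Y &
  forall C, maximum C -> below C lo = X -> below C (maxn lo k) = Y \/
    exists i, [/\ i < maxn lo k, i \notin Y, i \in C & below Y i = below C i]].
have : P n (fill lo X).
  apply: foldl_enum_ind; rewrite /P ?maxn0.
    split=> //; last by move=> C _ ->; left.
    apply/setP=> i; rewrite !inE; case iX: (i \in X) => //=.
    by have := subsetP Xlo i iX; rewrite !inE ltnNge.
  move=> i Y [Ys YX [C mC CY] HY]; case: (leqP lo i) => [loi|ilo] /=; last first.
    by rewrite (maxn_idPl ilo) in Ys CY HY *; rewrite (maxn_idPl (ltnW ilo)) in Ys CY HY; split=> //; exists C.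
  rewrite (maxn_idPr loi) in Ys CY HY; rewrite (maxn_idPr (leqW loi)).
  have iY : i \notin Y by apply/negP => /(subsetP Ys); rewrite !inE leqnn.
  have Ys' : Y \subset ~: from i.+1.
    by apply: subset_trans Ys _; apply/subsetP => j; rewrite !inE -!ltnNge ltnS => /ltnW.
  have keep (D : {set 'I_n}) : (exists j : 'I_n, [/\ j < i, j \notin Y, j \in D & below Y j = below D j]) ->
      forall Z, Z = Y \/ Z = i |: Y ->
      exists j : 'I_n, [/\ j < i.+1, j \notin Z, j \in D & below Z j = below D j].
    case=> j [ji jY jD E] Z EZ; exists j; rewrite ltnW //; split=> //.
      by case: EZ => ->; rewrite // !inE negb_or jY andbT neq_ltn ji.
    by case: EZ => ->; rewrite // below_add // ltnW.
  case: feasibleP => // [[D mD DY]|NF] /=.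
    split=> //; first by exists D.
    move=> E mE /(HY E mE)[EY|/keep]; last by move=> H; right; apply: H; left.
    case iE: (i \in E); last by left; rewrite belowS iE.
    by right; exists i; split=> //; rewrite -EY below_sub.
  have inn (E : {set 'I_n}) : maximum E -> below E i = Y -> i \in E.
    move=> mE EY; apply/negPn/negP => iE; apply: NF; exists E => //.
    by rewrite belowS (negPf iE).
  split.
  - rewrite subUset Ys' sub1set !inE ltnn //.
  - by rewrite below_add.
  - by exists C => //; rewrite belowS inn // CY.
  - move=> E mE /(HY E mE)[EY|/keep]; last by move=> H; right; apply: H; right.
    by left; rewrite belowS inn // EY.
rewrite /P (maxn_idPr lon) => -[_ YX [C mC]]; rewrite below_all => EY HY.
split=> //; first by rewrite -EY.
move=> D mD /(HY D mD)[|[i [_ iY iD E]]]; rewrite ?below_all; first by left.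
by right; exists i.
Qed.

Lemma branch_spec B : 
  match branch B with
  | None => forall i C, maximum C -> ~ [/\ i \notin B, i \in C & below B i = below C i]
  | Some i => [/\ i \notin B, exists2 C, maximum C & below C i.+1 = i |: below B i &
     forall j C, maximum C -> [/\ j \notin B, j \in C & below B j = below C j] -> j <= i]
  end.
Proof.
pose P k (pos : option 'I_n) := match pos with
  | None => forall (i : 'I_n) C, i < k -> maximum C -> ~ [/\ i \notin B, i \in C & below B i = below C i]
  | Some i => [/\ i < k, i \notin B, exists2 C, maximum C & below C i.+1 = i |: below B i &
     forall (j : 'I_n) C, j < k -> maximum C -> [/\ j \notin B, j \in C & below B j = below C j] -> j <= i]
  end.
have : P n (branch B).
  apply: foldl_enum_ind => // i pos Hp.
  have sub := prefix_from B i.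
  have cert (C : {set 'I_n}) : maximum C -> [/\ i \notin B, i \in C & below B i = below C i] ->
      (i \notin B) && feasible (from i.+1) (i |: below B i).
    by move=> mC [-> iC E]; apply/feasibleP => //; exists C => //; rewrite belowS iC E.
  case: ifPn => [/andP[iB /feasibleP[//|C mC CE]]|NF].
    by split=> //; exists C.
  case: pos Hp => [k [ki kB exC Hk]|Hn] /=.
    split=> //; first exact: ltnW.
    move=> j C; rewrite ltnS leq_eqVlt => /predU1P[/val_inj-> mC /(cert C mC)|]; last exact: Hk.
    by rewrite (negPf NF).
  move=> j C; rewrite ltnS leq_eqVlt => /predU1P[/val_inj-> mC /(cert C mC)|]; last exact: Hn.
  by rewrite (negPf NF).
rewrite /P; case: (branch B) => [i [_ iB exC H]|H].
  by split=> // j C; apply: H.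
by move=> i C; apply: H.
Qed.

(** A later set departs from [B] at some [j], at most the branching index [i]. For [j < i] it also
    comes after the successor, which agrees with [B] below [i]; for [j = i] it competes in the
    minimality of [fill]. *)
Lemma next_maxP B : maximum B ->
  match next_max B with
  | None => forall C, maximum C -> ~ lexlt B C
  | Some B' => [/\ maximum B', lexlt B B' &
      forall C, maximum C -> lexlt B C -> C = B' \/ lexlt B' C]
  end.
Proof.
move=> mB; have := branch_spec B; rewrite /next_max; case: (branch B) => [i [iB exC H]|H]; last first.
  by move=> C mC [i Hi]; apply: (H i C).
have [mF EF HF] := fill_spec (prefix_from B i) (ltn_ord i) exC.
set F := fill _ _ in mF EF HF *.
have iF : i \in F by have /setP/(_ i) := EF; rewrite !inE eqxx ltnSn andbT.
have EFi : below F i = below B i.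
  by rewrite -(@below_sub F i i.+1) // EF below_add // below_sub.
split=> //; first by exists i.
move=> C mC [j [jB jC E]]; have : j <= i by apply: (H j C mC).
rewrite leq_eqVlt => /predU1P[/val_inj ji|ji]; last first.
  right; exists j; split=> //.
    have /belowP := EFi => /(_ j ji) ->; exact: jB.
  by rewrite -E -(@below_sub F j i) ?(ltnW ji) // EFi below_sub // ltnW.
by subst j; apply: HF => //; rewrite belowS jC E.
Qed.

End Lex.

(** * Reverse search *)

Lemma uniq_flatten_map (A B : eqType) (f : A -> seq B) s :
  uniq s -> {in s, forall x, uniq (f x)} ->
  {in s &, forall x y z, z \in f x -> z \in f y -> x = y} ->
  uniq (flatten (map f s)).
Proof.
elim: s => //= x s IH /andP[xs Us] Uf D; rewrite cat_uniq Uf ?mem_head //=.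
rewrite IH // ?andbT; first last.
- by move=> y z ys zs; apply: D; rewrite inE ?ys ?zs orbT.
- by move=> y ys; apply: Uf; rewrite inE ys orbT.
apply/hasPn => z /flatten_mapP[y ys zy]; apply/negP => zx; case/negP: xs.
by rewrite (D x y _ _ z zx zy) ?mem_head // inE ys orbT.
Qed.

Lemma filter_split (A : eqType) (a : pred A) s m t :
  [seq x <- s | a x] = m :: t ->
  exists s1 s2, [/\ s = s1 ++ m :: s2, [seq x <- s1 | a x] = [::], a m & t = [seq x <- s2 | a x]].
Proof.
elim: s => //= x s IH; case: ifP => [ax [<- <-]|ax /IH[s1 [s2 [-> E am ->]]]].
  by exists [::], s.
by exists (x :: s1), s2; rewrite /= ax.
Qed.

Section ReverseSearch.

Variables (V Mv : eqType) (moves : seq Mv) (root : V) (nd : pred V).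
Variables (par : V -> V) (mv : V -> V -> Mv) (cand : V -> Mv -> V).
Variables (rank lev : V -> nat) (B n : nat).

Hypothesis moves_uniq : uniq moves.
Hypothesis nd_root : nd root.
Hypothesis par_root : par root = root.
Hypothesis nd_par : forall u, nd u -> u != root ->
  [/\ nd (par u), rank (par u) < rank u,
      cand (par u) (mv (par u) u) = u & mv (par u) u \in moves].
Hypothesis rank_le : forall u, nd u -> rank u <= B.

Definition child v m :=
  let u := cand v m in [&& nd u, u != root, par u == v & mv v u == m].

Definition rest pos := if pos is Some m then drop (index m moves).+1 moves else moves.

Definition advance (c : V * option Mv) : option (V * option Mv) :=
  if ohead [seq m <- rest c.2 | child c.1 m] is Some m then Some (cand c.1 m, None)
  else if c.1 == root then None else Some (par c.1, Some (mv (par c.1) c.1)).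

(** The list collects the nodes entered by a descent, marked by [None]. The starting node and the
    nodes returned to by a pop are not recorded. *)
Inductive reach c : nat -> seq V -> V * option Mv -> Prop :=
| Reach0 : reach c 0 [::] c
| ReachS t l c1 c2 : reach c t l c1 -> advance c1 = Some c2 ->
    reach c t.+1 (l ++ (if c2.2 is None then [:: c2.1] else [::])) c2.

(** The preorder of the subtree at [v], with fuel [k]. Ranks grow from parent to child and are at
    most [B], so the fuel is sufficient when [B < rank v + k]. *)
Fixpoint tree k v :=
  v :: if k is k'.+1 then flatten [seq tree k' (cand v m) | m <- moves & child v m]
       else [::].

Lemma reach_trans a s l b t k c : reach a s l b -> reach b t k c -> reach a (s + t) (l ++ k) c.
Proof.
move=> ab; elim=> [|{}t {}k c1 c2 _ IH N]; first by rewrite addn0 cats0.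
by rewrite addnS catA; apply: ReachS IH N.
Qed.

Lemma reach_det c t l c1 l' c1' : reach c t l c1 -> reach c t l' c1' -> l = l' /\ c1 = c1'.
Proof.
move=> H; elim: H l' c1' => [l' c1' H|{}t {}l c2 c3 _ IH N l' c1' H].
  by inversion H.
inversion H as [|? k c4 ? H1 H2]; subst.
by have [? ?] := IH _ _ H1; subst; move: H2; rewrite N => -[->].
Qed.

Lemma reach_prefix c t l c1 s : reach c t l c1 -> s <= t ->
  exists l' c1', reach c s l' c1' /\ prefix l' l.
Proof.
elim=> [|{}t {}l c2 c3 R IH N].
  by rewrite leqn0 => /eqP->; exists [::], c; split; [left | ].
rewrite leq_eqVlt => /predU1P[->|st].
  by eexists _, _; split; [apply: ReachS R N | apply: prefix_refl].
have [l' [c' [R' P]]] := IH st; exists l', c'; split=> //.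
by apply: prefix_trans P _; apply: prefix_prefix.
Qed.

Lemma reach_next_none c t l c1 T L C :
  reach c t l c1 -> reach c T L C -> advance C = None -> t <= T.
Proof.
move=> H1 H2 N; rewrite leqNgt; apply/negP => lt.
have [l' [c' [R _]]] := reach_prefix H1 lt.
inversion R as [|? ? c2 ? R1 R2]; subst.
by have [_ E] := reach_det H2 R1; rewrite -E N in R2.
Qed.

Lemma childP v m : child v m ->
  [/\ nd (cand v m), cand v m != root, par (cand v m) = v & mv v (cand v m) = m].
Proof. by case/and4P=> ? ? /eqP ? /eqP ?. Qed.

(** Since no move is repeated, a pop that knows only [m] resumes exactly where the scan was
    interrupted. *)
Lemma rest_some s1 m s2 pos : rest pos = s1 ++ m :: s2 -> rest (Some m) = s2.
Proof.
move=> E; have [s0 Em] : exists s0, moves = s0 ++ m :: s2.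
  case: pos E => [p|] /= E; last by exists s1.
  exists (take (index p moves).+1 moves ++ s1).
  by rewrite -catA -E cat_take_drop.
have := moves_uniq; rewrite /rest Em cat_uniq => /and3P[_ D _].
rewrite index_cat; case: ifP D => [ms0 D|_ _].
  by case/negP: D; apply/hasP; exists m; rewrite ?mem_head.
by rewrite /= eqxx addn0 -cat_rcons drop_size_cat ?size_rcons.
Qed.

(** Outer induction on the fuel handles the subtrees, inner induction on the remaining moves handles
    the siblings. Each child costs a descent, its own traversal and a pop; [behead] is there because
    the starting node is not recorded. *)
Lemma tree_run k v : nd v -> B < rank v + k ->
  exists t pos, reach (v, None) t (behead (tree k v)) (v, pos) /\
    [seq m <- rest pos | child v m] = [::].
Proof.
elim: k v => [|k IH] v nv Bk; first by have := rank_le nv; rewrite addn0 in Bk; lia.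
suff : forall pos, exists t pos', reach (v, pos) t
    (flatten [seq tree k (cand v m) | m <- rest pos & child v m]) (v, pos') /\
    [seq m <- rest pos' | child v m] = [::] by move/(_ None).
move=> pos; have [N] := ubnP (size (rest pos)); elim: N pos => // N IHN pos ltN.
case E: [seq m <- rest pos | child v m] => [|m s] /=.
  by exists 0, pos; split=> //; left.
have [s1 [s2 [Er E1 cm Es]]] := filter_split E.
have Er' := rest_some Er; have [nu ur Ep Em] := childP cm.
set u := cand v m in nu ur Ep Em.
have [t1 [p1 [R1 F1]]] : exists t pos, reach (u, None) t (behead (tree k u)) (u, pos) /\
    [seq m <- rest pos | child u m] = [::].
  apply: IH => //; have [_ + _ _] := nd_par nu ur; rewrite Ep => lr.
  apply: leq_trans Bk _; rewrite addnS -addSn leq_add2r; exact: lr.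
have [|t2 [p2 [R2 F2]]] := IHN (Some m).
  rewrite Er' -ltnS; apply: leq_trans ltN; rewrite Er size_cat /= addnS !ltnS; exact: leq_addl.
exists (1 + t1 + 1 + t2), p2; split=> //.
have H1 : reach (v, pos) 1 [:: u] (u, None).
  have H : advance (v, pos) = Some (u, None) by rewrite /advance /= E.
  exact: (ReachS (Reach0 _) H).
have H3 : reach (u, p1) 1 [::] (v, Some m).
  have H : advance (u, p1) = Some (v, Some m) by rewrite /advance /= F1 (negPf ur) Ep Em.
  exact: (ReachS (Reach0 _) H).
have := reach_trans (reach_trans (reach_trans H1 R1) H3) R2.
by rewrite cats0 Er' -Es; case: (k).
Qed.

Lemma tree_nd k v w : nd v -> w \in tree k v -> nd w.
Proof.
elim: k v => [|k IH] v nv /=; rewrite inE; first by move/eqP->.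
case/predU1P=> [->//|].
case/flatten_mapP=> m; rewrite mem_filter => /andP[/childP[nu _ _ _] _].
exact: IH.
Qed.

Lemma nd_par_all u : nd u -> nd (par u) /\ rank (par u) <= rank u.
Proof.
move=> nu; have [->|ur] := eqVneq u root; first by rewrite par_root.
by have [? ? _ _] := nd_par nu ur; split=> //; apply: ltnW.
Qed.

Lemma nd_iter u i : nd u -> nd (iter i par u) /\ rank (iter i par u) <= rank u.
Proof.
move=> nu; elim: i => //= i [ni ri]; have [? r'] := nd_par_all ni.
by split=> //; apply: leq_trans r' ri.
Qed.

Lemma tree_iter k v w : w \in tree k v -> exists i, iter i par w = v.
Proof.
elim: k v => [|k IH] v /=; rewrite inE; first by move/eqP->; exists 0.
case/predU1P=> [->|]; first by exists 0.
case/flatten_mapP=> m; rewrite mem_filter => /andP[/childP[nu _ Ep _] _].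
by case/IH=> i Ei; exists i.+1; rewrite iterS Ei.
Qed.

Lemma tree_uniq k v : nd v -> uniq (tree k v).
Proof.
elim: k v => [|k IH] v nv //=; apply/andP; split.
  apply/negP => /flatten_mapP[m]; rewrite mem_filter => /andP[/childP[nu ur Ep _] _].
  case/tree_iter => i Ei; have [_ ri] := nd_iter i nv.
  by have [_ lt _ _] := nd_par nu ur; rewrite Ep -Ei ltnNge ri in lt.
apply: uniq_flatten_map.
- exact: filter_uniq.
- by move=> m; rewrite mem_filter => /andP[/childP[nu _ _ _] _]; apply: IH.
(* If [z] lay below two children at different heights, the second child would be an iterated parent
   of [v]; but iterating [par] does not raise the rank, whereas a child has a larger rank than
   [v]. *)
have main m1 m2 i j z : child v m1 -> child v m2 ->
    iter i par z = cand v m1 -> iter j par z = cand v m2 -> i <= j -> m1 = m2.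
  move=> /childP[n1 r1 p1 e1] /childP[n2 r2 p2 e2] E1 E2 ij.
  move: E2; rewrite -(subnK ij) iterD E1.
  case: (j - i) => [|d] /=; first by move=> /= E; rewrite -e1 -e2 E.
  rewrite -iterS iterSr p1 => E2; have [_ ri] := nd_iter d nv.
  by have [_ lt _ _] := nd_par n2 r2; rewrite p2 -E2 ltnNge ri in lt.
move=> m1 m2; rewrite !mem_filter => /andP[c1 _] /andP[c2 _] z /tree_iter[i E1] /tree_iter[j E2].
case: (leqP i j) => ij; first exact: (main _ _ i j z).
by apply/esym; apply: (main _ _ j i z) => //; apply: ltnW.
Qed.

Lemma tree_child k v u : nd v -> B < rank v + k -> nd u -> u != root ->
  par u \in tree k v -> u \in tree k v.
Proof.
move=> + + nu ur; elim: k v => [|k IH] v nv Bk.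
  by have := rank_le nv; rewrite addn0 in Bk; lia.
have [_ lt Ec mm] := nd_par nu ur.
rewrite /= inE => /predU1P[E|].
  rewrite inE; apply/orP; right; apply/flatten_mapP; exists (mv v u).
    by rewrite mem_filter -E mm andbT /child Ec nu ur !eqxx.
  by rewrite -E Ec; case: (k) => [|k'] /=; rewrite inE eqxx.
case/flatten_mapP=> m mf pu; rewrite inE; apply/orP; right; apply/flatten_mapP; exists m => //.
move: mf; rewrite mem_filter => /andP[/childP[n1 r1 p1 _] _]; apply: IH => //.
have [_ + _ _] := nd_par n1 r1; rewrite p1 => lr.
apply: leq_trans Bk _; rewrite addnS -addSn leq_add2r; exact: lr.
Qed.

Lemma tree_complete u : nd u -> u \in tree B.+1 root.
Proof.
have [k] := ubnP (rank u); elim: k u => // k IH u ru nu.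
have [->|ur] := eqVneq u root; first by rewrite inE eqxx.
have [np lt _ _] := nd_par nu ur; apply: tree_child => //.
  by rewrite addnS ltnS leq_addl.
by apply: IH => //; apply: leq_trans lt _; rewrite -ltnS.
Qed.

Theorem search_complete : exists T L C,
  [/\ reach (root, None) T L C, advance C = None, uniq (root :: L) & root :: L =i nd].
Proof.
have Bk : B < rank root + B.+1 by rewrite addnS ltnS leq_addl.
have [t [pos [R F]]] := tree_run nd_root Bk.
exists t, (behead (tree B.+1 root)), (root, pos); split=> //.
- by rewrite /advance /= F eqxx.
- by have := tree_uniq B.+1 nd_root.
move=> u; have -> : root :: behead (tree B.+1 root) = tree B.+1 root by [].
by apply/idP/idP; [apply: tree_nd | apply: tree_complete].
Qed.

Lemma advance_nd c c' : nd c.1 -> advance c = Some c' -> nd c'.1.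
Proof.
case: c => v pos /= nv; rewrite /advance /=.
case E: [seq m <- rest pos | child v m] => [|m s] /=.
  by case: eqP => // _ [<-] /=; have [] := nd_par_all nv.
have : m \in [seq m <- rest pos | child v m] by rewrite E mem_head.
by rewrite mem_filter => /andP[/childP[? _ _ _] _] [<-].
Qed.

Lemma reach_nd t l c : reach (root, None) t l c -> nd c.1 /\ all nd l.
Proof.
elim=> {t l c} [|t l c1 c2 _ [nc al] N] //.
have n2 := advance_nd nc N; split=> //; rewrite all_cat al /=.
by case: (c2.2) => //=; rewrite n2.
Qed.

(* Every pop undoes a descent, so at least half of the steps are visits. *)
Lemma reach_steps t l c : reach (root, None) t l c ->
  exists d, [/\ t + d = 2 * size l, iter d par c.1 = root &
    forall i, i < d -> iter i par c.1 != root].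
Proof.
elim=> {t l c} [|t l [v pos] c2 _ [d [Et Ei Er]] N]; first by exists 0.
move: N; rewrite /advance /=.
case E: [seq m <- rest pos | child v m] => [|m s] /=.
  case: (eqVneq v root) => // vr [<-] /=; rewrite cats0.
  case: d Et Ei Er => [|d] Et Ei Er; first by rewrite /= in Ei; rewrite Ei eqxx in vr.
  exists d; split; first by rewrite -Et addnS addSn.
    by rewrite -iterSr.
  by move=> i id; have := Er i.+1 id; rewrite iterSr.
have : m \in [seq m <- rest pos | child v m] by rewrite E mem_head.
rewrite mem_filter => /andP[/childP[nu ur pu _] _] [<-] /=.
exists d.+1; split; first by rewrite size_cat /= mulnDr -Et muln1 addn2 addnS addSn.
  by rewrite iterSr pu.
by case=> [|i] //= id; rewrite -iterS iterSr pu Er.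
Qed.

Hypothesis lev_le : forall v, nd v -> lev v <= n.
Hypothesis first_child : forall v, nd v -> lev v < n ->
  exists2 u, advance (v, None) = Some (u, None) & lev u = (lev v).+1.

(** The last summand pays for the current chain of fresh descents. Such a chain gains a level with
    every node and cannot be interrupted by a pop before level [n], so when it reaches a leaf its at
    most [n.+1] nodes are charged to that leaf. *)
Lemma reach_leaves t l c : reach (root, None) t l c ->
  (size l).+1 <= n.+1 * count (fun v => lev v == n) (root :: l) +
    (if c.2 is None then (if lev c.1 < n then (lev c.1).+1 else 0) else 0).
Proof.
elim=> {t l c} [|t l [v pos] c2 R IH N] /=.
  case: (ltngtP (lev root) n) (lev_le nd_root) => //= _ _; rewrite ?addnS ?addn0 ?muln1 //.
have nv : nd v by have [] := reach_nd R.
have n2 : nd c2.1 by apply: advance_nd N.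
case E2: (c2.2) => [m|].
  rewrite cats0 addn0; case: pos R IH N => [p|] R /=; first by rewrite addn0.
  case: (ltnP (lev v) n) => [lt _ N|_]; last by rewrite addn0.
  by have [u + _] := first_child nv lt; rewrite N => -[E]; rewrite E in E2.
rewrite size_cat count_cat /= addn1 addn0.
set K := (lev root == n) + count (fun v => lev v == n) l in IH *.
have {}IH : (size l).+1 <= n.+1 * K + lev c2.1.
  case: pos R IH N => [p|] R /=; first by rewrite addn0 => H _; apply: leq_trans H (leq_addr _ _).
  case: (ltnP (lev v) n) => [lt H N|_ H _]; last by rewrite addn0 in H; apply: leq_trans H (leq_addr _ _).
  by have [u + Lu] := first_child nv lt; rewrite N => -[E]; rewrite E /= Lu.
rewrite addnA -/K mulnDr; case: (ltngtP (lev c2.1) n) (lev_le n2) => //= E _; rewrite ?muln0 ?muln1 ?addn0; first by rewrite addnS ltnS.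
by rewrite E in IH; rewrite addnS ltnS.
Qed.

End ReverseSearch.

(** * The search tree for a given threshold *)

Definition first2 n (X : {set 'I_n}) := (onth (enum X) 0, onth (enum X) 1).

Lemma enum_small n (X : {set 'I_n}) : #|X| <= 2 ->
  X = oadd (first2 X).1 (oadd (first2 X).2 set0).
Proof.
rewrite /first2 cardE => cX; apply/setP => x; rewrite -mem_enum.
case: (enum X) cX => [|a [|b [|c s]]] //= _; first by rewrite !inE.
  by rewrite !inE orbF.
by rewrite !inE orbF.
Qed.

Section Levels.

Variables (n : nat) (M : bool -> matroid 'I_n) (R : {set 'I_n}) (tau : nat).
Implicit Types (I K G : {set 'I_n}) (u v : nat * {set 'I_n}).

Notation cis := (cis M).

Hypothesis R_cis : cis R.
Hypothesis tau_lt : tau < #|R|.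

Definition ground j := R :|: [set i : 'I_n | i < j].

Definition maximal_in G I := [&& cis I, I \subset G & complete M G I == I].

Definition node v := [&& v.1 <= n, maximal_in (ground v.1) v.2 & tau <= #|v.2|].

(** A node of level 0 is its own parent, as the abstract traversal demands of the root. In the last
    case the level stays the same. *)
Definition parent u :=
  if u.1 is j.+1 then
    if insub j is Some i then
      if (i \notin u.2) || (i \in R) then (j, u.2)
      else if tau < #|u.2| then (j, complete M (ground j) (u.2 :\ i))
      else (j.+1, complete M (ground j.+1) (improve M (ground j.+1) u.2))
    else u
  else u.

Definition move := (bool * (option 'I_n * (option 'I_n * option 'I_n)))%type.

Definition opts : seq (option 'I_n) := rcons [seq Some i | i <- enum 'I_n] None.

Definition triples := [seq (f, p) | f <- opts, p <- [seq (a, b) | a <- opts, b <- opts]].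

(** Moves with [false], which raise the level, come first; [first_child] depends on this order. A
    move adds at most one element and removes at most two, with [None] for an absent one. *)
Definition moves : seq move := [seq (l, t) | l <- [:: false; true], t <- triples].

Definition move_to v u : move :=
  (u.1 == v.1, ((first2 (u.2 :\: v.2)).1, first2 (v.2 :\: u.2))).

Definition apply_move v (m : move) : nat * {set 'I_n} :=
  (v.1 + ~~ m.1, oadd m.2.1 (odel m.2.2.2 (odel m.2.2.1 v.2))).

(** A lexicographic measure: the level, and at the threshold the length of a shortest augmenting
    path. As [dist] is at most [n.+1], the second summand is at most [n.+2], so the weight [n.+3]
    lets the level dominate. The successor puts sets at the threshold above larger sets of the same
    level, which get 0. *)
Definition rank u := u.1 * n.+3 + (if #|u.2| <= tau then (dist M (ground u.1) u.2).+1 else 0).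

Lemma maximal_inP G I : reflect
  [/\ cis I, I \subset G & {in G, forall i, cis (i |: I) -> i \in I}]
  (maximal_in G I).
Proof.
apply: (iffP and3P) => [[cI IG /eqP E]|[cI IG H]]; split=> //.
  by have [_ _ _] := complete_inv M G I; rewrite E.
by apply/eqP/complete_id => i iG; apply: H.
Qed.

Lemma complete_maximal G I : cis I -> I \subset G -> maximal_in G (complete M G I).
Proof.
move=> cI IG; have [s1 c1 s2 H] := complete_inv M G I; apply/maximal_inP; split=> //.
  exact: c1.
by apply: subset_trans s2 _; rewrite subUset IG subxx.
Qed.

Lemma mem_opts o : o \in opts.
Proof.
rewrite /opts mem_rcons inE; case: o => [i|] //=.
by apply: map_f; rewrite mem_enum.
Qed.

Lemma opts_uniq : uniq opts.
Proof.
rewrite /opts rcons_uniq map_inj_uniq ?enum_uniq ?andbT; last by move=> ? ? [].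
by apply/negP => /mapP[].
Qed.

Lemma moves_uniq : uniq moves.
Proof.
by rewrite /moves /triples !allpairs_uniq ?opts_uniq // => [] [? ?] [? ?] _ _ [-> ->].
Qed.

Lemma mem_moves m : m \in moves.
Proof.
case: m => l [f [a b]]; apply/allpairsP; exists (l, (f, (a, b))); split=> //; first by case: l.
apply/allpairsP; exists (f, (a, b)); split=> //; first exact: mem_opts.
by apply/allpairsP; exists (a, b); rewrite !mem_opts.
Qed.

Lemma ground0 : ground 0 = R.
Proof. by apply/setP=> i; rewrite !inE orbF. Qed.

Lemma groundS (i : 'I_n) : ground i.+1 = i |: ground i.
Proof.
by apply/setP=> j; rewrite !inE ltnS leq_eqVlt orbCA; congr (_ || _).
Qed.

Lemma ground_all : ground n = setT.
Proof. by apply/setP=> i; rewrite !inE ltn_ord orbT. Qed.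

Lemma node_root : node (0, R).
Proof.
rewrite /node /= (ltnW tau_lt) andbT ground0; apply/maximal_inP; by split.
Qed.

Lemma node0 u : node u -> u.1 = 0 -> u = (0, R).
Proof.
case: u => j I /= /and3P[_ /maximal_inP[cI sI H] _] /= j0; rewrite j0 ground0 in sI H *.
congr pair; apply/eqP; rewrite eqEsubset sI /=; apply/subsetP=> i iR; apply: H => //.
by apply: cisS R_cis; rewrite subUset sub1set iR.
Qed.

(* Three new elements, pairwise independent over [I :\ f] in both matroids,
   would leave one that can be added to [I]. *)
Lemma few_new G I K f : maximal_in G I -> f \in I -> cis K -> K \subset G ->
  I :\ f \subset K -> #|K :\: I| <= 2.
Proof.
move=> /maximal_inP[cI IG Hm] fI cK KG IK; rewrite leqNgt; apply/negP.
have UX := enum_uniq (K :\: I); have EX := mem_enum (K :\: I).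
rewrite cardE; case: (enum (K :\: I)) UX EX => [|a [|b [|c s]]] //= UX EX _.
have inX x : x \in [:: a, b, c & s] -> [/\ x \in K, x \notin I & ~~ cis (x |: I)].
  move=> xs; have : x \in K :\: I by rewrite -EX.
  rewrite inE => /andP[xI xK]; split=> //.
  by apply: contra xI => /Hm; apply; apply: (subsetP KG).
have [aK aI na] := inX a (mem_head _ _).
have [bK bI nb] : [/\ b \in K, b \notin I & ~~ cis (b |: I)] by apply: inX; rewrite !inE eqxx orbT.
have [cK' cI' nc] : [/\ c \in K, c \notin I & ~~ cis (c |: I)] by apply: inX; rewrite !inE eqxx !orbT.
move: UX; rewrite !inE !negb_or => /and3P[/and3P[ab ac _] /andP[bc _] _].
have two q x y : x \in K -> y \in K -> x \notin I -> y \notin I -> x != y ->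
    M q (x |: I) || M q (y |: I).
  move=> xK yK xI yI xy; apply: (indep_two_added (cis_indep q cI) fI) => //.
  by apply: indepS (cis_indep q cK); rewrite !subUset !sub1set xK yK.
move: na nb nc; rewrite /cis.
move: (two false a b) (two false a c) (two false b c) (two true a b) (two true a c) (two true b c).
move=> /(_ aK bK aI bI ab) + /(_ aK cK' aI cI' ac) + /(_ bK cK' bI cI' bc).
move=> + + + /(_ aK bK aI bI ab) + /(_ aK cK' aI cI' ac) + /(_ bK cK' bI cI' bc).
by do 6![case: (M _ _)].
Qed.

Lemma apply_move_to v u : #|v.2 :\: u.2| <= 2 -> #|u.2 :\: v.2| <= 1 ->
  (v.1 = u.1 \/ v.1.+1 = u.1) -> apply_move v (move_to v u) = u.
Proof.
case: v u => j K [k I] /= c2 c1 jk; rewrite /apply_move /move_to /=; congr pair.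
  case: jk => <-; first by rewrite eqxx addn0.
  by rewrite gtn_eqF // addn1.
have /setP EK := enum_small c2; have /setP EI := enum_small (leqW c1).
have F2 : (first2 (I :\: K)).2 = None.
  by apply: (@onth_default _ 1); rewrite -cardE.
rewrite F2 in EI; apply/setP => x; move: (EK x) (EI x).
rewrite !(in_oadd, in_odel, inE) (_ : (Some x == None) = false) // !orbF.
by do 3?[case: (Some x == _)]; case: (x \in K); case: (x \in I).
Qed.

Lemma parent_spec u : node u -> 0 < u.1 ->
  [/\ node (parent u), rank (parent u) < rank u &
      apply_move (parent u) (move_to (parent u) u) = u].
Proof.
case: u => -[|j] I //= nu _; have /and3P[/= jn mI tI] := nu.
rewrite /parent /= insubT /=; set i := Sub j jn; have Ei : val i = j by [].
have /maximal_inP[cI IG Hm] := mI.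
have dn (G K : {set 'I_n}) : dist M G K <= n.+1 by have := dist_bound M G K; rewrite card_ord.
have lowr (K : {set 'I_n}) : rank (j, K) < rank (j.+1, I).
  rewrite /rank /= mulSn; apply: leq_trans (leq_addr _ _).
  rewrite addnC ltn_add2r; case: ifP => // _; rewrite ltnS ltnS; exact: dn.
have GS : ground j.+1 = i |: ground j by rewrite -Ei groundS.
case: ifP => [ior|/negbT].
  split=> //; last by apply: apply_move_to; rewrite ?setDv ?cards0 //; right.
  rewrite /node /= (ltnW jn) tI andbT; apply/maximal_inP; split=> //.
    apply/subsetP => x xI; have := subsetP IG x xI; rewrite GS !inE.
    case/predU1P=> [xi|//]; move: ior; rewrite -xi xI /= => ->; by [].
  by move=> x xG; apply: Hm; rewrite GS inE xG orbT.
rewrite negb_or negbK => /andP[iI iR].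
have cD : cis (I :\ i) by apply: cisS cI; apply: subsetDl.
case: ifP => [tI'|/negbT]; last rewrite -leqNgt => It.
  have sG : I :\ i \subset ground j.
    by apply/subsetP=> x; rewrite inE inE => /andP[xi /(subsetP IG)]; rewrite GS inE inE (negPf xi).
  have mK := complete_maximal cD sG; have [s1 _ _ _] := complete_inv M (ground j) (I :\ i).
  set K := complete _ _ _ in mK s1 *.
  split=> //.
    rewrite /node /= (ltnW jn) mK; apply: leq_trans (subset_leq_card s1).
    by move: tI'; rewrite (cardsD1 i I) iI.
  have /and3P[cK KG _] := mK.
  apply: apply_move_to => /=; last by right.
    apply: (few_new mI iI cK _ s1); apply: subset_trans KG _.
    by rewrite GS subsetUr.
  rewrite -(cards1 i); apply: subset_leq_card; apply/subsetP => x; rewrite !inE.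
  case/andP=> xK xI; apply: contraR xK => xi; apply: (subsetP s1); by rewrite !inE xi.
have RG : R \subset I :|: ground j.+1.
  by apply: subset_trans (subsetUr _ _); apply: subsetUl.
have IG0 : I :\: ground j.+1 \subset R.
  by move: IG; rewrite -setD_eq0 => /eqP->; apply: sub0set.
(* Only an exchange is possible here: [R] is a larger common independent set in the same ground set,
   so [I] is not maximum, and [I] is maximal, so nothing can be added. *)
rewrite /improve /update; case: (stepP (ground j.+1) cI) => /=.
- by move=> H; have := H R R_cis IG0 RG; rewrite leqNgt (leq_ltn_trans It).
- by move=> x xG xI cx; rewrite (Hm x xG cx) in xI.
move=> x f xG xI fG fI cx /andP[dlt dle].
have xf : x != f by apply: contraNneq xI => ->.
rewrite setU1D1 //.
set I' := x |: I :\ f in cx dlt *.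
have cI' : #|I'| = #|I| by rewrite cardsU1 !inE (negPf xI) andbF (cardsD1 f I) fI.
have I'G : I' \subset ground j.+1.
  by rewrite subUset sub1set xG; apply: subset_trans (subsetDl _ _) IG.
have mK := complete_maximal cx I'G; have [s1 _ _ _] := complete_inv M (ground j.+1) I'.
set K := complete _ _ _ in mK s1 *.
have cK1 := subset_leq_card s1; rewrite cI' in cK1.
split.
- by rewrite /node /= jn mK (leq_trans tI).
- rewrite /rank /= ltn_add2l It; case: ifP => // Kt; rewrite ltnS.
  (* A completion with at most [tau] elements has gained nothing over [I'], so the shorter path
     found for [I'] is the one of [K]. *)
  suff <- : I' = K by [].
  by apply/eqP; rewrite eqEcard s1 cI' (leq_trans Kt).
have sI : I :\ f \subset K by apply: subset_trans s1; apply: subsetUr.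
apply: apply_move_to => /=; last by left.
  have /and3P[cK KG _] := mK; exact: (few_new mI fI cK KG).
rewrite -(cards1 f); apply: subset_leq_card; apply/subsetP => z; rewrite !inE.
case/andP=> zK zI; apply: contraR zK => zf; apply: (subsetP sI); by rewrite !inE zf.
Qed.

Lemma node_root_eq u : node u -> (u == (0, R)) = (u.1 == 0).
Proof.
move=> nu; apply/eqP/eqP => [->//|u0]; exact: node0.
Qed.

Lemma parent_node u : node u -> u != (0, R) ->
  [/\ node (parent u), rank (parent u) < rank u,
      apply_move (parent u) (move_to (parent u) u) = u & move_to (parent u) u \in moves].
Proof.
move=> nu; rewrite node_root_eq // -lt0n => u0.
by have [? ? ?] := parent_spec nu u0; split=> //; apply: mem_moves.
Qed.

Lemma rank_le u : node u -> rank u <= n * n.+3 + n.+2.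
Proof.
case/and3P=> un _ _; rewrite /rank leq_add // ?leq_mul2r ?un ?orbT //.
case: ifP => // _; by rewrite ltnS; have := dist_bound M (ground u.1) u.2; rewrite card_ord.
Qed.

Notation nxt := (advance moves (0, R) node parent move_to apply_move).
Notation chd := (child (0, R) node parent move_to apply_move).

(** Take [i |: K] if it is independent in both matroids, and [K] otherwise. In the first case the
    size exceeds [tau], so the parent is the completion of [K], which is [K] by maximality. *)
Lemma level_up v : node v -> v.1 < n ->
  exists u, [/\ node u, u.1 = v.1.+1 & parent u = v].
Proof.
case: v => j K nv /= jn; have /and3P[/= _ mK tK] := nv; have /maximal_inP[cK KG Hm] := mK.
have [i Ei] : exists i : 'I_n, val i = j by exists (Ordinal jn).
have GS : ground j.+1 = i |: ground j by rewrite -Ei groundS.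
have GS' : ground j \subset ground j.+1 by rewrite GS subsetUr.
have nodeK : (i \in R) || ~~ cis (i |: K) -> node (j.+1, K).
  move=> H; rewrite /node /= jn tK andbT; apply/maximal_inP; split=> //.
    exact: subset_trans KG GS'.
  move=> x; rewrite GS inE inE => /predU1P[->|xG cx]; last exact: Hm.
  case/orP: H => [iR|/negPf-> //]; apply: Hm; by rewrite inE iR.
have parK : node (j.+1, K) -> (i \notin K) || (i \in R) -> parent (j.+1, K) = (j, K).
  move=> _ H; rewrite /parent /= insubT /=.
  have -> : Sub j jn = i by apply: val_inj.
  by rewrite H.
have [iR|iR] := boolP (i \in R).
  by exists (j.+1, K); rewrite nodeK ?parK ?nodeK ?iR ?orbT.
have iK : i \notin K.
  by apply/negP => /(subsetP KG); rewrite !inE (negPf iR) Ei ltnn.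
have [ci|ci] := boolP (cis (i |: K)); last first.
  by exists (j.+1, K); rewrite nodeK ?parK ?nodeK ?ci ?iK ?orbT.
have cKi : #|i |: K| = #|K|.+1 by rewrite cardsU1 iK.
exists (j.+1, i |: K); split=> //.
  rewrite /node /= jn cKi (leqW tK) andbT; apply/maximal_inP; split=> //.
    by rewrite GS setUS.
  move=> x; rewrite GS inE inE => /predU1P[->|xG cx]; first by rewrite !inE eqxx.
  by rewrite inE Hm ?orbT //; apply: cisS cx; rewrite setUS // subsetUr.
rewrite /parent /= insubT /=.
have -> : Sub j jn = i by apply: val_inj.
rewrite !inE eqxx (negPf iR) /= cKi ltnS tK setU1K //; congr pair.
by have /and3P[_ _ /eqP] := mK.
Qed.

Lemma first_child v : node v -> v.1 < n ->
  exists2 u, nxt (v, None) = Some (u, None) & u.1 = v.1.+1.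
Proof.
move=> nv vn; have [u [nu Eu pu]] := level_up nv vn.
pose m := move_to v u.
have um : u != (0, R) by rewrite node_root_eq // Eu.
have cm : chd v m.
  have [_ _ E _] := parent_node nu um; rewrite pu in E.
  by rewrite /child E nu um pu !eqxx.
pose up : seq move := [seq (false, t) | t <- triples].
have Emv : moves = up ++ [seq (true, t) | t <- triples] by rewrite /moves /= cats0.
have mup : m \in [seq m <- up | chd v m].
  rewrite mem_filter cm /=; have := mem_moves m; rewrite Emv mem_cat => /orP[//|].
  by case/mapP=> t _ /(congr1 fst) /=; rewrite Eu gtn_eqF.
rewrite /advance /= Emv filter_cat; case E: [seq m <- up | chd v m] mup => [|m' s] //= _.
exists (apply_move v m') => //.
have : m' \in [seq m <- up | chd v m] by rewrite E mem_head.
by rewrite mem_filter => /andP[_ /mapP[t _ ->]] /=; rewrite addn1.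
Qed.

Lemma leaf_mcis K : node (n, K) = maximal_in setT K && (tau <= #|K|).
Proof. by rewrite /node /= leqnn ground_all. Qed.

Lemma maximal_setT K : maximal_in setT K = maxset cis K.
Proof.
apply/maximal_inP/maxsetP => [[cK _ H]|[cK H]]; split=> //.
- move=> L cL sKL; apply/eqP; rewrite eqEsubset sKL andbT; apply/subsetP=> x xL.
  by apply: H => //; apply: cisS cL; rewrite subUset sub1set xL.
- by move=> i _ ci; rewrite -(H _ ci (subsetUr _ _)) !inE eqxx.
Qed.

End Levels.

(** * The enumeration as an abstract machine *)

Section Machine.

Variables (n : nat) (M : bool -> matroid 'I_n).
Implicit Types (K B C : {set 'I_n}) (outs : seq {set 'I_n}).

Notation cis := (cis M).

Definition top := augmented M setT set0.
Notation R := top.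
Notation r := #|R|.

(** [Flash B] is the lexicographic phase with [B] the set output last; [Search tau v pos] is a
    position in the traversal for the threshold [tau]. *)
Inductive config :=
| Flash of {set 'I_n}
| Search of nat & nat * {set 'I_n} & option (move n)
| Halt.

Definition descend tau := if tau is k.+1 then Search k (0, R) None else Halt.

Definition cnext tau := advance (@moves n) (0, R) (node M R tau) (parent M R tau) (@move_to n) (@apply_move n).

Definition emitted tau (c : (nat * {set 'I_n}) * option (move n)) : seq {set 'I_n} :=
  if [&& ~~ isSome c.2, c.1.1 == n & #|c.1.2| == tau] then [:: c.1.2] else [::].

Definition cstep (c : config * seq {set 'I_n}) : config * seq {set 'I_n} :=
  match c.1 with
  | Flash B => if next_max M r B is Some B' then (Flash B', rcons c.2 B') else (descend r, c.2)
  | Search tau v pos =>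
      if cnext tau (v, pos) is Some (v', pos')
      then (Search tau v' pos', c.2 ++ emitted tau (v', pos')) else (descend tau, c.2)
  | Halt => c
  end.

Definition cinit : config * seq {set 'I_n} :=
  let B := fill M r 0 set0 in (Flash B, [:: B]).

Definition mcis_ge s K := maxset cis K && (s <= #|K|).

Definition listed s outs :=
  [/\ uniq outs, outs =i mcis_ge s & sorted (fun I J : {set 'I_n} => #|J| <= #|I|) outs].

Lemma cis0 : cis set0.
Proof. by rewrite /cis !indep0. Qed.

Lemma top_cis : cis R.
Proof. by have [] := improve_iter_bounds setT (#|'I_n|.+1 * #|'I_n|.+1) cis0. Qed.

Lemma top_max I : cis I -> #|I| <= r.
Proof. by move=> cI; apply: augmented_max => //; rewrite ?cis0 ?set0D ?sub0set ?setUT ?subsetT. Qed.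

Definition emits (tau : nat) (l : seq (nat * {set 'I_n})) :=
  [seq v.2 | v : nat * {set 'I_n} <- l & (v.1 == n) && (#|v.2| == tau)].

Definition treach tau :=
  reach (@moves n) (0, R) (node M R tau) (parent M R tau) (@move_to n) (@apply_move n).

(** If the leaves met are at most [size outs], then at most [n.+1 * (size outs).+1] nodes were
    visited, the extra unit standing for an unfinished chain. The factor 2 accounts for pops, the
    final successor for the step that ends the phase. *)
Definition phase_cost outs := (2 * n.+1 * (size outs).+1).+1.

(** Each finished threshold is charged [phase_cost] of the current outputs rather than of those at
    its end; the bound persists because the list only grows. *)
Definition trace_inv k (c : config * seq {set 'I_n}) :=
  let outs := c.2 in
  match c.1 with
  | Flash B => [/\ k.+1 = size outs, maximum M r B, uniq outs,
        {in outs, forall C, maximum M r C /\ (C = B \/ lexlt C B)} &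
        forall C, maximum M r C -> C \in outs \/ lexlt B C]
  | Search tau v pos => tau < r /\ exists t l O,
      [/\ treach tau ((0, R), None) t l (v, pos), outs = O ++ emits tau l, listed tau.+1 O &
          k <= size outs + (r.-1 - tau) * phase_cost outs + t]
  | Halt => listed 0 outs
  end.

Lemma maximum_mcis B : maximum M r B = mcis_ge r B.
Proof.
apply/andP/andP => [[cB /eqP rB]|[/maxsetP[cB _] rB]].
  split; last by rewrite rB.
  apply/maxsetP; split=> // C cC sBC; apply/esym/eqP.
  by rewrite eqEcard sBC rB top_max.
by split=> //; rewrite eqn_leq rB top_max.
Qed.

Lemma first_maximum : let B := fill M r 0 set0 in maximum M r B /\
  forall C, maximum M r C -> C = B \/ lexlt B C.
Proof.
have below0 C : below C 0 = set0 by apply/setP=> i; rewrite !inE andbF.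
have ex : exists2 C, maximum M r C & below C 0 = set0.
  by exists R; rewrite // /maximum top_cis eqxx.
have [mB _ HB] := fill_spec top_max (sub0set _) (leq0n n) ex.
by split=> // C mC; apply: HB.
Qed.

Lemma trace_init : trace_inv 0 cinit.
Proof.
have [mB HB] := first_maximum; split=> //=.
  by move=> C; rewrite inE => /eqP->; split=> //; left.
by move=> C /HB[->|]; [left; rewrite mem_head | right].
Qed.

Section Phase.
Variable (tau : nat).
Hypothesis tr : tau < r.

Lemma treach_complete : exists T L Z,
  [/\ treach tau ((0, R), None) T L Z, cnext tau Z = None, uniq ((0, R) :: L) &
      (0, R) :: L =i node M R tau].
Proof.
apply: (search_complete (rank := rank M R tau) (B := n * n.+3 + n.+2)) => //.
- exact: moves_uniq.
- exact: (node_root top_cis tr).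
- by move=> u nu ur; apply: (parent_node top_cis tr).
- exact: rank_le.
Qed.

Lemma treach_uniq t l c : treach tau ((0, R), None) t l c -> uniq ((0, R) :: l).
Proof.
move=> H; have [T [L [Z [HT N U _]]]] := treach_complete.
have [l' [c' [H' P]]] := reach_prefix HT (reach_next_none H HT N).
have [-> _] := reach_det H H'; move: U.
by case/prefixP: P => s ->; rewrite -cat_cons cat_uniq => /andP[].
Qed.

Lemma treach_all t l c : treach tau ((0, R), None) t l c -> cnext tau c = None ->
  (0, R) :: l =i node M R tau.
Proof.
move=> H Nc; have [T [L [Z [HT N _ E]]]] := treach_complete.
have ET : t = T.
  by apply/eqP; rewrite eqn_leq (reach_next_none H HT N) (reach_next_none HT H Nc).
by subst T; have [-> _] := reach_det H HT.
Qed.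

Lemma treach_nodes t l c : treach tau ((0, R), None) t l c -> all (node M R tau) l.
Proof.
move=> H; have [] := reach_nd (rank := rank M R tau) _ _ _ H => //.
- exact: (node_root top_cis tr).
- by move=> u nu ur; apply: (parent_node top_cis tr).
Qed.

Lemma leaf_mcis_ge v : (node M R tau v) && (v.1 == n) = (v.1 == n) && mcis_ge tau v.2.
Proof.
case: v => j K /=; rewrite andbC; case: eqP => //= ->.
by rewrite leaf_mcis maximal_setT.
Qed.

(** Distinct leaves are distinct solutions with at least [tau] elements: those with more are in [O],
    those with exactly [tau] have just been emitted. So leaves are bounded by outputs even in the
    middle of a phase. *)
Lemma treach_leaves t l c O : treach tau ((0, R), None) t l c -> listed tau.+1 O ->
  t.+1 <= phase_cost (O ++ emits tau l).
Proof.
move=> H [_ OE _]; have U := treach_uniq H; have nl := treach_nodes H.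
have nr : node M R tau (0, R) by apply: node_root => //; apply: top_cis.
have [d [Ed _ _]] := reach_steps H.
have /= Hl := reach_leaves (n := n) (lev := fst) nr erefl
   (fun u nu ur => parent_node top_cis tr nu ur)
   (fun v nv => proj1 (elimT andP nv)) (fun v nv => @first_child _ M R tau top_cis tr v nv) H.
set lam := (_ + count _ _) in Hl.
suff cl : lam <= size (O ++ emits tau l).
  rewrite /phase_cost ltnS; have : t <= 2 * size l by rewrite -Ed leq_addr.
  set s := size (_ ++ _) in cl *; move: Hl; set p := (X in _ + X).
  have pn : p <= n.+1 by rewrite /p; case: (c.2) => //; case: ifP => // /ltnW.
  move=> Hl tl; apply: leq_trans tl _; rewrite -mulnA leq_mul2l /= mulnS addnC.
  by apply: leq_trans (ltnW Hl) _; rewrite leq_add // leq_mul2l /=.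
pose leaves := [seq v <- (0, R) :: l | v.1 == n].
have -> : lam = size [seq v.2 | v <- leaves] by rewrite size_map size_filter.
apply: uniq_leq_size.
  rewrite map_inj_in_uniq ?filter_uniq // => -[j K] [j' K']; rewrite !mem_filter /=.
  by move=> /andP[/eqP-> _] /andP[/eqP-> _] ->.
move=> K /mapP[v]; rewrite mem_filter => /andP[vn vl] ->.
have nv : node M R tau v.
  by move: vl; rewrite inE => /predU1P[->//|]; apply: (allP nl).
have /andP[mv tv] : mcis_ge tau v.2.
  by have := leaf_mcis_ge v; rewrite nv vn => /esym.
rewrite mem_cat OE unfold_in /mcis_ge mv /=.
case: (ltnP tau #|v.2|) => //= vt.
have ev : #|v.2| == tau by rewrite eqn_leq vt.
apply/mapP; exists v => //; rewrite mem_filter vn ev /=.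
(* Emitted sets come from [l], which does not record the root; the root has more than [tau]
   elements, so nothing is missed. *)
by move: vl; rewrite inE => /predU1P[E|//]; have := tr; rewrite -(eqP ev) E ltnn.
Qed.

End Phase.

Lemma mcis_ge_card s K : mcis_ge s K -> s <= #|K|.
Proof. by case/andP. Qed.

Lemma sorted_card_const s outs : (forall C, C \in outs -> #|C| = s) ->
  sorted (fun I J : {set 'I_n} => #|J| <= #|I|) outs.
Proof.
case: outs => //= B outs; elim: outs B => //= C outs IH B H; rewrite !H ?inE ?eqxx ?orbT //= leqnn.
by apply: IH => D DC; apply: H; rewrite inE DC orbT.
Qed.

Lemma phase_done tau t l c O : tau < r ->
  treach tau ((0, R), None) t l c -> cnext tau c = None -> listed tau.+1 O ->
  listed tau (O ++ emits tau l).
Proof.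
move=> tr H Nc [UO OE SO]; have U := treach_uniq tr H; have E := treach_all tr H Nc.
have size_emits K : K \in emits tau l -> #|K| = tau.
  by case/mapP=> v; rewrite mem_filter => /andP[/andP[_ /eqP ev] _] ->.
have memE : emits tau l =i [pred K | maxset cis K & #|K| == tau].
  move=> K; rewrite inE; apply/mapP/andP => [[v]|[mK eK]].
    rewrite mem_filter => /andP[/andP[vn ev] vl] ->; split=> //.
    have nv : node M R tau v by move: (E v); rewrite inE vl orbT => /esym.
    by have := leaf_mcis_ge tau v; rewrite nv vn /= => /esym/andP[].
  exists (n, K); rewrite // mem_filter /= eqxx eK /=.
  have : node M R tau (n, K).
    have := leaf_mcis_ge tau (n, K); rewrite /= eqxx andbT => ->.
    by rewrite /mcis_ge mK (eqP eK) /=.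
  rewrite -[node _ _ _ _]/((n, K) \in node M R tau) -E inE => /predU1P[[_ KR]|//].
  by have := tr; rewrite -(eqP eK) KR ltnn.
split.
- rewrite cat_uniq UO /=; apply/andP; split.
    apply/hasPn => K /size_emits eK; rewrite OE unfold_in /mcis_ge eK ltnn andbF //.
  rewrite map_inj_in_uniq; first by apply: filter_uniq; case/andP: U.
  by case=> j K [j' K']; rewrite !mem_filter /= => /andP[/andP[/eqP-> _] _] /andP[/andP[/eqP-> _] _] ->.
- move=> K; rewrite mem_cat memE OE inE !unfold_in /mcis_ge -andb_orr.
  by congr (_ && _); rewrite orbC [RHS]leq_eqVlt eq_sym.
have tr_le : transitive (fun I J : {set 'I_n} => #|J| <= #|I|).
  by move=> J I K /= IJ JK; apply: leq_trans JK IJ.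
rewrite sorted_pairwise // pairwise_cat -[pairwise _ O]sorted_pairwise // SO /=; apply/andP; split.
  apply/allrelP => I J; rewrite OE => /mcis_ge_card tI /size_emits ->; exact: ltnW.
by rewrite -sorted_pairwise //; apply: (@sorted_card_const tau).
Qed.

Lemma trace_step k c : c.1 <> Halt -> trace_inv k c -> trace_inv k.+1 (cstep c).
Proof.
have start s outs : s <= r -> listed s outs -> k < size outs + (r - s) * phase_cost outs ->
    trace_inv k.+1 (descend s, outs).
  case: s => [|s] Kr lK kb //=; split=> //; exists 0, [::], outs; split=> //.
  - by left.
  - by rewrite cats0.
  - by rewrite addn0; move: kb; rewrite -subn1 -subnDA add1n.
case: c => -[B|tau v pos|] //= outs _.
  case=> Ek mB U Hs Hc; rewrite /cstep /=; have := next_maxP top_max mB.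
  case: (next_max M r B) => [B' [mB' BB' H]|H] /=.
    have B'n : B' \notin outs.
      apply/negP => /Hs[_ [E|lt]]; first by rewrite E in BB'; apply: lexlt_irr BB'.
      by apply: (lexlt_irr (lexlt_trans BB' lt)).
    split.
    - by rewrite size_rcons Ek.
    - by [].
    - by rewrite rcons_uniq B'n.
    - move=> C; rewrite mem_rcons inE => /predU1P[->|/Hs[mC HC]]; first by split=> //; left.
      by split=> //; right; case: HC => [->|/lexlt_trans]; last apply.
    - move=> C mC; rewrite mem_rcons inE; case: (Hc C mC) => [->|/(H C mC)[->|]].
      + by left; rewrite orbT.
      + by left; rewrite eqxx.
      + by right.
  apply: start => //; last by rewrite -Ek subnn addn0.
  split=> //.
    move=> C; rewrite -[C \in mcis_ge r]/(mcis_ge r C) -maximum_mcis; apply/idP/idP => [/Hs[]//|mC].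
    by case: (Hc C mC) => // /(H C mC).
  by apply: (@sorted_card_const r) => C /Hs[/andP[_ /eqP]].
case=> tr [t [l [O [H /= EO lO kb]]]]; rewrite /cstep /=.
case N: (cnext tau (v, pos)) => [[v' pos']|].
  have H' := ReachS H N; split=> //; eexists t.+1, _, O; split; first exact: H'.
  - rewrite /= EO -catA; congr cat; rewrite /emits filter_cat map_cat; congr cat.
    rewrite /emitted /=; case: (pos') => //=.
    by case: ifP.
  - by [].
  - rewrite addnS ltnS; apply: leq_trans kb _; rewrite leq_add2r.
    have sz : size outs <= size (outs ++ emitted tau (v', pos')) by rewrite size_cat leq_addr.
    by rewrite leq_add // leq_mul // /phase_cost ltnS leq_mul.
(* The traversal and the step that closes it cost at most [phase_cost outs] together, so [t] is
   exchanged for one more finished threshold. *)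
have lt := treach_leaves tr H lO; rewrite -EO in lt.
apply: start; first exact: ltnW.
  by rewrite EO; apply: (phase_done tr H N lO).
have r0 : 0 < r := leq_ltn_trans (leq0n _) tr.
have -> : r - tau = (r.-1 - tau).+1 by rewrite -subSn ?prednK // -ltnS prednK.
rewrite mulSn; apply: leq_ltn_trans kb _.
by rewrite -addnA ltn_add2l addnC ltn_add2r.
Qed.

Definition crun k := iter k cstep cinit.

Lemma trace_run k : (crun k).1 <> Halt -> trace_inv k (crun k).
Proof.
elim: k => [|k IH] H; first exact: trace_init.
have Hk : (crun k).1 <> Halt by move=> E; apply: H; rewrite /crun iterS -/(crun k) /cstep E.
by apply: trace_step => //; apply: IH.
Qed.

(** At most [n] thresholds are charged [phase_cost] each, and the remaining steps are at most the
    number of outputs; the factor 4 absorbs the lower-order terms. *)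
Lemma run_progress k : (crun k).1 <> Halt ->
  uniq (crun k).2 /\ k < 4 * (n.+1 ^ 2 * (size (crun k).2).+1).
Proof.
move=> H; have := trace_run H; rewrite /trace_inv; case: (crun k) H => -[B|tau v pos|] outs //= _ [].
  move=> Ek _ U _ _; split=> //; rewrite Ek; nia.
move=> tr [t [l [O [H EO lO kb]]]]; have := treach_leaves tr H lO.
rewrite -EO => lt; split.
  rewrite EO cat_uniq; case: lO => UO OE _; rewrite UO /=; apply/andP; split.
    apply/hasPn => K /mapP[w]; rewrite mem_filter => /andP[/andP[_ /eqP ew] _] ->.
    by rewrite OE unfold_in /mcis_ge ew ltnn andbF.
  rewrite map_inj_in_uniq; first by apply: filter_uniq; case/andP: (treach_uniq tr H).
  by case=> j K [j' K']; rewrite !mem_filter /= => /andP[/andP[/eqP-> _] _] /andP[/andP[/eqP-> _] _] ->.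
apply: leq_ltn_trans kb _; rewrite -addnA.
have rn : r <= n by rewrite -[n in _ <= n]card_ord max_card.
apply: (@leq_ltn_trans (size outs + n * phase_cost outs)).
  rewrite leq_add2l; apply: (@leq_trans ((r.-1 - tau).+1 * phase_cost outs)).
    by rewrite mulSn addnC leq_add2r ltnW.
  rewrite leq_mul2r; apply/orP; right; apply: leq_trans rn.
  have r0 : 0 < r := leq_ltn_trans (leq0n _) tr.
  by rewrite -subSn ?prednK ?leq_subr // -ltnS prednK.
rewrite /phase_cost; move: (size outs) => s; nia.
Qed.

(** Outputs are distinct subsets of the ground set, so their number is bounded, and by
    [run_progress] so is the number of steps before [Halt]. *)
Theorem run_halts : exists k, [/\ (crun k).1 = Halt, forall k', k' < k -> (crun k').1 <> Halt &
  listed 0 (crun k).2].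
Proof.
have hdec k : decidable ((crun k).1 = Halt) by case: (crun k).1; [right|right|left].
pose halted k := if hdec k is left _ then true else false.
have hP k : reflect ((crun k).1 = Halt) (halted k).
  by rewrite /halted; case: (hdec k) => ?; constructor.
have ex : exists k, halted k.
  pose b := 4 * (n.+1 ^ 2 * (#|{: {set 'I_n}}|).+1).
  exists b; apply/hP; case: (hdec b) => // /run_progress[U].
  rewrite ltnNge /b !leq_mul // ltnS -(card_uniqP U); apply: max_card.
have [k /hP Hk Hmin] := ex_minnP ex; exists k; split=> //.
  by move=> k' lt /hP /Hmin; rewrite leqNgt lt.
case: k Hk Hmin => [//|k] Hk Hmin.
have Nk : (crun k).1 <> Halt by move=> /hP /Hmin; rewrite ltnn.
have := trace_step Nk (trace_run Nk); rewrite -[cstep _]/(crun k.+1) /trace_inv Hk.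
by [].
Qed.

End Machine.

(** * A structured language compiled to the random access machine *)

(* All values are at most [n.+1]: they fit into one machine word and are valid
   indices of an array, which has [n.+2] cells. Index [n] encodes [None]; it lies
   beyond the ground set, so writing there does not change the set represented.
   [HInc] saturates at [n.+1]. *)
Inductive hexpr :=
| HBool of bool
| HDim
| HVar of nat
| HGet of nat & hexpr
| HEq of hexpr & hexpr
| HLt of hexpr & hexpr
| HAnd of hexpr & hexpr
| HSub of hexpr & hexpr
| HInc of hexpr.

(** The flag of [HFor] extends the range from [n] to [n.+1] values, so that the loop also runs
    through the code of [None]. *)
Inductive hcmd :=
| HSkip
| HSet of nat & hexpr
| HPut of nat & hexpr & hexpr
| HAsk of nat & bool & nat
| HOut of nat
| HSeq of hcmd & hcmd
| HIf of hexpr & hcmd & hcmd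
| HFor of nat & bool & hcmd.

(** Cell 0 holds the input [n], the scalars follow, then the arrays of [n.+2] cells. The two numbers
    are merely large enough for the variables declared below. *)
Definition nscalars := 50.
Definition narrays := 10.
Definition abase := nscalars.+1.

Definition Dim := Cell (Const 0).
Definition addr b e := Bin Add (Const abase) (Bin Add (Bin Mul (Const b) (Bin Add (Const 2) Dim)) e).

Fixpoint cexpr e :=
  match e with
  | HBool b => Const b
  | HDim => Dim
  | HVar k => Cell (Const k.+1)
  | HGet b e => Cell (addr b (cexpr e))
  | HEq a b => Bin Eq (cexpr a) (cexpr b)
  | HLt a b => Bin Lt (cexpr a) (cexpr b)
  | HAnd a b => Bin Mul (Bin Lt (Const 0) (cexpr a)) (Bin Lt (Const 0) (cexpr b))
  | HSub a b => Bin Defs.Sub (cexpr a) (cexpr b)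
  | HInc a => Bin Add (cexpr a) (Bin Lt (cexpr a) (Bin Add (Const 1) Dim))
  end.

Definition bound (full : bool) := Bin Add (Const full) Dim.

Fixpoint ccmd h :=
  match h with
  | HSkip => Skip
  | HSet k e => Store (Const k.+1) (cexpr e)
  | HPut b i e => Store (addr b (cexpr i)) (cexpr e)
  | HAsk k o b => Query o (Const k.+1) (addr b (Const 0))
  | HOut b => Output (addr b (Const 0))
  | HSeq p q => Seq (ccmd p) (ccmd q)
  | HIf e p q => If (cexpr e) (ccmd p) (ccmd q)
  | HFor k full p =>
      Seq (Store (Const k.+1) (Const 0))
        (While (Bin Lt (Cell (Const k.+1)) (bound full))
           (Seq (ccmd p) (Store (Const k.+1) (Bin Add (Cell (Const k.+1)) (Const 1)))))
  end.

Fixpoint modv h : seq nat :=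
  match h with
  | HSet k _ | HAsk k _ _ => [:: k]
  | HSeq p q | HIf _ p q => modv p ++ modv q
  | HFor k _ p => k :: modv p
  | _ => [::]
  end.

Fixpoint moda h : seq nat :=
  match h with
  | HPut b _ _ => [:: b]
  | HSeq p q | HIf _ p q => moda p ++ moda q
  | HFor _ _ p => moda p
  | _ => [::]
  end.

Fixpoint silent h : bool :=
  match h with
  | HOut _ => false
  | HSeq p q | HIf _ p q => silent p && silent q
  | HFor _ _ p => silent p
  | _ => true
  end.

Fixpoint ewf e : bool :=
  match e with
  | HBool _ | HDim => true
  | HVar k => k < nscalars
  | HGet b e => (b < narrays) && ewf e
  | HEq a b | HLt a b | HAnd a b | HSub a b => ewf a && ewf b
  | HInc a => ewf a
  end.

Fixpoint cwf h : bool :=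
  match h with
  | HSkip => true
  | HSet k e => (k < nscalars) && ewf e
  | HPut b i e => [&& b < narrays, ewf i & ewf e]
  | HAsk k o b => (k < nscalars) && (b < narrays)
  | HOut b => b < narrays
  | HSeq p q => cwf p && cwf q
  | HIf e p q => [&& ewf e, cwf p & cwf q]
  | HFor k full p => [&& k < nscalars, k \notin modv p & cwf p]
  end.

(** The exponent of the time bound; an output counts like a loop because it takes time [n]. *)
Fixpoint deg h : nat :=
  match h with
  | HOut _ => 1
  | HSeq p q | HIf _ p q => maxn (deg p) (deg q)
  | HFor _ _ p => (deg p).+1
  | _ => 0
  end.

Fixpoint esize e : nat :=
  match e with
  | Const _ => 1
  | Cell a => (esize a).+1
  | Bin _ a b => (esize a + esize b).+1
  end.

Record hst n := HSt { sc : nat -> nat; ar : nat -> nat -> nat; out : seq {set 'I_n} }.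

Lemma foldl_iotaS S (f : S -> nat -> S) z i :
  foldl f z (iota 0 i.+1) = f (foldl f z (iota 0 i)) i.
Proof. by rewrite -addn1 iotaD foldl_cat. Qed.

Section Semantics.

Variables (n : nat) (oracle : bool -> {set 'I_n} -> bool).
Implicit Types (x : hst n) (h : hcmd) (s : state n).

Definition setv x k v := HSt (fun j => if j == k then v else sc x j) (ar x) (out x).

Definition seta x b i v :=
  HSt (sc x) (fun c => if c == b then fun j => if j == i then v else ar x b j else ar x c) (out x).

Definition cset (f : nat -> nat) : {set 'I_n} := [set i : 'I_n | f i != 0].

Fixpoint heval x e : nat :=
  match e with
  | HBool b => b
  | HDim => n
  | HVar k => sc x k
  | HGet b e => ar x b (heval x e)
  | HEq a b => heval x a == heval x b
  | HLt a b => heval x a < heval x b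
  | HAnd a b => (heval x a != 0) && (heval x b != 0)
  | HSub a b => heval x a - heval x b
  | HInc a => heval x a + (heval x a < n.+1)
  end.

Fixpoint den h x : hst n :=
  match h with
  | HSkip => x
  | HSet k e => setv x k (heval x e)
  | HPut b i e => seta x b (heval x i) (heval x e)
  | HAsk k o b => setv x k (oracle o (cset (ar x b)))
  | HOut b => HSt (sc x) (ar x) (rcons (out x) (cset (ar x b)))
  | HSeq p q => den q (den p x)
  | HIf e p q => if heval x e != 0 then den p x else den q x
  | HFor k full p =>
      setv (foldl (fun x i => den p (setv x k i)) x (iota 0 (n + full))) k (n + full)
  end.

Lemma modvP h x k : k \notin modv h -> sc (den h x) k = sc x k.
Proof.
elim: h x => //=.
- by move=> j e x; rewrite inE => /negPf->.
- by move=> j o b x; rewrite inE => /negPf->.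
- by move=> p IHp q IHq x; rewrite mem_cat negb_or => /andP[kp kq]; rewrite IHq ?IHp.
- by move=> e p IHp q IHq x; rewrite mem_cat negb_or => /andP[kp kq]; case: ifP => _; rewrite ?IHq ?IHp.
move=> j full p IHp x; rewrite inE negb_or => /andP[/negPf kj kp]; rewrite kj.
by elim: (iota _ _) x => //= i l IH x; rewrite IH IHp //= kj.
Qed.

Lemma modaP h x b : b \notin moda h -> ar (den h x) b = ar x b.
Proof.
elim: h x => //=.
- by move=> c i e x; rewrite inE => /negPf->.
- by move=> p IHp q IHq x; rewrite mem_cat negb_or => /andP[kp kq]; rewrite IHq ?IHp.
- by move=> e p IHp q IHq x; rewrite mem_cat negb_or => /andP[kp kq]; case: ifP => _; rewrite ?IHq ?IHp.
move=> j full p IHp x bp.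
by elim: (iota _ _) x => //= i l IH x; rewrite IH IHp.
Qed.

Lemma silentP h x : silent h -> out (den h x) = out x.
Proof.
elim: h x => //=.
- by move=> p IHp q IHq x /andP[kp kq]; rewrite IHq ?IHp.
- by move=> e p IHp q IHq x /andP[kp kq]; case: ifP => _; rewrite ?IHq ?IHp.
move=> j full p IHp x bp.
by elim: (iota _ _) x => //= i l IH x; rewrite IH IHp.
Qed.

(** * Memory layout, word sizes and the cost of expressions *)

Definition adr b i := abase + (b * n.+2 + i).

Definition space_bound := abase + narrays * n.+2.

Definition sim x s :=
  [/\ Defs.mem s 0 = n, forall k, k < nscalars -> Defs.mem s k.+1 = sc x k,
      forall b i, b < narrays -> i < n.+2 -> Defs.mem s (adr b i) = ar x b i &
      outputs s = out x].

Definition good s :=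
  [/\ forall a, Defs.mem s a <= n.+1, used s <= space_bound, peak s <= space_bound * n.+2 &
      all (fun e => e.1 <= clock s) (log s)].

Definition wordbound := (abase + narrays).+2.

(** Addresses are linear in [n] with fixed coefficients, so in base [n.+2] their number of digits is
    bounded independently of [n]; the crude exponent also covers base 2. *)
Lemma wlen_le v : v <= space_bound -> wlen n v <= wordbound.
Proof.
move=> vb; rewrite /wlen /wordbound ltnS.
have : v < n.+2 ^ (abase + narrays).+2.
  apply: leq_ltn_trans vb _; rewrite /space_bound.
  apply: (@leq_ltn_trans ((abase + narrays) * n.+2)).
    by rewrite mulnDl leq_add2r leq_pmulr.
  rewrite expnSr ltn_pmul2r //; apply: (@ltn_trans (abase + narrays).+1) => //.
  exact: ltn_expl.
case: v {vb} => [|v] lt; first by rewrite trunc_log0.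
by rewrite -ltnS -(@ltn_exp2l n.+2) //; apply: leq_ltn_trans lt; rewrite trunc_logP.
Qed.

Fixpoint small m e : bool :=
  (eval m e <= space_bound) &&
  match e with
  | Const _ => true
  | Cell a => small m a
  | Bin _ a b => small m a && small m b
  end.

Lemma small_le m e : small m e -> eval m e <= space_bound.
Proof. by case: e => [?|?|???] /andP[]. Qed.

Lemma ecost_le m e : small m e -> ecost n m e <= esize e * wordbound ^ 2.
Proof.
have W2 : wordbound <= wordbound ^ 2 by rewrite -mulnn leq_pmulr.
elim: e => [c|a IH|o a IHa b IHb] /= /andP[vb].
- by move=> _; rewrite mul1n; apply: leq_trans (wlen_le vb) W2.
- move=> sa; rewrite mulSn addnC leq_add ?IH //.
  exact: leq_trans (wlen_le vb) W2.
move=> /andP[sa sb]; rewrite mulSn mulnDl addnC leq_add ?leq_add ?IHa ?IHb //.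
by rewrite leq_mul ?wlen_le ?small_le.
Qed.

Lemma cexprP x s e : ewf e -> sim x s -> good s ->
  [/\ eval (Defs.mem s) (cexpr e) = heval x e, heval x e <= n.+1 & small (Defs.mem s) (cexpr e)].
Proof.
move=> we xs sg; have [s0 sv sa _] := xs; have [gm _ _ _] := sg.
have dim1 : n.+1 <= space_bound.
  rewrite /space_bound; apply: (@leq_trans (narrays * n.+2)); last exact: leq_addl.
  by apply: leq_trans (leqnSn _) _; rewrite leq_pmull.
have one v : v <= n.+1 -> v <= space_bound by move/leq_trans; apply.
have dim2 : n.+2 <= space_bound.
  by rewrite /space_bound (@leq_trans (narrays * n.+2)) ?leq_addl // leq_pmull.
have cst c : c <= nscalars -> c <= space_bound.
  by move=> cn; apply: leq_trans cn _; rewrite /space_bound /abase addSn leqW ?leq_addr.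
elim: e we => [b|||b e IH|a IHa b IHb|a IHa b IHb|a IHa b IHb|a IHa b IHb|a IHa] /=.
- by case: b.
- by move=> _; rewrite s0 andbT !one.
- by move=> k /[dup] kn /sv Ek; rewrite Ek -Ek gm one //= cst.
- move=> /andP[bn /IH[E le sm]]; rewrite s0 E -/(adr b _) sa //; split=> //.
    by rewrite -(sa b) // gm.
  have bb : adr b (heval x e) <= space_bound.
    rewrite /adr /space_bound leq_add2l; apply: (@leq_trans (b.+1 * n.+2)).
      by rewrite mulSn addnC leq_add2r leqW.
    by rewrite leq_mul2r bn orbT.
  rewrite sm /= -/(adr b _) -(sa b) // one ?gm //= -/(adr b _) bb /=.
  have b1 : b * n.+2 + heval x e <= space_bound by apply: leq_trans bb; apply: leq_addl.
  have b2 : b * n.+2 <= space_bound by apply: leq_trans b1; apply: leq_addr.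
  rewrite add2n b1 b2 dim2 (one n) // cst //; apply: leq_trans (ltnW bn) _.
  by [].
- move=> /andP[/IHa[Ea la sma] /IHb[Eb lb smb]]; rewrite Ea Eb sma smb /= andbT.
  by case: eqP.
- move=> /andP[/IHa[Ea la sma] /IHb[Eb lb smb]]; rewrite Ea Eb sma smb /= andbT.
  by case: ltnP.
- move=> /andP[/IHa[Ea la sma] /IHb[Eb lb smb]]; rewrite Ea Eb sma smb /=.
  by case: (heval x a) => [|?]; case: (heval x b).
- move=> /andP[/IHa[Ea la sma] /IHb[Eb lb smb]]; rewrite Ea Eb sma smb /= andbT.
  have l : heval x a - heval x b <= n.+1 by apply: leq_trans la; apply: leq_subr.
  by rewrite l one.
- move=> /IHa[Ea la sma]; rewrite Ea sma /= s0 add1n.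
  have l : heval x a + (heval x a < n.+1) <= n.+1 by case: ltnP; rewrite ?addn0 ?addn1.
  by rewrite l !one //; case: ltnP.
Qed.

Lemma adr_lt b i : b < narrays -> i < n.+2 -> adr b i < space_bound.
Proof.
move=> bn ib; rewrite /adr /space_bound ltn_add2l; apply: (@leq_trans (b.+1 * n.+2)).
  by rewrite mulSn addnC ltn_add2r.
by rewrite leq_mul2r bn orbT.
Qed.

Lemma adr_eq b c i j : i < n.+2 -> j < n.+2 -> (adr c j == adr b i) = (c == b) && (j == i).
Proof.
move=> ib jb; rewrite /adr eqn_add2l; apply/eqP/andP => [E|[/eqP-> /eqP->]//].
have := congr1 (fun m => m %% n.+2) E; rewrite !modnMDl !modn_small // => ->.
have := congr1 (fun m => m %/ n.+2) E; rewrite !divnMDl // !divn_small // !addn0 => ->.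
by rewrite !eqxx.
Qed.

Lemma addrP x s b e : b < narrays -> ewf e -> sim x s -> good s ->
  eval (Defs.mem s) (addr b (cexpr e)) = adr b (heval x e) /\
  small (Defs.mem s) (addr b (cexpr e)).
Proof.
move=> bn we xs sg; have [E _ _] := cexprP we xs sg.
have [|_ _ /andP[_ sm]] := @cexprP x s (HGet b e) _ xs sg; first by rewrite /= bn.
split=> //; have [s0 _ _ _] := xs; rewrite /= -/(cexpr e) E s0 add2n.
by [].
Qed.

(** The bit length of a value is bounded by the value plus one, which is enough for a polynomial
    bound. *)
Lemma bits_le (m : nat -> nat) u : (forall a, m a <= n.+1) -> bits m u <= u * n.+2.
Proof.
move=> mb; rewrite /bits; apply: leq_trans (_ : \sum_(a < u) n.+2 <= _); last first.
  by rewrite sum_nat_const card_ord.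
apply: leq_sum => a _; rewrite ltnS; apply: leq_trans (mb a).
case: (m a) => [|v]; first by rewrite trunc_log0.
by apply: leq_trans (ltnW (ltn_expl _ (ltnSn 1))) (trunc_logP _ _).
Qed.

Lemma good_tick t s : good s -> good (tick t s).
Proof.
case=> gm gu gp gl; split=> //; apply: sub_all gl => e /leq_trans; apply.
exact: leq_addr.
Qed.

Lemma good_store a v s : a < space_bound -> v <= n.+1 -> good s -> good (store a v s).
Proof.
move=> ab vb [gm gu gp gl].
have mb c : Defs.mem (store a v s) c <= n.+1 by rewrite /=; case: eqP.
have ub : maxn (used s) a.+1 <= space_bound by rewrite geq_max gu.
split=> //=; rewrite geq_max gp /=; apply: leq_trans (bits_le _ mb) _.
by rewrite leq_mul2r ub orbT.
Qed.

Lemma sim_tick x t s : sim x s -> sim x (tick t s).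
Proof. by case=> *; split. Qed.

Lemma sim_setv x s k v : k < nscalars -> sim x s -> sim (setv x k v) (store k.+1 v s).
Proof.
move=> kn [s0 sv sa so]; split=> //=.
- by move=> j jn; rewrite eqSS; case: eqP => // _; apply: sv.
- move=> b i bn ib; rewrite gtn_eqF ?sa //.
  by rewrite /adr /abase addSn ltnS; apply: leq_trans kn (leq_addr _ _).
Qed.

Lemma sim_seta x s b i v : b < narrays -> i < n.+2 -> sim x s ->
  sim (seta x b i v) (store (adr b i) v s).
Proof.
move=> bn ib [s0 sv sa so]; split=> //=.
- move=> j jn; rewrite ltn_eqF ?sv //.
  by rewrite /adr /abase addSn ltnS; apply: leq_trans jn (leq_addr _ _).
- move=> c j cn jb; rewrite adr_eq //; case: (c =P b) => [->|_] /=; last exact: sa.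
  by case: eqP => // _; apply: sa.
Qed.

Lemma sim_block x s b : b < narrays -> sim x s ->
  block n (Defs.mem s) (adr b 0) = cset (ar x b).
Proof.
move=> bn [_ _ sa _]; apply/setP=> i; rewrite !inE.
have -> : adr b 0 + i = adr b i by rewrite /adr addn0 addnA.
by rewrite sa //; apply: leq_trans (ltn_ord i) _; rewrite ltnW.
Qed.

Definition w2 := wordbound ^ 2.

Fixpoint konst h : nat :=
  match h with
  | HSkip => 1
  | HSet k e => ((esize (Const k.+1) + esize (cexpr e)) * w2).+1
  | HPut b i e => ((esize (addr b (cexpr i)) + esize (cexpr e)) * w2).+1
  | HAsk k o b => ((esize (Const k.+1) + esize (addr b (Const 0))) * w2).+2
  | HOut b => (esize (addr b (Const 0)) * w2).+2
  | HSeq p q => konst p + konst q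
  | HIf e p q => (esize (cexpr e) * w2).+1 + konst p + konst q
  | HFor k full p =>
     ((esize (Const k.+1) + esize (Const 0)) * w2).+1 +
     ((esize (Bin Lt (Cell (Const k.+1)) (bound full)) * w2).+1 +
     ((esize (Const k.+1) + esize (Bin Add (Cell (Const k.+1)) (Const 1))) * w2).+1 +
       konst p)
  end.

(** * Simulation with time bounds *)

Variable Q : nat.
Hypothesis Q0 : 0 < Q.

Definition follows s B s' := clock s' <= clock s + B /\ prefix (log s) (log s').

Lemma follows_trans s1 s2 s3 a b : follows s1 a s2 -> follows s2 b s3 -> follows s1 (a + b) s3.
Proof.
case=> c1 p1 [c2 p2]; split; last exact: prefix_trans p1 p2.
by apply: leq_trans c2 _; rewrite addnA leq_add2r.
Qed.

Lemma follows_le s a b s' : follows s a s' -> a <= b -> follows s b s'.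
Proof. by case=> c p ab; split=> //; apply: leq_trans c _; rewrite leq_add2l. Qed.

Lemma follows_store s a v t : follows s t (store a v (tick t s)).
Proof. by split; rewrite /= ?prefix_refl. Qed.

Lemma follows_tick s t : follows s t (tick t s).
Proof. by split; rewrite /= ?prefix_refl. Qed.

Lemma unit_gt0 d : 0 < n.+2 ^ d * Q.
Proof. by rewrite muln_gt0 expn_gt0. Qed.

Lemma le_unit c k d : c <= k -> c <= k * (n.+2 ^ d * Q).
Proof. by move=> ck; apply: leq_trans ck _; rewrite leq_pmulr ?unit_gt0. Qed.

Lemma unit_mono d d' : d <= d' -> n.+2 ^ d * Q <= n.+2 ^ d' * Q.
Proof. by move=> dd; rewrite leq_mul2r leq_pexp2l ?orbT. Qed.

Lemma const_small m k : k <= nscalars -> small m (Const k).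
Proof.
move=> kn; rewrite /= andbT; apply: leq_trans kn _.
by rewrite /space_bound /abase addSn leqW ?leq_addr.
Qed.

Lemma dim_space : n.+2 <= space_bound.
Proof. by rewrite /space_bound (@leq_trans (narrays * n.+2)) ?leq_addl // leq_pmull. Qed.

Lemma dim_space1 v : v <= n.+1 -> v <= space_bound.
Proof. by move=> vn; apply: leq_trans (leqW vn) dim_space. Qed.

Lemma small_test x s k full : k < nscalars -> sim x s -> good s ->
  small (Defs.mem s) (Bin Lt (Cell (Const k.+1)) (bound full)) /\
  eval (Defs.mem s) (Bin Lt (Cell (Const k.+1)) (bound full)) = (sc x k < n + full).
Proof.
move=> kn [s0 sv _ _] [gm _ _ _]; have ck := const_small (Defs.mem s) kn.
have b1 : full + n <= n.+1 by case: full; rewrite ?add1n.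
split; last by rewrite /= sv // s0 addnC.
rewrite /= andbT in ck; rewrite /= s0 ck !dim_space1 //; first by case: (full).
by case: (_ < _).
Qed.

Lemma small_inc x s k : k < nscalars -> sim x s -> good s -> sc x k <= n ->
  small (Defs.mem s) (Bin Add (Cell (Const k.+1)) (Const 1)) /\
  eval (Defs.mem s) (Bin Add (Cell (Const k.+1)) (Const 1)) = (sc x k).+1.
Proof.
move=> kn [s0 sv _ _] [gm _ _ _] le; have ck := const_small (Defs.mem s) kn.
split; last by rewrite /= sv // addn1.
rewrite /= andbT in ck; rewrite /= sv // addn1 ck !dim_space1 //; exact: leqW.
Qed.

(** Stating every cost as a constant times [n.+2 ^ deg h * Q] lets the constants of consecutive
    parts simply add up; [Q > 0] allows constant work to be charged against this unit. *)
Definition simulated h := forall x s, cwf h -> sim x s -> good s ->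
  exists2 s', exec Q oracle (ccmd h) s s' &
  [/\ sim (den h x) s', good s' & follows s (konst h * (n.+2 ^ deg h * Q)) s'].

Lemma simulate_for k full p : simulated p -> simulated (HFor k full p).
Proof.
move=> IH x s; rewrite [cwf _]/= => /and3P[kn kp wp] xs sg.
rewrite [den _ _]/= [deg _]/= [ccmd _]/=.
set t0 := ((esize (Const k.+1) + esize (Const 0)) * w2).+1.
set t1 := (esize (Bin Lt (Cell (Const k.+1)) (bound full)) * w2).+1.
set t2 := ((esize (Const k.+1) + esize (Bin Add (Cell (Const k.+1)) (Const 1))) * w2).+1.
have -> : konst (HFor k full p) = t0 + (t1 + (t2 + konst p)) by [].
set N := n + full; set U := n.+2 ^ deg p * Q.
set body := Seq (ccmd p) _.
pose x' i := setv (foldl (fun x i => den p (setv x k i)) x (iota 0 i)) k i.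
have Nb : N <= n.+1 by rewrite /N; case: (full); rewrite ?addn1 ?addn0.
have knS : k.+1 < space_bound.
  by apply: (@leq_trans abase); rewrite ?ltnS // /space_bound leq_addr.
have cs m : ecost n m (Const k.+1) <= esize (Const k.+1) * w2.
  by apply/ecost_le/const_small.
(* With [d] rounds left there are [d.+1] tests, the last one failing. A full loop has [n.+1] rounds
   and so [n.+2] tests, whence the base of the cost bound. *)
have loop d i s1 : i + d = N -> sim (x' i) s1 -> good s1 ->
    exists2 s2, exec Q oracle (While (Bin Lt (Cell (Const k.+1)) (bound full)) body) s1 s2 &
    [/\ sim (x' N) s2, good s2 & follows s1 (d.+1 * (t1 + t2 + konst p * U)) s2].
  elim: d i s1 => [|d IHd] i s1 Ei xs1 sg1;
    have [smt Et] := small_test full kn xs1 sg1; rewrite [sc _ _]/= eqxx -/N in Et;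
    have ct := ecost_le smt.
    rewrite addn0 in Ei; rewrite Ei ltnn in Et; rewrite Ei in xs1.
    eexists; first exact: ExWhileStop.
    split; [exact: sim_tick | exact: good_tick | apply: follows_le (follows_tick _ _) _].
    by rewrite mul1n -addnA; apply: leq_trans (leq_addr _ _); rewrite ltnS.
  have iN : i < N by rewrite -Ei -addSnnS leq_addr.
  rewrite iN in Et.
  have [s2 e2 [xs2 sg2 f2]] := IH _ _ wp (sim_tick (ecost n (Defs.mem s1) (Bin Lt (Cell (Const k.+1)) (bound full))).+1 xs1) (good_tick _ sg1).
  have Ek : sc (den p (x' i)) k = i by rewrite modvP //= eqxx.
  have [|smi Ei2] := small_inc kn xs2 sg2; first by rewrite Ek -ltnS (leq_trans iN).
  rewrite Ek in Ei2; set e := Bin Add _ _ in smi Ei2.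
  pose c3 := (ecost n (Defs.mem s2) (Const k.+1) + ecost n (Defs.mem s2) e).+1.
  pose s3 := store k.+1 i.+1 (tick c3 s2).
  have e3 : exec Q oracle (Store (Const k.+1) e) s2 s3.
    by rewrite /s3 -{1}Ei2; apply: ExStore.
  have xs3 : sim (x' i.+1) s3.
    rewrite /x' foldl_iotaS; exact/sim_setv/sim_tick.
  have sg3 : good s3.
    by apply: good_store => //; [apply: leq_trans iN _ | apply: good_tick].
  have [|s4 e4 [xs4 sg4 f4]] := IHd i.+1 s3 _ xs3 sg3; first by rewrite addSnnS.
  exists s4.
    by apply: ExWhileLoop e4; rewrite ?Et //; apply: ExSeq e2 e3.
  split=> //; rewrite mulSn; apply: follows_trans f4.
  rewrite -addnA; apply: (@follows_trans _ (tick (ecost n (Defs.mem s1) (Bin Lt (Cell (Const k.+1)) (bound full))).+1 s1)).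
    by apply: follows_le (follows_tick _ _) _; rewrite ltnS.
  rewrite addnC; apply: follows_trans f2 _.
  apply: follows_le (follows_store _ _ _ _) _.
  by rewrite /c3 ltnS mulnDl leq_add // ecost_le.
have sg0 : good (store k.+1 0 (tick t0 s)) by apply: good_store => //; apply: good_tick.
pose c0 := (ecost n (Defs.mem s) (Const k.+1) + ecost n (Defs.mem s) (Const 0)).+1.
have sg1 : good (store k.+1 0 (tick c0 s)) by apply: good_store => //; apply: good_tick.
have xs1 : sim (x' 0) (store k.+1 0 (tick c0 s)) by apply: sim_setv => //; apply: sim_tick.
have [s2 e2 [xs2 sg2 f2]] := loop N 0 _ (add0n _) xs1 sg1.
exists s2; first by apply: ExSeq e2; apply: ExStore.
split=> //; apply: (@follows_le _ (c0 + N.+1 * (t1 + t2 + konst p * U))).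
  exact: follows_trans (follows_store _ _ _ _) f2.
have U0 : 0 < U by apply: unit_gt0.
rewrite expnS -mulnA -/U mulnDl leq_add //.
  apply: leq_trans (_ : t0 <= _); last by rewrite leq_pmulr // muln_gt0.
  by rewrite /c0 /t0 ltnS mulnDl leq_add //; apply/ecost_le/const_small.
rewrite mulnCA leq_mul // addnA mulnDl leq_add2r.
by rewrite leq_pmulr.
Qed.

Theorem simulate h : simulated h.
Proof.
elim: h => [|k e|b i e|k o b|b|p IHp q IHq|e p IHp q IHq|k full p IHp]; last exact: simulate_for.
- move=> x s _ xs sg; exists (tick 1 s); first exact: ExSkip.
  split; [exact: sim_tick | exact: good_tick | apply: follows_le (follows_tick _ _) _].
  by rewrite mul1n expn0 mul1n.
- move=> x s /= /andP[kn we] xs sg; have [E le sm] := cexprP we xs sg.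
  have kb : k.+1 < space_bound by apply: (@leq_trans abase); rewrite ?ltnS // /space_bound leq_addr.
  eexists; first exact: ExStore.
  rewrite E; split; [exact/sim_setv/sim_tick | exact/good_store/good_tick |].
  apply: follows_le (follows_store _ _ _ _) _; apply: le_unit.
  by rewrite ltnS mulnDl leq_add ?ecost_le // const_small.
- move=> x s /= /and3P[bn wi we] xs sg; have [E le sm] := cexprP we xs sg.
  have [Ei lei _] := cexprP wi xs sg; have [Ea sma] := addrP bn wi xs sg.
  eexists; first exact: ExStore.
  rewrite E Ea; split; [exact/sim_seta/sim_tick | exact/good_store/good_tick/sg/le/adr_lt |].
  apply: follows_le (follows_store _ _ _ _) _; apply: le_unit.
  by rewrite ltnS mulnDl leq_add ?ecost_le.
- move=> x s; rewrite [cwf _]/= => /andP[kn bn] xs sg.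
  have kb : k.+1 < space_bound by apply: (@leq_trans abase); rewrite ?ltnS // /space_bound leq_addr.
  have [Ea sma] := addrP (e := HBool false) bn isT xs sg.
  eexists; first exact: ExQuery.
  rewrite Ea (sim_block bn xs).
  split; [exact/sim_setv/sim_tick | apply/good_store/good_tick/sg => //; by case: (oracle _ _) |].
  apply: follows_le (follows_store _ _ _ _) _.
  have -> : konst (HAsk k o b) = ((esize (Const k.+1) + esize (addr b (Const 0))) * w2).+1 + 1.
    by rewrite addn1.
  rewrite mulnDl mul1n leq_add //; last by rewrite expn0 mul1n.
  by apply: le_unit; rewrite ltnS mulnDl leq_add ?ecost_le // const_small.
- move=> x s; rewrite [cwf _]/= => bn xs sg.
  have [Ea sma] := addrP (e := HBool false) bn isT xs sg.
  eexists; first exact: ExOutput.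
  rewrite Ea; set t := _ + n.
  have [s0 sv sa so] := xs; have [gm gu gp gl] := sg; split.
  - by split=> //=; rewrite /outputs map_rcons /= -/(outputs s) so (sim_block bn xs).
  - split=> //=; rewrite all_rcons leqnn /=; apply: sub_all gl => z /leq_trans; apply.
    exact: leq_addr.
  split; last by rewrite /= prefix_rcons.
  rewrite [clock _]/= leq_add2l /t.
  have -> : konst (HOut b) = (esize (addr b (Const 0)) * w2).+1 + 1 by rewrite addn1.
  rewrite mulnDl mul1n leq_add //; first by apply: le_unit; rewrite ltnS ecost_le.
  by rewrite expn1; apply: leq_trans (_ : n.+2 <= _); rewrite ?leqW // leq_pmulr.
- move=> x s /= /andP[wp wq] xs sg; have [s1 e1 [x1 g1 f1]] := IHp x s wp xs sg.
  have [s2 e2 [x2 g2 f2]] := IHq _ _ wq x1 g1; exists s2; first exact: ExSeq e1 e2.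
  split=> //; apply: follows_le (follows_trans f1 f2) _; rewrite mulnDl.
  by rewrite leq_add // leq_mul2l unit_mono ?orbT // ?leq_maxl ?leq_maxr.
- move=> x s /= /and3P[we wp wq] xs sg; have [E _ sm] := cexprP we xs sg.
  have [s1 e1 [x1 g1 f1]] : exists2 s1,
     exec Q oracle (if heval x e != 0 then ccmd p else ccmd q)
        (tick (ecost n (Defs.mem s) (cexpr e)).+1 s) s1 &
     [/\ sim (if heval x e != 0 then den p x else den q x) s1, good s1 &
       follows (tick (ecost n (Defs.mem s) (cexpr e)).+1 s)
         ((konst p + konst q) * (n.+2 ^ maxn (deg p) (deg q) * Q)) s1].
    set s0 := tick _ s; have xs0 : sim x s0 by apply: sim_tick.
    have sg0 : good s0 by apply: good_tick.
    case: ifP => _; [have [s1 e1 [x1 g1 f1]] := IHp x s0 wp xs0 sg0 | have [s1 e1 [x1 g1 f1]] := IHq x s0 wq xs0 sg0];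
      exists s1 => //; split=> //; apply: follows_le f1 _; apply: leq_mul;
      rewrite ?unit_mono ?leq_maxl ?leq_maxr ?leq_addl ?leq_addr //.
  exists s1; first by apply: ExIf; rewrite E.
  split=> //; rewrite -addnA mulnDl; apply: follows_trans f1.
  apply: follows_le (follows_tick _ _) _; apply: le_unit.
  by rewrite ltnS ecost_le.
Qed.

(** * A main loop with time bounds for every round *)

Variables (init body : hcmd) (go : nat).
Hypotheses (wi : cwf init) (wb : cwf body) (wg : go < nscalars).

Definition program := Seq (ccmd init) (While (Cell (Const go.+1)) (ccmd body)).

Definition hst0 : hst n := HSt (fun _ => 0) (fun _ _ => 0) [::].

Definition state_at k := iter k (den body) (den init hst0).

Definition round_cost := ((esize (Cell (Const go.+1)) * w2).+1 + konst body) * (n.+2 ^ deg body * Q).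

Lemma good_init : good (init_state n) /\ sim hst0 (init_state n).
Proof.
have m1 a : (if a == 0 then n else 0) <= n.+1 by case: ifP.
split; last first.
  split=> //= b i bn ib; rewrite ifF //.
split=> //.
apply: leq_trans (bits_le _ m1) _; rewrite leq_mul2r; apply/orP; right.
by rewrite /space_bound.
Qed.

Lemma count_log (s : state n) x : good s -> sim x s -> count (fun e => e.1 <= clock s) (log s) = size (out x).
Proof.
move=> [_ _ _ gl] [_ _ _ <-]; rewrite size_map; apply/eqP.
by rewrite -all_count.
Qed.

(** The log only grows at its end, so what is present after round [j] keeps its time stamps in the
    final log; this turns bounds on rounds into bounds on single outputs. *)
Lemma loop_run K i d s : i + d = K -> sim (state_at i) s -> good s ->
  (forall k, k < K -> sc (state_at k) go <> 0) -> sc (state_at K) go = 0 ->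
  exists s', [/\ exec Q oracle (While (Cell (Const go.+1)) (ccmd body)) s s',
    sim (state_at K) s', good s', prefix (log s) (log s') &
    forall j, j <= d -> size (out (state_at (i + j))) <= outputs_by s' (clock s + j * round_cost)].
Proof.
move=> + + + Hlt HK; elim: d i s => [|d IH] i s Ei xs sg; have [s0 sv _ _] := xs.
  rewrite addn0 in Ei; rewrite Ei in xs sv *.
  eexists; split.
  - by apply: ExWhileStop; rewrite /= sv.
  - exact: sim_tick.
  - exact: good_tick.
  - exact: prefix_refl.
  by move=> j; rewrite leqn0 => /eqP->; rewrite !addn0 -(count_log sg xs).
set c := (ecost n (Defs.mem s) (Cell (Const go.+1))).+1.
have cb : c <= (esize (Cell (Const go.+1)) * w2).+1.
  rewrite ltnS ecost_le //=; have [gm _ _ _] := sg; rewrite dim_space1 ?gm //=.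
  exact: (const_small (Defs.mem s) wg).
have [s1 e1 [x1 g1 f1]] := simulate wb (sim_tick c xs) (good_tick c sg).
have [|s2 [e2 x2 g2 p2 H2]] := IH i.+1 s1 _ x1 g1; first by rewrite addSnnS.
have [c1 p1] : follows s round_cost s1.
  rewrite /round_cost mulnDl; apply: follows_trans f1.
  by apply: follows_le (follows_tick _ _) _; apply: le_unit.
have p12 := prefix_trans p1 p2.
have iK : i < K by rewrite -Ei -addSnnS leq_addr.
exists s2; split=> //.
  apply: ExWhileLoop e2; last exact: e1.
  by rewrite /= sv //; apply: Hlt.
case=> [_|j jd]; last first.
  rewrite -addSnnS; apply: leq_trans (H2 j jd) _; apply: sub_count => z /leq_trans; apply.
  by rewrite mulSn addnA leq_add2r.
rewrite !addn0 -(count_log sg xs) /outputs_by.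
by case/prefixP: p12 => l ->; rewrite count_cat leq_addr.
Qed.

Theorem program_run K :
  (forall k, k < K -> sc (state_at k) go <> 0) -> sc (state_at K) go = 0 ->
  exists s, [/\ exec Q oracle program (init_state n) s, good s, outputs s = out (state_at K) &
    forall k, k <= K -> size (out (state_at k)) <=
      outputs_by s (konst init * (n.+2 ^ deg init * Q) + k * round_cost)].
Proof.
move=> Hlt HK; have [gi xi] := good_init.
have [s1 e1 [x1 g1 [c1 _]]] := simulate wi xi gi.
have [s2 [e2 x2 g2 _ H2]] := loop_run (add0n K) x1 g1 Hlt HK.
exists s2; split=> //; first exact: ExSeq e1 e2.
  by case: x2.
move=> k kK; apply: leq_trans (H2 k kK) _; apply: sub_count => z /leq_trans; apply.
by rewrite leq_add2r.
Qed.

End Semantics.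

(** * The program *)

Notation "p ;; q" := (HSeq p q) (at level 90, right associativity).
Notation HZero := (HBool false).
Notation HOne := (HBool true).
Notation HNot e := (HEq e (HBool false)).

(* [vphase] tells the search from the lexicographic phase and [vgo] whether to go
   on. The current node is [(vj, aK)] with threshold [vtau]; unless [vfresh] is
   set, [(vml, vmf, vma, vmb)] is the last move tried there. *)
Definition vr := 0. Definition vphase := 1. Definition vgo := 2. Definition vtau := 3.
Definition vj := 4. Definition vfresh := 5. Definition vml := 6. Definition vmf := 7.
Definition vma := 8. Definition vmb := 9.
Definition vx := 10. Definition vf := 11. Definition vtail := 12. Definition vh := 13.
Definition vu := 14. Definition vv := 15. Definition vq := 16. Definition vq2 := 17.
Definition vside := 18.

Definition aR := 0. Definition aK := 1. Definition aI := 2. Definition aW := 3.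
Definition aG := 4. Definition aM := 5. Definition aQ := 6. Definition aN := 7.

Definition TOG b k := HPut b (HVar k) (HNot (HGet b (HVar k))).

(** [vq2] must hold the answer of the first oracle on the set with [u] toggled, so the test for
    [ends false] needs no query of its own. *)
Definition PUSH e :=
  HIf (HAnd (HEq (HVar vx) HDim) (HAnd (HNot (HGet aW (HVar vu))) (HVar vq2)))
    (HSet vx (HVar vu) ;; HSet vf e) HSkip ;;
  HPut aM (HVar vu) HOne ;; HPut aQ (HVar vtail) (HVar vu) ;; HSet vtail (HInc (HVar vtail)).

Definition SEED :=
  HIf (HAnd (HNot (HGet aM (HVar vu))) (HAnd (HGet aG (HVar vu)) (HNot (HGet aW (HVar vu)))))
    (TOG aW vu ;; HAsk vq true aW ;; HAsk vq2 false aW ;; TOG aW vu ;;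
     HIf (HVar vq) (PUSH HDim) HSkip)
    HSkip.

Definition SCAN :=
  HIf (HAnd (HAnd (HEq (HVar vx) HDim) (HNot (HGet aM (HVar vu))))
            (HAnd (HGet aG (HVar vu)) (HEq (HNot (HGet aW (HVar vu))) (HVar vside))))
    (TOG aW vu ;; HAsk vq2 false aW ;; TOG aW vv ;;
     HIf (HVar vside) (HAsk vq true aW) (HAsk vq false aW) ;;
     TOG aW vv ;; TOG aW vu ;;
     HIf (HVar vq) (PUSH (HVar vv)) HSkip)
    HSkip.

Definition VISIT :=
  HIf (HLt (HVar vh) (HVar vtail))
    (HSet vv (HGet aQ (HVar vh)) ;; HSet vside (HNot (HNot (HGet aW (HVar vv)))) ;;
     HFor vu false SCAN)
    HSkip.

Definition STEP :=
  HFor vu false (HPut aM (HVar vu) HZero) ;;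
  HSet vtail HZero ;; HSet vx HDim ;; HSet vf HDim ;;
  HFor vu false SEED ;; HFor vh false VISIT.

Definition oval n (o : option 'I_n) : nat := if o is Some i then i else n.

Lemma foldl_map A B S (f : S -> B -> S) (h : A -> B) z l :
  foldl f z (map h l) = foldl (fun s a => f s (h a)) z l.
Proof. by elim: l z => /=. Qed.

Section Sets.

Variable n : nat.
Implicit Types (f g : nat -> nat) (o : option 'I_n) (i : 'I_n).
Notation cset := (cset n).

Lemma oval_inj : injective (@oval n).
Proof.
move=> [i|] [j|] //= E; first by congr Some; apply: val_inj.
- by have := ltn_ord i; rewrite E ltnn.
- by have := ltn_ord j; rewrite -E ltnn.
Qed.

Lemma oval_n o : (oval o == n) = ~~ isSome o.
Proof. by case: o => [i|] /=; rewrite ?eqxx // ltn_eqF. Qed.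

Lemma csetE f i : (i \in cset f) = (f i != 0).
Proof. by rewrite inE. Qed.

Lemma cset0E f i : (f i == 0) = (i \notin cset f).
Proof. by rewrite inE negbK. Qed.

Lemma cset_put f o (b : bool) :
  cset (fun j => if j == oval o then b : nat else f j) =
  if b then oadd o (cset f) else odel o (cset f).
Proof.
apply/setP=> i.
have -> : (i \in cset (fun j => if j == oval o then b : nat else f j)) =
    (if Some i == o then b else i \in cset f).
  rewrite !inE -[val i]/(oval (Some i)) (inj_eq oval_inj).
  by case: (Some i == o) => //; case: b.
by case: b; rewrite ?in_oadd ?in_odel; case: (Some i == o).
Qed.

Lemma cset_tog f i :
  cset (fun j => if j == i then (f i == 0) : nat else f j) = tog i (cset f).
Proof.
have /= := cset_put f (Some i) (f i == 0); rewrite /tog => ->.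
by rewrite cset0E; case: (i \in cset f).
Qed.

Lemma togK i (X : {set 'I_n}) : tog i (tog i X) = X.
Proof.
rewrite /tog; case iX: (i \in X); last by rewrite !inE eqxx setU1K // iX.
by rewrite !inE eqxx /= setD1K.
Qed.

End Sets.

Section Programs.

Variables (n : nat) (M : bool -> matroid 'I_n).
Implicit Types (x y : hst n) (I G : {set 'I_n}).

Notation den := (den (fun b => indep (M b))).
Notation cset := (cset n).

Lemma den_for k p x :
  den (HFor k false p) x =
  setv (foldl (fun x (i : 'I_n) => den p (setv x k i)) x (enum 'I_n)) k n.
Proof. by rewrite /= addn0 -val_enum_ord foldl_map. Qed.

Lemma den_for_full k p x :
  den (HFor k true p) x =
  setv (foldl (fun x o => den p (setv x k (oval o))) x (opts n)) k n.+1.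
Proof.
rewrite /= addn1 foldl_iotaS -val_enum_ord foldl_map /opts.
by rewrite -cats1 foldl_cat (@foldl_map _ _ _ _ Some).
Qed.

Lemma for_rel S (R : hst n -> S -> Prop) k p (g : S -> 'I_n -> S) x z :
  R x z -> (forall x z v, R x z -> R (setv x k v) z) ->
  (forall (i : 'I_n) x z, R x z -> sc x k = i -> R (den p x) (g z i)) ->
  R (den (HFor k false p) x) (foldl g z (enum 'I_n)).
Proof.
move=> R0 RV RS; rewrite den_for; apply: (RV).
elim: (enum 'I_n) x z R0 => //= i l IH x z H; apply: IH; apply: (RS); first exact: RV.
by rewrite /= eqxx.
Qed.

Lemma for_full_rel S (R : hst n -> S -> Prop) k p (g : S -> option 'I_n -> S) x z :
  R x z -> (forall x z v, R x z -> R (setv x k v) z) ->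
  (forall o x z, R x z -> sc x k = oval o -> R (den p x) (g z o)) ->
  R (den (HFor k true p) x) (foldl g z (opts n)).
Proof.
move=> R0 RV RS; rewrite den_for_full; apply: (RV).
elim: (opts n) x z R0 => //= i l IH x z H; apply: IH; apply: (RS); first exact: RV.
by rewrite /= eqxx.
Qed.

Lemma for_iota_rel S (R : hst n -> S -> Prop) k p (g : S -> nat -> S) x z :
  R x z -> (forall x z v, R x z -> R (setv x k v) z) ->
  (forall i x z, R x z -> sc x k = i -> R (den p x) (g z i)) ->
  R (den (HFor k false p) x) (foldl g z (iota 0 n)).
Proof.
move=> R0 RV RS /=; apply: (RV); rewrite addn0.
elim: (iota 0 n) x z R0 => //= i l IH x z H; apply: IH; apply: (RS); first exact: RV.
by rewrite /= eqxx.
Qed.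

Lemma for_ind (P : nat -> hst n -> Prop) k p x :
  P 0 x -> (forall i x v, P i x -> P i (setv x k v)) ->
  (forall (i : 'I_n) x, P i x -> sc x k = i -> P i.+1 (den p x)) ->
  P n (den (HFor k false p) x).
Proof.
move=> P0 PV PS; rewrite den_for; apply: (PV).
apply: (foldl_enum_ind (P := P)) => // i z Pz; apply: PS; first exact: PV.
by rewrite /= eqxx.
Qed.

Definition bfs_rel I G x (st : sstate 'I_n) :=
  [/\ cset (ar x aW) = I, cset (ar x aG) = G, cset (ar x aM) = [set u in st.1] &
  [/\ sc x vtail = size st.1, uniq st.1,
      forall i v, onth st.1 i = Some v -> ar x aQ i = v,
      sc x vx = oval st.2.1 & sc x vf = oval st.2.2]].

Lemma bfs_relV I G x st k v : k \notin [:: vtail; vx; vf] ->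
  bfs_rel I G x st -> bfs_rel I G (setv x k v) st.
Proof.
rewrite !inE !negb_or => /and3P[k1 k2 k3] [? ? ? [? ? ? ? ?]].
by split=> //; split=> //=; rewrite ifN // eq_sym.
Qed.

Lemma push_ok I G x st (u : 'I_n) p e : bfs_rel I G x st -> sc x vu = u ->
  u \notin st.1 -> sc x vq2 = M false (tog u I) -> heval x e = oval p ->
  (forall v, heval (setv x vx v) e = heval x e) ->
  bfs_rel I G (den (PUSH e) x) (push M I st u p).
Proof.
move=> [EW EG EM [Et Uq EQ Ex Ef]] Eu uq Eq2 Ee He.
(* The queue together with the new [u] has no repetitions, so the tail is a proper index and its
   increment does not saturate. *)
have sz : size st.1 < n.
  have : size (u :: st.1) <= #|'I_n|.
    by rewrite -(card_uniqP (_ : uniq (u :: st.1))) ?max_card //= uq.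
  by rewrite card_ord.
rewrite /PUSH /=; rewrite Ex oval_n Eu cset0E EW Eq2.
set y := (if _ then _ else _).
have Hy : [/\ ar y = ar x, sc y vtail = sc x vtail, sc y vu = u,
   sc y vx = oval (push M I st u p).2.1 & sc y vf = oval (push M I st u p).2.2].
  rewrite /y /push /= !eqb0 negbK.
  case uI: (u \in I) => /=; rewrite ?andbF /=.
    by rewrite -Ex -Ef.
  rewrite /tog uI; case rN: (isSome st.2.1); case Mu: (M false (u |: I)); rewrite /= -?Ex -?Ef //.
  by rewrite He Ee Eu.
case: Hy => Ha Ey1 Ey2 Ey3 Ey4.
split=> /=; rewrite ?Ha ?Ey2 //; last split=> /=.
- rewrite -[1]/(nat_of_bool true) -[nat_of_ord u]/(oval (Some u)) cset_put /= EM.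
  by apply/setP=> z; rewrite !inE mem_rcons inE.
- by rewrite Ey1 Et size_rcons ltnS (ltnW sz) addn1.
- by rewrite rcons_uniq uq.
- move=> i v; rewrite -cats1 onth_cat Ey1 Et; case: ltnP => [lt|ge].
    by rewrite ltn_eqF //; apply: EQ.
  case E: (i - size st.1) => [|d] //=; last by rewrite onth0n.
  case=> <-; rewrite ifT //; apply/eqP/anti_leq; rewrite ge andbT -subn_eq0 E //.
- by rewrite Ey3.
- by rewrite Ey4.
Qed.

Lemma denS p q x : den (p ;; q) x = den q (den p x). Proof. by []. Qed.

Lemma denIf e p q x :
  den (HIf e p q) x = if heval x e != 0 then den p x else den q x.
Proof. by []. Qed.

Lemma denSet k e x : den (HSet k e) x = setv x k (heval x e). Proof. by []. Qed.

Lemma denAsk k o b x : den (HAsk k o b) x = setv x k (M o (cset (ar x b))).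
Proof. by []. Qed.

Definition hevalE := (eqb0, negbK).

Lemma tog_ok x b k (i : 'I_n) : sc x k = i -> let y := den (TOG b k) x in
  [/\ sc y = sc x, cset (ar y b) = tog i (cset (ar x b)),
     forall c, c != b -> ar y c = ar x c & out y = out x].
Proof.
move=> Ek; split=> //=; last by move=> c /negPf->.
by rewrite eqxx Ek cset_tog.
Qed.

Lemma seed_ok I G x st (u : 'I_n) : bfs_rel I G x st -> sc x vu = u ->
  bfs_rel I G (den SEED x) (seed M G I st u).
Proof.
move=> Hx Eu; have [EW EG EM [Et Uq EQ Ex Ef]] := Hx.
rewrite /SEED denIf /seed.
have -> : (heval x (HAnd (HNot (HGet aM (HVar vu))) (HAnd (HGet aG (HVar vu)) (HNot (HGet aW (HVar vu))))) != 0) =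
    [&& u \notin st.1, u \in G & u \notin I].
  rewrite /= !hevalE Eu !cset0E EG EM EW inE.
  by case: (u \in st.1); case: (u \in G); case: (u \in I).
case: ifP => [/and3P[uq uG uI]|]; last first.
  by case: (u \in st.1); case: (u \in G); case: (u \in I).
rewrite uq uG uI !andTb !denS.
have [S1 W1 A1 _] := @tog_ok x aW vu u Eu.
move: (den (TOG aW vu) x) S1 W1 A1 => y1 S1 W1 A1.
rewrite !denAsk; set y2 := setv (setv _ _ _) _ _.
have [|S2 W2 A2 _] := @tog_ok y2 aW vu u; first by rewrite /= S1.
move: (den (TOG aW vu) y2) S2 W2 A2 => y3 S2 W2 A2.
have E3 : cset (ar y3 aW) = I by rewrite W2 /= W1 togK.
have a3 c : c != aW -> ar y3 c = ar x c by move=> ca; rewrite A2 //= A1.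
have uI' : tog u I = u |: I by rewrite /tog (negPf uI).
have H3 : bfs_rel I G y3 st.
  by split; rewrite ?E3 ?a3 //; split; rewrite ?S2 /= ?S1.
rewrite denIf; have -> : (heval y3 (HVar vq) != 0) = M true (u |: I).
  by rewrite /= S2 /= hevalE negbK W1 EW uI'.
case: ifP => _ //; apply: push_ok => //.
- by rewrite S2 /= S1.
- by rewrite S2 /= W1 EW.
Qed.

Lemma scan_ok I G x st (u v : 'I_n) : bfs_rel I G x st -> sc x vu = u ->
  sc x vv = v -> sc x vside = (v \in I) ->
  let y := den SCAN x in
  [/\ bfs_rel I G y (scan M G I v st u), sc y vv = v & sc y vside = (v \in I)].
Proof.
move=> Hx Eu Ev Es; have [EW EG EM [Et Uq EQ Ex Ef]] := Hx.
have fr k : k \notin modv SCAN -> sc (den SCAN x) k = sc x k by apply: modvP.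
cbv zeta; rewrite (fr vv) // (fr vside) //; split=> // {fr}.
rewrite /SCAN denIf /scan /edge.
have -> : (heval x (HAnd (HAnd (HEq (HVar vx) HDim) (HNot (HGet aM (HVar vu))))
    (HAnd (HGet aG (HVar vu)) (HEq (HNot (HGet aW (HVar vu))) (HVar vside)))) != 0) =
    [&& ~~ isSome st.2.1, u \notin st.1, u \in G & (u \in I) != (v \in I)].
  rewrite /= !hevalE Eu Ex oval_n !cset0E EG EM EW inE Es.
  by case: (isSome _); case: (u \in st.1); case: (u \in G); case: (u \in I); case: (v \in I).
case: ifP => [/and4P[rN uq uG uv]|]; last first.
  by case: (isSome _); case: (u \in st.1); case: (u \in G); case: (u \in I); case: (v \in I).
rewrite rN uq uG uv !andTb !denS.
have [S1 W1 A1 _] := @tog_ok x aW vu u Eu.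
move: (den (TOG aW vu) x) S1 W1 A1 => y1 S1 W1 A1.
rewrite denAsk; set y2 := setv _ _ _.
have [|S3 W3 A3 _] := @tog_ok y2 aW vv v; first by rewrite /= S1.
move: (den (TOG aW vv) y2) S3 W3 A3 => y3 S3 W3 A3.
rewrite [den (HIf (HVar vside) _ _) _]denIf !denAsk; set y4 := if _ then _ else _.
have E4 : y4 = setv y3 vq (M (v \in I) (tog v (tog u I))).
  rewrite /y4 /= S3 /= S1 Es W3 /= W1 EW.
  by case: (v \in I).
rewrite E4; set y5 := setv _ _ _.
have [|S6 W6 A6 _] := @tog_ok y5 aW vv v; first by rewrite /= S3 /= S1.
move: (den (TOG aW vv) y5) S6 W6 A6 => y6 S6 W6 A6.
have [|S7 W7 A7 _] := @tog_ok y6 aW vu u; first by rewrite S6 /= S3 /= S1.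
move: (den (TOG aW vu) y6) S7 W7 A7 => y7 S7 W7 A7.
have E7 : cset (ar y7 aW) = I by rewrite W7 W6 /= W3 /= W1 !togK.
have a7 c : c != aW -> ar y7 c = ar x c by move=> ca; rewrite A7 // A6 // /= A3 // /= A1.
have H7 : bfs_rel I G y7 st.
  by split; rewrite ?E7 ?a7 //; split; rewrite ?S7 ?S6 /= ?S3 /= ?S1.
rewrite denIf; have -> : (heval y7 (HVar vq) != 0) = M (v \in I) (tog v (tog u I)).
  by rewrite /= S7 S6 /= hevalE negbK.
case: ifP => _ //; apply: push_ok => //.
- by rewrite S7 S6 /= S3 /= S1.
- by rewrite S7 S6 /= S3 /= W1 EW.
- by rewrite /= S7 S6 /= S3 /= S1.
Qed.

Lemma visit_ok I G x st h : bfs_rel I G x st -> sc x vh = h ->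
  bfs_rel I G (den VISIT x) (visit M G I st h).
Proof.
move=> Hx Eh; have [EW EG EM [Et Uq EQ Ex Ef]] := Hx.
rewrite /VISIT denIf /visit.
have -> : (heval x (HLt (HVar vh) (HVar vtail)) != 0) = (h < size st.1).
  by rewrite /= eqb0 negbK Eh Et.
case Ev: (onth st.1 h) => [v|]; last by rewrite ifN // -leqNgt -onthNE Ev.
rewrite ifT; last by rewrite -onthTE Ev.
rewrite !denS !denSet.
have -> : heval x (HGet aQ (HVar vh)) = v by rewrite /= Eh; apply: EQ.
set y := setv _ _ _.
have Hy : [/\ bfs_rel I G y st, sc y vv = v & sc y vside = (v \in I)].
  split; [by do 2!apply: bfs_relV => // | by [] |].
  by rewrite /y /= !hevalE -EW csetE.
pose R (y : hst n) st := [/\ bfs_rel I G y st, sc y vv = v & sc y vside = (v \in I)].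
have [] // : R (den (HFor vu false SCAN) y) (foldl (scan M G I v) st (enum 'I_n)).
apply: for_rel => //.
by move=> u z st' [Hz E1 E2] Eu; apply: scan_ok.
Qed.

Lemma clear_ok x k : cset (ar (den (HFor k false (HPut aM (HVar k) HZero)) x) aM) = set0 /\
  forall c, c != aM -> ar (den (HFor k false (HPut aM (HVar k) HZero)) x) c = ar x c.
Proof.
pose P i (y : hst n) := cset (ar y aM) \subset ~: [set j : 'I_n | j < i] /\
  forall c, c != aM -> ar y c = ar x c.
have [H1 H2] : P n (den (HFor k false (HPut aM (HVar k) HZero)) x).
  apply: for_ind => //; first by split=> //; apply/subsetP => j; rewrite !inE.
  move=> i y [H1 H2] Ek; split=> [|c /negPf ca]; last by rewrite /= ca -H2 // ca.
  rewrite /= Ek; have /= -> := cset_put (ar y aM) (Some i) false.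
  apply/subsetP => j; rewrite !inE => /andP[ji jM].
  have := subsetP H1 j; rewrite !inE => /(_ jM); rewrite -!leqNgt => ij.
  by rewrite ltn_neqAle ij andbT eq_sym.
split=> //; apply/setP=> j; rewrite [RHS]inE; apply/negP => /(subsetP H1).
by rewrite !inE ltn_ord.
Qed.

Lemma step_ok x I G : cset (ar x aW) = I -> cset (ar x aG) = G ->
  let y := den STEP x in
  [/\ cset (ar y aW) = I, sc y vx = oval (step M G I).1 & sc y vf = oval (step M G I).2].
Proof.
move=> EW EG; suff : bfs_rel I G (den STEP x) (foldl (visit M G I) (seeds M G I) (iota 0 #|'I_n|)).
  by case=> ? _ _ [].
rewrite card_ord /STEP !denS !denSet; have [H1 H2] := clear_ok x vu.
move: (den _ x) H1 H2 => y H1 H2.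
apply: for_iota_rel; [|by move=> *; apply: bfs_relV|by move=> *; apply: visit_ok].
apply: for_rel; [|by move=> *; apply: bfs_relV|by move=> *; apply: seed_ok].
split; [by rewrite /= H2 | by rewrite /= H2 | by rewrite /= H1; apply/setP=> u; rewrite !inE |].
by split=> // i v; rewrite onth0n.
Qed.

End Programs.

(** * Subroutines: completion, augmentation, lexicographic successor *)

Definition vi := 19. Definition vl1 := 20. Definition vl2 := 21. Definition vc := 22.
Definition vk := 23. Definition ve := 24. Definition vlo := 25. Definition vok := 26.
Definition vp := 27. Definition vpos := 28. Definition vst := 29. Definition vqf := 30.

Notation OR a b := (HNot (HAnd (HNot a) (HNot b))).

Definition BUILD c e := HFor vk false (HPut c (HVar vk) e).
Definition COPY b c := BUILD c (HGet b (HVar vk)).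
Definition FORALL v e := HSet v HOne ;; HFor vk false (HIf e HSkip (HSet v HZero)).
Definition EQUAL b c := FORALL ve (HEq (HNot (HGet b (HVar vk))) (HNot (HGet c (HVar vk)))).
Definition CARD b :=
  HSet vc HZero ;; HFor vk false (HIf (HGet b (HVar vk)) (HSet vc (HInc (HVar vc))) HSkip).

Definition COMPLETE :=
  HFor vi false
    (HIf (HAnd (HGet aG (HVar vi)) (HNot (HGet aW (HVar vi))))
       (HPut aW (HVar vi) HOne ;; HAsk vq false aW ;; HAsk vq2 true aW ;;
        HIf (HAnd (HVar vq) (HVar vq2)) HSkip (HPut aW (HVar vi) HZero))
       HSkip).

Definition IMPROVE := STEP ;; HPut aW (HVar vx) HOne ;; HPut aW (HVar vf) HZero.
(** Two full loops give the [n.+1 * n.+1] rounds in the definition of [augmented]. *)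
Definition AUGMENT := HFor vl1 true (HFor vl2 true IMPROVE).

Definition FEASIBLE :=
  COPY aI aW ;; BUILD aG (HNot (HLt (HVar vk) (HVar vlo))) ;;
  HAsk vq false aW ;; HAsk vq2 true aW ;; HSet vok (HAnd (HVar vq) (HVar vq2)) ;;
  AUGMENT ;; CARD aW ;; HSet vok (HAnd (HVar vok) (HEq (HVar vc) (HVar vr))).

Definition FILL :=
  HFor vqf false
    (HIf (HLt (HVar vqf) (HVar vst)) HSkip
       (HSet vlo (HInc (HVar vqf)) ;; FEASIBLE ;;
        HIf (HVar vok) HSkip (HPut aI (HVar vqf) HOne))).

Definition PREFIX v :=
  BUILD aI (OR (HAnd (HLt (HVar vk) (HVar v)) (HGet aK (HVar vk))) (HEq (HVar vk) (HVar v))).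

Definition BRANCH :=
  HSet vpos HDim ;;
  HFor vp false
    (HIf (HGet aK (HVar vp)) HSkip
       (PREFIX vp ;; HSet vlo (HInc (HVar vp)) ;; FEASIBLE ;;
        HIf (HVar vok) (HSet vpos (HVar vp)) HSkip)).

Ltac frame1 :=
  first [rewrite modvP; last by vm_compute | rewrite modaP; last by vm_compute].
Ltac frame := repeat frame1.

Lemma foldl_const (A B : Type) (f : A -> A) (l : seq B) z :
  foldl (fun a _ => f a) z l = iter (size l) f z.
Proof. by elim: l z => //= b l IH z; rewrite IH -iterSr. Qed.

Section Programs.

Variables (n : nat) (M : bool -> matroid 'I_n).
Implicit Types (x y : hst n) (I G : {set 'I_n}).

Notation den := (den (fun b => indep (M b))).
Notation cset := (cset n).

Lemma build_ok c e x (P : pred 'I_n) :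
  (forall (i : 'I_n) y, sc y vk = i -> (forall k, k != vk -> sc y k = sc x k) ->
     (forall b, b != c -> ar y b = ar x b) -> (heval y e != 0) = P i) ->
  cset (ar (den (BUILD c e) x) c) = [set i | P i].
Proof.
move=> He.
pose Inv m (y : hst n) := [/\ forall k, k != vk -> sc y k = sc x k,
   forall b, b != c -> ar y b = ar x b & forall i : 'I_n, i < m -> (ar y c i != 0) = P i].
have [_ _ H] : Inv n (den (BUILD c e) x).
  apply: for_ind => //.
    by move=> i y v [H1 H2 H3]; split=> //= k /[dup] kk /negPf->; apply: H1.
  move=> i y [H1 H2 H3] Ei; split=> //= [b /[dup] bc /negPf->|j]; first exact: H2.
  rewrite eqxx Ei ltnS leq_eqVlt; case: (j =P i :> nat) => [/val_inj->|_] /=; last exact: H3.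
  by move=> _; apply: He.
by apply/setP=> i; rewrite !inE H.
Qed.

Lemma copy_ok b c x : b != c -> cset (ar (den (COPY b c) x) c) = cset (ar x b).
Proof.
move=> bc; rewrite (@build_ok _ _ _ (mem (cset (ar x b)))); last first.
  by move=> i y Ei _ /(_ b bc) /= ->; rewrite Ei inE.
by apply/setP=> i; rewrite inE.
Qed.

Lemma forall_ok v e x (P : pred 'I_n) : v != vk ->
  (forall (i : 'I_n) y, sc y vk = i -> (forall k, k != vk -> k != v -> sc y k = sc x k) ->
     ar y = ar x -> (heval y e != 0) = P i) ->
  sc (den (FORALL v e) x) v = [forall i, P i].
Proof.
move=> vvk He.
pose Inv m (y : hst n) := [/\ forall k, k != vk -> k != v -> sc y k = sc x k,
   ar y = ar x & sc y v = [forall i : 'I_n, (i < m) ==> P i] :> nat].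
have [_ _ ->] : Inv n (den (FORALL v e) x).
  rewrite /FORALL denS; apply: for_ind => //.
  - split=> //= [k _ /negPf-> //|]; rewrite eqxx.
    by rewrite (_ : [forall _, _] = true) //; apply/forallP.
  - move=> i y w [H1 H2 H3]; split=> //= [k /[dup] kk /negPf->|]; first exact: H1.
    by rewrite (negPf vvk).
  move=> i y [H1 H2 H3] Ei.
  have step : [forall j : 'I_n, (j < i.+1) ==> P j] = [forall j : 'I_n, (j < i) ==> P j] && P i.
    apply/forallP/andP => [H|[/forallP H Pi] j].
      split; last by have := H i; rewrite ltnSn.
      by apply/forallP => j; apply/implyP => ji; have := H j; rewrite ltnS ltnW.
    rewrite ltnS leq_eqVlt; apply/implyP => /predU1P[/val_inj-> //|].
    by apply/implyP.
  rewrite denIf (He i y) //; case: ifP => Pi /=; rewrite ?step ?Pi ?andbT ?andbF.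
    by split; rewrite // step Pi andbT.
  split=> //= [k kk /[dup] kv /negPf->|]; first exact: H1.
  by rewrite eqxx step Pi andbF.
by congr (nat_of_bool _); apply: eq_forallb => i; rewrite ltn_ord.
Qed.

Lemma equal_ok b c x : sc (den (EQUAL b c) x) ve = (cset (ar x b) == cset (ar x c)).
Proof.
rewrite (@forall_ok _ _ _ (fun i => (i \in cset (ar x b)) == (i \in cset (ar x c)))) //.
  congr (nat_of_bool _); apply/forallP/eqP => [H|-> //].
  by apply/setP=> i; apply/eqP.
move=> i y Ei _ E /=; rewrite E Ei !hevalE !inE.
by case: (ar x b i == 0); case: (ar x c i == 0).
Qed.

Lemma card_below I (i : 'I_n) : #|below I i.+1| = (i \in I) + #|below I i|.
Proof.
rewrite belowS; case: ifP => // iI.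
by rewrite cardsU1 !inE ltnn andbF.
Qed.

Lemma card_ok b x : sc (den (CARD b) x) vc = #|cset (ar x b)|.
Proof.
pose Inv m (y : hst n) := ar y b = ar x b /\ sc y vc = #|below (cset (ar x b)) m|.
have [_ ->] : Inv n (den (CARD b) x); last by rewrite below_all.
rewrite /CARD denS; apply: for_ind => //.
  split=> //=; rewrite (_ : below _ 0 = set0) ?cards0 //.
  by apply/setP=> i; rewrite !inE andbF.
move=> i y [H1 H2] Ei; rewrite denIf /= H1 Ei; rewrite /Inv card_below inE.
case: ifP => _ /=; last by rewrite H1 H2.
split=> //; rewrite H2 addnC; congr (_ + _).
suff -> : #|below (cset (ar x b)) i| < n.+1 by [].
by rewrite ltnS -[X in _ <= X]card_ord max_card.
Qed.

Lemma put_set x b v (o : option 'I_n) (t : bool) : sc x v = oval o ->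
  cset (ar (den (HPut b (HVar v) (HBool t)) x) b) =
  if t then oadd o (cset (ar x b)) else odel o (cset (ar x b)).
Proof. by move=> Ev; rewrite /= eqxx Ev cset_put. Qed.

Lemma complete_ok x I G : cset (ar x aW) = I -> cset (ar x aG) = G ->
  cset (ar (den COMPLETE x) aW) = complete M G I.
Proof.
move=> EW EG.
pose R (y : hst n) (X : {set 'I_n}) := cset (ar y aW) = X /\ cset (ar y aG) = G.
suff [] : R (den COMPLETE x) (complete M G I) by [].
apply: for_rel => // i y X [H1 H2] Ei.
rewrite denIf (_ : (heval _ _ != 0) = (i \in G) && (i \notin X)); last first.
  by rewrite /= !hevalE Ei -H1 -H2 !inE negbK.
case: ifP => [/andP[iG iX]|/negbT]; last first.
  rewrite negb_and negbK => iGX; rewrite (_ : (if _ then _ else _) = X) //.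
  case: ifP => // /andP[iG _]; move: iGX; rewrite iG /= => iX.
  by apply/setUidPr; rewrite sub1set.
rewrite iG andTb.
rewrite !denS !denAsk; set y1 := den _ y.
have E1 : cset (ar y1 aW) = i |: X by rewrite (@put_set _ _ _ (Some i)) ?H1.
have G1 : cset (ar y1 aG) = G by [].
have S1 : sc y1 vi = i by [].
move: y1 E1 G1 S1 => y1 E1 G1 S1.
rewrite denIf (_ : (heval _ _ != 0) = cis M (i |: X)); last first.
  by rewrite /= E1 !hevalE.
case: ifP => _; first by split.
split=> //; rewrite (@put_set _ _ _ (Some i)) //= E1 setU1K //.
Qed.

Lemma improve_ok x I G : cset (ar x aW) = I -> cset (ar x aG) = G ->
  cset (ar (den IMPROVE x) aW) = improve M G I /\ cset (ar (den IMPROVE x) aG) = G.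
Proof.
move=> EW EG; rewrite /IMPROVE 2!denS; have [E1 E2 E3] := step_ok M EW EG.
have G1 : cset (ar (den STEP x) aG) = G by frame.
move: (den STEP x) E1 E2 E3 G1 => y E1 E2 E3 G1; split=> //.
by rewrite (@put_set _ _ _ (step M G I).2) // (@put_set _ _ _ (step M G I).1) // E1.
Qed.

Lemma augment_ok x I G : cset (ar x aW) = I -> cset (ar x aG) = G ->
  cset (ar (den AUGMENT x) aW) = augmented M G I.
Proof.
move=> EW EG.
pose R (y : hst n) (X : {set 'I_n}) := cset (ar y aW) = X /\ cset (ar y aG) = G.
have sz : size (opts n) = n.+1 by rewrite size_rcons size_map -cardE card_ord.
have [-> _] : R (den AUGMENT x) (foldl (fun X _ => foldl (fun X _ => improve M G X) X (opts n)) I (opts n)).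
  apply: for_full_rel => // o y X Hy Eo.
  apply: for_full_rel => // o' z Y [H1 H2] Eo'; exact: improve_ok.
rewrite /augmented card_ord iterM foldl_const sz; apply: eq_iter => X.
by rewrite foldl_const sz.
Qed.

Lemma feasible_ok r x X lo : cset (ar x aI) = X -> sc x vlo = lo -> sc x vr = r ->
  sc (den FEASIBLE x) vok = feasible M r (from n lo) X.
Proof.
move=> EI El Er; rewrite /FEASIBLE 2!denS.
set y1 := den (BUILD _ _) _.
have W1 : cset (ar y1 aW) = X by rewrite /y1; frame1; rewrite copy_ok.
have G1 : cset (ar y1 aG) = from n lo.
  rewrite (@build_ok _ _ _ (fun i => lo <= i)) // => i y Ei Ey _.
  rewrite /= !hevalE Ei Ey //; frame; by rewrite El -leqNgt.
have R1 : sc y1 vr = r by rewrite /y1; frame; rewrite ?Er.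
move: y1 W1 G1 R1 => y1 W1 G1 R1.
rewrite 2!denS 2!denAsk denS denSet; set y2 := setv _ _ _.
have W2 : cset (ar y2 aW) = X by [].
have G2 : cset (ar y2 aG) = from n lo by [].
have R2 : sc y2 vr = r by [].
have O2 : sc y2 vok = cis M X by rewrite /y2 /= W1 !hevalE.
move: y2 W2 G2 R2 O2 => y2 W2 G2 R2 O2.
have A2 := augment_ok W2 G2.
rewrite 2!denS denSet.
have C3 : sc (den (CARD aW) (den AUGMENT y2)) vc = #|augmented M (from n lo) X|.
  by rewrite card_ok A2.
have O3 : sc (den (CARD aW) (den AUGMENT y2)) vok = cis M X by frame.
have R3 : sc (den (CARD aW) (den AUGMENT y2)) vr = r by frame.
move: (den (CARD aW) _) C3 O3 R3 => y3 C3 O3 R3.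
by rewrite /= C3 O3 R3 /feasible !hevalE.
Qed.

Lemma fill_ok r x X lo : cset (ar x aI) = X -> sc x vst = lo -> sc x vr = r ->
  cset (ar (den FILL x) aI) = fill M r lo X.
Proof.
move=> EI El Er.
pose R (y : hst n) (X : {set 'I_n}) := [/\ cset (ar y aI) = X, sc y vst = lo & sc y vr = r].
suff [] : R (den FILL x) (fill M r lo X) by [].
apply: for_rel => // i y Z [E1 E2 E3] Ei; rewrite denIf.
have -> : (heval y (HLt (HVar vqf) (HVar vst)) != 0) = (i < lo).
  by rewrite /= !hevalE Ei E2.
rewrite ltnNge; case: ifPn => [/negPf-> //|/negPn li]; rewrite li andTb.
rewrite 2!denS denSet; set y1 := setv _ _ _.
have L1 : sc y1 vlo = i.+1 by rewrite /y1 /= Ei ltnS ltnW // addn1.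
have F := @feasible_ok r y1 Z i.+1 E1 L1 E3.
have HR : R (den FEASIBLE y1) Z by split; frame.
have Eq : sc (den FEASIBLE y1) vqf = i by frame.
move: (den FEASIBLE y1) F HR Eq => y2 F [H1 H2 H3] Eq.
rewrite denIf /= F !hevalE; case: (feasible _ _ _ _) => //=.
by split; rewrite //= Eq (cset_put _ (Some i) true) /= H1.
Qed.

Lemma prefix_ok v x (i : 'I_n) : v != vk -> sc x v = i ->
  cset (ar (den (PREFIX v) x) aI) = i |: below (cset (ar x aK)) i.
Proof.
move=> vn Ev; rewrite (@build_ok _ _ _ (mem (i |: below (cset (ar x aK)) i))).
  by apply/setP=> j; rewrite inE.
move=> j y Ej Es Ea; rewrite /= !hevalE Ej Es // Ev Ea // !inE /=.
have -> : (j == i :> nat) = (j == i) by [].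
by case: (j == i); case: (j < i); case: (ar x aK j == 0).
Qed.

Lemma branch_ok r x B : cset (ar x aK) = B -> sc x vr = r ->
  sc (den BRANCH x) vpos = oval (branch M r B).
Proof.
move=> EK Er.
pose R (y : hst n) (o : option 'I_n) := [/\ cset (ar y aK) = B, sc y vpos = oval o & sc y vr = r].
suff [] : R (den BRANCH x) (branch M r B) by [].
rewrite /BRANCH denS; apply: for_rel => // i y o [E1 E2 E3] Ei; rewrite denIf.
have -> : (heval y (HGet aK (HVar vp)) != 0) = (i \in B).
  by rewrite /= Ei -E1 inE.
case: (boolP (i \in B)) => iB; first by split.
rewrite andTb.
rewrite 2!denS; have P1 := @prefix_ok vp y i isT Ei.
have S1 : sc (den (PREFIX vp) y) vp = i by frame.
have K1 : cset (ar (den (PREFIX vp) y) aK) = B by frame.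
have R1 : sc (den (PREFIX vp) y) vr = r by frame.
have O1 : sc (den (PREFIX vp) y) vpos = oval o by frame.
move: (den (PREFIX vp) y) P1 S1 K1 R1 O1 => y1 P1 S1 K1 R1 O1.
rewrite denS denSet; set y2 := setv _ _ _.
have L2 : sc y2 vlo = i.+1 by rewrite /y2 /= S1 ltnS ltnW // addn1.
have F := @feasible_ok r y2 _ i.+1 P1 L2 R1.
have HR : R (den FEASIBLE y2) o by split; frame.
have Eq : sc (den FEASIBLE y2) vp = i by frame.
move: (den FEASIBLE y2) F HR Eq => y3 F [H1 H2 H3] Eq.
rewrite denIf /= F E1 !hevalE; case: (feasible _ _ _ _) => //=.
Qed.

End Programs.

(** * The node test and the parent *)

Definition vl := 32. Definition vlf := 33. Definition vla := 34. Definition vlb := 35.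
Definition vseen := 36. Definition vfound := 37. Definition vJ := 38. Definition vpj := 39.
Definition vp1 := 40. Definition vp2 := 41. Definition vf1 := 42. Definition vcis := 44.
Definition vsub := 45. Definition vJN := 46.

Definition GROUND v := BUILD aG (OR (HGet aR (HVar vk)) (HLt (HVar vk) (HVar v))).

Definition FIRST2 b c :=
  HSet vp1 HDim ;; HSet vp2 HDim ;;
  HFor vk false
    (HIf (HAnd (HGet b (HVar vk)) (HNot (HGet c (HVar vk))))
       (HIf (HEq (HVar vp1) HDim) (HSet vp1 (HVar vk))
          (HIf (HEq (HVar vp2) HDim) (HSet vp2 (HVar vk)) HSkip))
       HSkip).

(** Input in [vJ] and [aI], which are preserved; result in [vpj] and [aW]. *)
Definition PARENT :=
  HSet vpj (HSub (HVar vJ) HOne) ;;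
  HIf (OR (HNot (HGet aI (HVar vpj))) (HGet aR (HVar vpj))) (COPY aI aW)
    (CARD aI ;;
     HIf (HLt (HVar vtau) (HVar vc))
       (COPY aI aW ;; HPut aW (HVar vpj) HZero ;; GROUND vpj ;; COMPLETE)
       (COPY aI aW ;; GROUND vJ ;; IMPROVE ;; COMPLETE ;; HSet vpj (HVar vJ))).

Definition NODE :=
  COPY aI aW ;; GROUND vJ ;; HAsk vq false aW ;; HAsk vq2 true aW ;;
  HSet vcis (HAnd (HVar vq) (HVar vq2)) ;;
  FORALL vsub (OR (HNot (HGet aI (HVar vk))) (HGet aG (HVar vk))) ;;
  COMPLETE ;; EQUAL aW aI ;; CARD aI ;;
  HSet vcis (HAnd (HAnd (HVar vcis) (HVar vsub)) (HAnd (HVar ve) (HNot (HLt (HVar vc) (HVar vtau))))).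

Section Programs.

Variables (n : nat) (M : bool -> matroid 'I_n).
Implicit Types (x y : hst n) (I G : {set 'I_n}).

Notation den := (den (fun b => indep (M b))).
Notation cset := (cset n).

Lemma sc_setv x k v : sc (setv x k v) k = v.
Proof. by rewrite /= eqxx. Qed.

Lemma heval_var x k : heval x (HVar k) = sc x k.
Proof. by []. Qed.

Lemma ground_ok v x R j : v != vk -> cset (ar x aR) = R -> sc x v = j ->
  cset (ar (den (GROUND v) x) aG) = ground R j.
Proof.
move=> vn ER Ej; rewrite (@build_ok _ _ _ _ _ (mem (ground R j))).
  by apply/setP=> i; rewrite inE.
move=> i y Ei Es Ea; rewrite /= !hevalE Ei Es // Ej Ea // -ER !inE.
by case: (i < j); case: (ar x aR i == 0).
Qed.

Lemma first2_ok b c x (X := cset (ar x b) :\: cset (ar x c)) :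
  sc (den (FIRST2 b c) x) vp1 = oval (first2 X).1 /\
  sc (den (FIRST2 b c) x) vp2 = oval (first2 X).2.
Proof.
rewrite /FIRST2 2!denS 2!denSet den_for; set y0 := setv (setv x _ _) _ _.
suff : forall s, let y := foldl (fun x (i : 'I_n) => den (HIf (HAnd (HGet b (HVar vk)) (HNot (HGet c (HVar vk))))
       (HIf (HEq (HVar vp1) HDim) (HSet vp1 (HVar vk))
          (HIf (HEq (HVar vp2) HDim) (HSet vp2 (HVar vk)) HSkip))
       HSkip) (setv x vk i)) y0 s in
   [/\ ar y = ar x, sc y vp1 = oval (onth [seq i <- s | i \in X] 0) &
       sc y vp2 = oval (onth [seq i <- s | i \in X] 1)].
  have EX : enum X = [seq i <- enum 'I_n | i \in X].
    by rewrite /enum_mem -filter_predI; apply: eq_filter => i; rewrite /= andbT.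
  by move/(_ (enum 'I_n)) => [_ E1 E2]; rewrite /first2 EX.
elim/last_ind=> [|s i [E1 E2 E3]] //; cbv zeta.
rewrite -cats1 foldl_cat [foldl _ _ [:: i]]/=.
move: (foldl _ y0 s) E1 E2 E3 => y E1 E2 E3.
rewrite /= E1 filter_cat /= !inE !hevalE andbC.
case: (ar x b i == 0); case: (ar x c i == 0); rewrite /= ?cats0 //.
move: E2 E3; case: [seq _ <- s | _] => [|p [|q t]] /= E2 E3; rewrite E2 ?E3 ?eqxx ?hevalE //=.
- by rewrite ltn_eqF.
- by rewrite ltn_eqF //= ltn_eqF.
Qed.

Lemma parentS R tau j I (jn : j < n) (i := Ordinal jn) : parent M R tau (j.+1, I) =
  if (i \notin I) || (i \in R) then (j, I)
  else if tau < #|I| then (j, complete M (ground R j) (I :\ i))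
  else (j.+1, complete M (ground R j.+1) (improve M (ground R j.+1) I)).
Proof. by rewrite /parent /= insubT. Qed.

Lemma parent_ok x I R tau J : cset (ar x aI) = I -> cset (ar x aR) = R -> sc x vJ = J ->
  sc x vtau = tau -> 0 < J -> J <= n ->
  (sc (den PARENT x) vpj, cset (ar (den PARENT x) aW)) = parent M R tau (J, I).
Proof.
move=> EI ER EJ Et J0 Jn; rewrite /PARENT denS denSet.
case: J J0 Jn EJ => [//|j] _ jn EJ; rewrite parentS; set i := Ordinal jn.
set y := setv _ _ _.
have Ep : sc y vpj = i by rewrite /y /= EJ subn1.
have yI : cset (ar y aI) = I by []. have yR : cset (ar y aR) = R by [].
have yJ : sc y vJ = j.+1 by []. have yt : sc y vtau = tau by [].
move: y Ep yI yR yJ yt => y Ep yI yR yJ yt.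
rewrite denIf (_ : (heval _ _ != 0) = (i \notin I) || (i \in R)); last first.
  by rewrite /= !hevalE Ep -yI -yR !inE; case: (ar y aI j == 0); case: (ar y aR j == 0).
case: ifP => _.
  congr pair; last by rewrite copy_ok.
  by frame; rewrite Ep.
rewrite denS; have Ec := card_ok M aI y.
have zI : cset (ar (den (CARD aI) y) aI) = I by frame.
have zR : cset (ar (den (CARD aI) y) aR) = R by frame.
have zJ : sc (den (CARD aI) y) vJ = j.+1 by frame.
have zt : sc (den (CARD aI) y) vtau = tau by frame.
have zp : sc (den (CARD aI) y) vpj = i by frame.
move: (den (CARD aI) y) Ec zI zR zJ zt zp => z Ec zI zR zJ zt zp.
rewrite denIf (_ : (heval _ _ != 0) = (tau < #|I|)); last first.
  by rewrite /= Ec zt yI hevalE negbK.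
case: ifP => _.
  rewrite 3!denS; congr pair; first by frame; rewrite zp.
  apply: complete_ok.
    frame1; rewrite (@put_set _ _ _ _ _ (Some i)) ?copy_ok // ?zI //.
    by frame.
  by apply: ground_ok => //; frame.
rewrite 4!denS denSet; congr pair.
  by rewrite sc_setv heval_var; frame; rewrite zJ.
set w := den (GROUND vJ) _.
have [||Wi Gi] := @improve_ok n M w I (ground R j.+1).
- by rewrite /w; frame1; rewrite copy_ok.
- by apply: ground_ok => //; frame.
exact: complete_ok.
Qed.

Lemma node_ok x I R tau J : cset (ar x aI) = I -> cset (ar x aR) = R -> sc x vJ = J ->
  sc x vtau = tau ->
  sc (den NODE x) vcis = maximal_in M (ground R J) I && (tau <= #|I|).
Proof.
move=> EI ER EJ Et; rewrite /NODE 2!denS.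
set y := den (GROUND vJ) _.
have yW : cset (ar y aW) = I by rewrite /y; frame1; rewrite copy_ok.
have yG : cset (ar y aG) = ground R J by apply: ground_ok => //; frame.
have yI : cset (ar y aI) = I by rewrite /y; frame.
have yt : sc y vtau = tau by rewrite /y; frame.
move: y yW yG yI yt => y yW yG yI yt.
rewrite 3!denS 2!denAsk denSet; set z := setv _ _ _.
have zc : sc z vcis = cis M I by rewrite /z /= yW !hevalE.
have zW : cset (ar z aW) = I by []. have zG : cset (ar z aG) = ground R J by [].
have zI : cset (ar z aI) = I by []. have zt : sc z vtau = tau by [].
move: z zc zW zG zI zt => z zc zW zG zI zt.
rewrite 4!denS denSet.
have F : sc (den (FORALL vsub (OR (HNot (HGet aI (HVar vk))) (HGet aG (HVar vk)))) z) vsub = (I \subset ground R J).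
  rewrite (@forall_ok _ _ _ _ _ (fun i => (i \in I) ==> (i \in ground R J))) //.
    congr (nat_of_bool _); apply/forallP/subsetP => H i; last by apply/implyP/H.
    exact/implyP/H.
  move=> i u Eu _ Ea; rewrite /= Ea Eu -zI -zG !hevalE !inE.
  by case: (ar z aI i == 0); case: (ar z aG i == 0).
set w1 := den (FORALL _ _) z in F *.
have C1 : cset (ar (den COMPLETE w1) aW) = complete M (ground R J) I.
  by apply: complete_ok; rewrite /w1; frame.
have I1 : cset (ar (den COMPLETE w1) aI) = I by rewrite /w1; frame.
have F1 : sc (den COMPLETE w1) vsub = (I \subset ground R J) by frame1.
have c1 : sc (den COMPLETE w1) vcis = cis M I by rewrite /w1; frame.
have t1 : sc (den COMPLETE w1) vtau = tau by rewrite /w1; frame.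
move: (den COMPLETE w1) C1 I1 F1 c1 t1 => w2 C1 I1 F1 c1 t1.
have E3 : sc (den (CARD aI) (den (EQUAL aW aI) w2)) ve = (complete M (ground R J) I == I).
  by frame1; rewrite equal_ok C1 I1.
have N3 : sc (den (CARD aI) (den (EQUAL aW aI) w2)) vc = #|I|.
  by rewrite card_ok; frame1; rewrite I1.
have c3 : sc (den (CARD aI) (den (EQUAL aW aI) w2)) vcis = cis M I by frame.
have s3 : sc (den (CARD aI) (den (EQUAL aW aI) w2)) vsub = (I \subset ground R J) by frame.
have t3 : sc (den (CARD aI) (den (EQUAL aW aI) w2)) vtau = tau by frame.
move: (den (CARD aI) _) E3 N3 c3 s3 t3 => w3 E3 N3 c3 s3 t3.
rewrite /= E3 N3 c3 s3 t3 !hevalE -leqNgt /maximal_in.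
by rewrite -!andbA.
Qed.

End Programs.

(** * Scanning the moves for the next child *)

Definition MATCH :=
  FIRST2 aI aK ;; HSet vf1 (HVar vp1) ;; FIRST2 aK aI ;;
  HSet vok (HAnd (HAnd (HEq (HEq (HVar vJ) (HVar vj)) (HVar vl)) (HEq (HVar vf1) (HVar vlf)))
                 (HAnd (HEq (HVar vp1) (HVar vla)) (HEq (HVar vp2) (HVar vlb)))).

Definition VALID :=
  NODE ;; HIf (HVar vcis)
    (PARENT ;; EQUAL aW aK ;; HIf (HAnd (HVar ve) (HEq (HVar vpj) (HVar vj))) MATCH HSkip)
    HSkip.

Definition CANDIDATE :=
  COPY aK aI ;; HPut aI (HVar vla) HZero ;; HPut aI (HVar vlb) HZero ;; HPut aI (HVar vlf) HOne ;;
  HIf (HVar vl) (HSet vJ (HVar vj)) (HSet vJ (HInc (HVar vj))).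

Definition CHECK :=
  CANDIDATE ;; HSet vok HZero ;;
  HIf (HAnd (HLt HZero (HVar vJ)) (HNot (HLt HDim (HVar vJ)))) VALID HSkip.

Definition TRYMOVE :=
  CHECK ;; HIf (HVar vok) (HSet vfound HOne ;; COPY aI aN ;; HSet vJN (HVar vJ)) HSkip.

Definition SEEKMOVE :=
  HIf (HAnd (HAnd (HEq (HVar vl) (HVar vml)) (HEq (HVar vlf) (HVar vmf)))
            (HAnd (HEq (HVar vla) (HVar vma)) (HEq (HVar vlb) (HVar vmb))))
    (HSet vseen HOne) HSkip.

(* Moves are passed over until the last one tried has been met ([vseen]) and
   after a child has been found ([vfound]). *)
Definition SCANMOVE := HIf (HVar vfound) HSkip (HIf (HVar vseen) TRYMOVE SEEKMOVE).

Definition TRIPLES := HFor vlf true (HFor vla true (HFor vlb true SCANMOVE)).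

Definition SCANALL :=
  HSet vseen (HVar vfresh) ;; HSet vfound HZero ;;
  HSet vl HZero ;; TRIPLES ;; HSet vl HOne ;; TRIPLES.

Lemma nat_of_bool_eq (a b : bool) : (a == b :> nat) = (a == b).
Proof. by case: a; case: b. Qed.

Lemma foldl_allpairs A B C S (f : S -> C -> S) (h : A -> B -> C) s t z :
  foldl f z [seq h a b | a <- s, b <- t] =
  foldl (fun z a => foldl (fun z b => f z (h a b)) z t) z s.
Proof. by elim: s z => //= a s IH z; rewrite foldl_cat foldl_map IH. Qed.

Section Programs.

Variables (n : nat) (M : bool -> matroid 'I_n) (R : {set 'I_n}) (tau : nat).
Implicit Types (x y : hst n) (I G : {set 'I_n}).

Notation den := (den (fun b => indep (M b))).
Notation cset := (cset n).

Variables (j : nat) (K : {set 'I_n}) (pos : option (move n)).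

Definition env0 pos x :=
  [/\ cset (ar x aK) = K, cset (ar x aR) = R, sc x vj = j, sc x vtau = tau &
   forall m : move n, pos = Some m -> [/\ sc x vml = m.1, sc x vmf = oval m.2.1,
      sc x vma = oval m.2.2.1 & sc x vmb = oval m.2.2.2]].

Notation env := (env0 pos).

Definition envfree h :=
  all (fun k => k \notin modv h) [:: vj; vtau; vml; vmf; vma; vmb] &&
  all (fun b => b \notin moda h) [:: aK; aR].

Lemma env_den h x : envfree h -> env x -> env (den h x).
Proof.
move=> /andP[/= /and5P[v1 v2 v3 v4 /and3P[v5 v6 _]] /and3P[b1 b2 _]] [E1 E2 E3 E4 E5].
split; rewrite ?modvP ?modaP // => m Em; rewrite !modvP //.
Qed.

Definition at_move x (m : move n) :=
  [/\ sc x vl = m.1, sc x vlf = oval m.2.1, sc x vla = oval m.2.2.1 & sc x vlb = oval m.2.2.2].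

Definition at_node x (u : nat * {set 'I_n}) := cset (ar x aI) = u.2 /\ sc x vJ = u.1.

Lemma candidate_ok x m : j <= n -> env x -> at_move x m ->
  at_node (den CANDIDATE x) (apply_move (j, K) m).
Proof.
move=> jn [EK ER Ej Et _] [E1 E2 E3 E4]; rewrite /CANDIDATE denS.
have C1 : cset (ar (den (COPY aK aI) x) aI) = K by rewrite copy_ok.
have F k : k != vk -> sc (den (COPY aK aI) x) k = sc x k.
  by move=> kk; rewrite modvP // inE.
move: (den (COPY aK aI) x) C1 F => y C1 F.
rewrite 3!denS; set z := den (HPut aI (HVar vlf) HOne) _.
have Z1 : cset (ar z aI) = (apply_move (j, K) m).2.
  rewrite (@put_set _ _ _ _ _ m.2.1) -?E2 -?F //.
  rewrite (@put_set _ _ _ _ _ m.2.2.2) -?E4 -?F //.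
  by rewrite (@put_set _ _ _ _ _ m.2.2.1) -?E3 -?F // C1.
have Z2 : sc z = sc y by [].
move: z Z1 Z2 => z Z1 Z2; rewrite denIf.
have -> : (heval z (HVar vl) != 0) = m.1 by rewrite heval_var Z2 F // E1 eqb0 negbK.
split; first by case: ifP.
rewrite /apply_move /=; case: (m.1); rewrite /= Z2 F // Ej ?addn0 //.
by rewrite ltnS jn.
Qed.

Lemma match_ok x m I J : env x -> at_move x m -> at_node x (J, I) ->
  sc (den MATCH x) vok = (move_to (j, K) (J, I) == m).
Proof.
move=> [EK ER Ej Et _] [E1 E2 E3 E4] [EI EJ]; rewrite /MATCH denS.
have [A1 _] := @first2_ok n M aI aK x; rewrite EI EK in A1.
have FI : cset (ar (den (FIRST2 aI aK) x) aI) = I by frame.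
have FK : cset (ar (den (FIRST2 aI aK) x) aK) = K by frame.
have F k : k \notin modv (FIRST2 aI aK) -> sc (den (FIRST2 aI aK) x) k = sc x k by apply: modvP.
move: (den (FIRST2 aI aK) x) A1 FI FK F => y A1 FI FK F.
rewrite denS denSet heval_var A1; set z := setv _ _ _.
have Z1 : cset (ar z aI) = I by []. have Z2 : cset (ar z aK) = K by [].
have Z3 : sc z vf1 = oval (first2 (I :\: K)).1 by [].
have G k : k \notin vf1 :: modv (FIRST2 aI aK) -> sc z k = sc x k.
  by rewrite inE negb_or => /andP[/negPf kv /F <-]; rewrite /= kv.
move: z Z1 Z2 Z3 G => z Z1 Z2 Z3 G.
rewrite denS denSet sc_setv.
have [B1 B2] := @first2_ok n M aK aI z; rewrite Z1 Z2 in B1 B2.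
have W3 : sc (den (FIRST2 aK aI) z) vf1 = oval (first2 (I :\: K)).1 by frame.
have W k : k \notin vf1 :: modv (FIRST2 aI aK) -> sc (den (FIRST2 aK aI) z) k = sc x k.
  by move=> kn; rewrite modvP ?G //; move: kn; rewrite inE negb_or => /andP[].
move: (den (FIRST2 aK aI) z) B1 B2 W3 W => w B1 B2 W3 W.
rewrite /= !hevalE B1 B2 W3 !W ?(EJ, Ej, E1, E2, E3, E4) //.
rewrite !(inj_eq (@oval_inj n)) nat_of_bool_eq /move_to /=.
case: m {E1 E2 E3 E4} => l [f [a b]] /=.
by rewrite !xpair_eqE /= -!andbA.
Qed.

Hypothesis R_cis : cis M R.

Notation chd := (child (0, R) (node M R tau) (parent M R tau) (@move_to n) (@apply_move n) (j, K)).

Lemma valid_ok x m : env x -> at_move x m -> at_node x (apply_move (j, K) m) ->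
  0 < (apply_move (j, K) m).1 <= n -> sc x vok = 0 ->
  sc (den VALID x) vok = chd m /\ at_node (den VALID x) (apply_move (j, K) m).
Proof.
move=> Hx Hm Hu /andP[J0 Jn] O0; split; last first.
  by case: Hu => H1 H2; split; frame.
rewrite /child; cbv zeta; move: (apply_move (j, K) m) Hu J0 Jn => [J I] Hu J0 Jn.
rewrite [(J, I).1]/= in J0 Jn.
have node_root' : node M R tau (J, I) && ((J, I) != (0, R)) = node M R tau (J, I).
  by case nu: (node _ _ _ _); rewrite //= (node_root_eq R_cis nu) -lt0n.
rewrite andbA node_root'; case: (Hx) => EK ER Ej Et _; case: (Hu) => EI EJ.
rewrite /VALID denS; have N1 := @node_ok n M x I R tau J EI ER EJ Et.
have H1 : env (den NODE x) by apply: env_den.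
have M1 : at_move (den NODE x) m by case: Hm => *; split; frame.
have U1 : at_node (den NODE x) (J, I) by split; frame.
have O1 : sc (den NODE x) vok = 0 by frame.
move: (den NODE x) N1 H1 M1 U1 O1 => y N1 H1 M1 U1 O1.
have -> : node M R tau (J, I) = maximal_in M (ground R J) I && (tau <= #|I|).
  by rewrite /node /= Jn.
rewrite denIf heval_var N1 eqb0 negbK; case: ifP => _; last by rewrite O1.
case: (H1) => yK yR yj yt _; case: (U1) => yI yJ.
rewrite denS; have P1 := @parent_ok n M y I R tau J yI yR yJ yt J0 Jn.
have H2 : env (den PARENT y) by apply: env_den.
have M2 : at_move (den PARENT y) m by case: M1 => *; split; frame.
have U2 : at_node (den PARENT y) (J, I) by split; frame.
have O2 : sc (den PARENT y) vok = 0 by frame.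
move: (den PARENT y) P1 H2 M2 U2 O2 => z P1 H2 M2 U2 O2.
rewrite denS; have E3 := @equal_ok n M aW aK z.
have H3 : env (den (EQUAL aW aK) z) by apply: env_den.
have M3 : at_move (den (EQUAL aW aK) z) m by case: M2 => *; split; frame.
have U3 : at_node (den (EQUAL aW aK) z) (J, I) by case: U2 => *; split; frame.
have O3 : sc (den (EQUAL aW aK) z) vok = 0 by frame.
have P3 : sc (den (EQUAL aW aK) z) vpj = sc z vpj by frame.
move: (den (EQUAL aW aK) z) E3 H3 M3 U3 O3 P3 => w E3 H3 M3 U3 O3 P3.
case: (H2) => zK _ _ _ _; case: (H3) => _ _ wj _ _.
rewrite denIf (_ : (heval _ _ != 0) = (parent M R tau (J, I) == (j, K))); last first.
  by rewrite /= E3 P3 wj zK -P1 !hevalE xpair_eqE andbC.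
case: ifP => _; last by rewrite O3.
by rewrite (match_ok H3 M3 U3).
Qed.

Lemma check_ok x m : j <= n -> env x -> at_move x m ->
  sc (den CHECK x) vok = chd m /\ at_node (den CHECK x) (apply_move (j, K) m).
Proof.
move=> jn Hx Hm; rewrite /CHECK 2!denS.
have U1 := candidate_ok jn Hx Hm.
have H1 : env (den CANDIDATE x) by apply: env_den.
have M1 : at_move (den CANDIDATE x) m by case: Hm => *; split; frame.
move: (den CANDIDATE x) U1 H1 M1 => y U1 H1 M1.
rewrite denSet; set z := setv _ _ _.
have U2 : at_node z (apply_move (j, K) m) by [].
have H2 : env z by []. have M2 : at_move z m by []. have O2 : sc z vok = 0 by [].
move: z U2 H2 M2 O2 => z U2 H2 M2 O2.
rewrite denIf (_ : (heval _ _ != 0) = (0 < (apply_move (j, K) m).1 <= n)); last first.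
  by case: U2 => _ EJ; rewrite /= EJ !hevalE -leqNgt.
case: ifP => [Jn|/negbT nJ]; first exact: valid_ok.
(* A child is a node other than the root, hence of level between 1 and [n]; the guard rejects no
   child. *)
split=> //; rewrite O2; apply/esym/eqP; rewrite eqb0; apply: contra nJ.
rewrite /child /= => /and4P[nu ur _ _]; rewrite (node_root_eq R_cis nu) -lt0n in ur.
by rewrite ur; case/and3P: nu.
Qed.

Definition scan_move (st : bool * option (move n)) m :=
  if st.2 is Some _ then st
  else if st.1 then (true, if chd m then Some m else None)
  else (Some m == pos, None).

Definition scan_rel x (st : bool * option (move n)) :=
  [/\ env x, sc x vseen = st.1, sc x vfound = isSome st.2 &
   forall m, st.2 = Some m -> cset (ar x aN) = (apply_move (j, K) m).2 /\
      sc x vJN = (apply_move (j, K) m).1].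

(** The condition on [pos] says that a fresh node starts in the seen state, so the stored move is
    compared only when there is one. *)
Lemma scan_move_ok x (st : bool * option (move n)) m : j <= n -> (pos == None -> st.1) -> scan_rel x st -> at_move x m ->
  scan_rel (den SCANMOVE x) (scan_move st m) /\ at_move (den SCANMOVE x) m.
Proof.
move=> jn Hpos [Hx Es Ef En] Hm; split; last by case: Hm => *; split; frame.
rewrite /SCANMOVE denIf heval_var Ef eqb0 negbK.
case: st Hpos Es Ef En => [seen [m'|]] Hpos Es Ef En.
  have H : scan_rel x (seen, Some m') by split.
  exact: H.
change (scan_rel (den (HIf (HVar vseen) TRYMOVE SEEKMOVE) x) (scan_move (seen, None) m)).
rewrite denIf heval_var Es eqb0 negbK.
rewrite [(_, _).1]/= in Hpos Es *; case: seen Hpos Es Ef En => Hpos Es Ef En.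
  change (scan_rel (den TRYMOVE x) (true, if chd m then Some m else None)).
  rewrite /TRYMOVE.
  rewrite denS; have [O1 U1] := check_ok jn Hx Hm.
  have H1 : env (den CHECK x) by apply: env_den.
  have S1 : sc (den CHECK x) vseen = true by frame.
  have F1 : sc (den CHECK x) vfound = false by frame.
  move: (den CHECK x) O1 U1 H1 S1 F1 => y O1 [UI UJ] H1 S1 F1.
  rewrite denIf heval_var O1 eqb0 negbK; case: ifP => _; last by split.
  rewrite 2!denS 2!denSet; set z := setv y _ _.
  split; last 1 first.
  - move=> _ [<-]; split; last by rewrite sc_setv heval_var; frame.
    by rewrite [ar (setv _ _ _)]/= copy_ok.
  - have : env (den (COPY aI aN) z) by apply: env_den.
    by case.
  - change (sc (den (COPY aI aN) z) vseen = true); frame; exact: S1.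
  - change (sc (den (COPY aI aN) z) vfound = true); frame; by [].
change (scan_rel (den SEEKMOVE x) (Some m == pos, None)).
rewrite /SEEKMOVE.
case Ep: pos Hpos => [p|] Hpos; last by have := Hpos isT.
case: (Hx) => EK ER Ej Et E5; have [p1 p2 p3 p4] := E5 p Ep; case: Hm => m1 m2 m3 m4.
rewrite denIf (_ : (heval _ _ != 0) = (Some m == Some p)); last first.
  rewrite /= !hevalE p1 p2 p3 p4 m1 m2 m3 m4 !(inj_eq (@oval_inj n)) nat_of_bool_eq.
  clear; rewrite [RHS](inj_eq (@Some_inj _)); case: m p => l [f [a b]] [l' [f' [a' b']]].
  by rewrite !xpair_eqE /= -!andbA.
have Hy y : ar y = ar x -> (forall k, k != vseen -> sc y k = sc x k) -> env y.
  by move=> Ea Esc; split; rewrite ?Ea ?Esc // => q Eq; rewrite !Esc //; apply: E5.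
case: ifP => _; split => //.
Qed.

Lemma scan_move_seen (st : bool * option (move n)) m : (pos == None -> st.1) -> (pos == None -> (scan_move st m).1).
Proof. by case: st => [[|] [m'|]] H //= /H. Qed.

Definition scan_rel_at (l : bool) x (st : bool * option (move n)) := [/\ scan_rel x st, pos == None -> st.1 & sc x vl = l :> nat].

Lemma triples_ok l x st : j <= n -> scan_rel_at l x st ->
  scan_rel_at l (den TRIPLES x) (foldl (fun z t => scan_move z (l, t)) st (triples n)).
Proof.
move=> jn H0; rewrite /triples foldl_allpairs.
pose R1 (f : option 'I_n) y st := scan_rel_at l y st /\ sc y vlf = oval f.
pose R2 (f a : option 'I_n) y st := R1 f y st /\ sc y vla = oval a.
apply: for_full_rel => // f y st1 Hy Ef; rewrite foldl_allpairs.
suff [] : R1 f (den (HFor vla true (HFor vlb true SCANMOVE)) y)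
  (foldl (fun z a => foldl (fun z b => scan_move z (l, (f, (a, b)))) z (opts n)) st1 (opts n)) by [].
apply: for_full_rel => // a z st2 [Hz Ez] Ea.
suff [] : R2 f a (den (HFor vlb true SCANMOVE) z)
  (foldl (fun z b => scan_move z (l, (f, (a, b)))) st2 (opts n)) by [].
apply: for_full_rel => // b w st3 [[[Hw Hp El] Ef'] Ea'] Eb.
have Hm : at_move w (l, (f, (a, b))) by split.
have [H1 [H2 H3 H4 H5]] := scan_move_ok jn Hp Hw Hm.
by split=> //; split=> //; split=> //; apply: scan_move_seen.
Qed.

Lemma scanall_ok x : j <= n -> env x -> sc x vfresh = (pos == None) ->
  scan_rel (den SCANALL x) (foldl scan_move (pos == None, None) (moves n)).
Proof.
move=> jn Hx Efr; rewrite /SCANALL 5!denS 4!denSet heval_var Efr.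
set y := setv (setv (setv x _ _) _ _) vl _.
have Hy : scan_rel_at false y (pos == None, None) by split=> //; split=> //.
have H1 := triples_ok jn Hy.
have H2 : scan_rel_at true (setv (den TRIPLES y) vl true)
    (foldl (fun z t => scan_move z (false, t)) (pos == None, None) (triples n)).
  by move: H1; move: (den TRIPLES y) => z [Hz Hp _].
have [H3 _ _] := triples_ok jn H2.
by rewrite /moves foldl_allpairs.
Qed.

(** The two flags imitate [drop] followed by [filter]: nothing is tested up to and including the
    last move tried, and nothing after the first child. *)
Lemma scan_found : (foldl scan_move (pos == None, None) (moves n)).2 =
  ohead [seq m <- rest (moves n) pos | chd m].
Proof.
have found b m s : (foldl scan_move (b, Some m) s).2 = Some m by elim: s.
have seen s : (foldl scan_move (true, None) s).2 = ohead [seq m <- s | chd m].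
  elim: s => //= m s IH; rewrite {2}/scan_move /=; case: ifP => _ //=.
case Ep: pos => [p|]; last exact: seen.
rewrite /rest; have : p \in moves n by apply: mem_moves.
rewrite (_ : (Some p == None) = false) //.
elim: (moves n) => //= m s IH; rewrite inE {2}/scan_move /= Ep [Some m == Some p](inj_eq (@Some_inj _)).
case: (m =P p) => [->|mp]; first by rewrite eqxx drop0 seen.
by rewrite eq_sym; case: eqP => // _ /IH.
Qed.

End Programs.

(** * One round of the main loop *)

Definition DESCEND v :=
  HIf (HVar v)
    (HSet vphase HOne ;; HSet vtau (HSub (HVar v) HOne) ;; COPY aR aK ;;
     HSet vj HZero ;; HSet vfresh HOne)
    (HSet vgo HZero).

Definition FLASH :=
  BRANCH ;;
  HIf (HLt (HVar vpos) HDim)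
    (PREFIX vpos ;; HSet vst (HInc (HVar vpos)) ;; FILL ;; COPY aI aK ;; HOut aK)
    (DESCEND vr).

Definition FOUND :=
  COPY aN aK ;; HSet vj (HVar vJN) ;; HSet vfresh HOne ;;
  HIf (HEq (HVar vj) HDim)
    (CARD aK ;; HIf (HEq (HVar vc) (HVar vtau)) (HOut aK) HSkip)
    HSkip.

(** The move from the parent is read off from the differences of the two sets and stored as the last
    one tried, so the parent's scan resumes right after the finished child. *)
Definition POP :=
  COPY aK aI ;; HSet vJ (HVar vj) ;; PARENT ;; FIRST2 aI aW ;; HSet vmf (HVar vp1) ;;
  FIRST2 aW aI ;; HSet vma (HVar vp1) ;; HSet vmb (HVar vp2) ;;
  HSet vml (HEq (HVar vJ) (HVar vpj)) ;; COPY aW aK ;; HSet vj (HVar vpj) ;; HSet vfresh HZero.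

Definition SEARCH :=
  SCANALL ;; HIf (HVar vfound) FOUND (HIf (HVar vj) POP (DESCEND vtau)).

Definition BODY := HIf (HVar vphase) SEARCH FLASH.

Definition INIT :=
  BUILD aG HOne ;; BUILD aW HZero ;; AUGMENT ;; COPY aW aR ;; CARD aR ;; HSet vr (HVar vc) ;;
  BUILD aI HZero ;; HSet vst HZero ;; FILL ;; COPY aI aK ;; HOut aK ;; HSet vgo HOne.

Lemma init_wf : cwf INIT. Proof. by vm_compute. Qed.
Lemma body_wf : cwf BODY. Proof. by vm_compute. Qed.
Lemma init_deg : deg INIT = 5. Proof. by vm_compute. Qed.
(** The lexicographic phase puts [AUGMENT], four nested loops, inside one loop; the search puts the
    breadth-first search, two nested loops, inside the three loops over candidates. *)
Lemma body_deg : deg BODY = 5. Proof. by vm_compute. Qed.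

Ltac quiet := rewrite silentP; last by vm_compute.

Section Programs.

Variables (n : nat) (M : bool -> matroid 'I_n).
Implicit Types (x y : hst n) (I G : {set 'I_n}).

Notation den := (den (fun b => indep (M b))).
Notation cset := (cset n).
Notation R := (top M).

Definition rep x (c : config n * seq {set 'I_n}) :=
  [/\ cset (ar x aR) = R, sc x vr = #|R|, out x = c.2 &
  match c.1 with
  | Flash B => [/\ sc x vgo = 1, sc x vphase = 0 & cset (ar x aK) = B]
  | Search tau v pos => [/\ sc x vgo = 1, sc x vphase = 1,
       env0 R tau v.1 v.2 pos x & sc x vfresh = (pos == None)]
  | Halt => sc x vgo = 0
  end].

Lemma den_out b x : den (HOut b) x = HSt (sc x) (ar x) (rcons (out x) (cset (ar x b))).
Proof. by []. Qed.

Lemma descend_ok v s x : cset (ar x aR) = R -> sc x vr = #|R| -> sc x vgo = 1 -> sc x v = s ->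
  v != vphase -> rep (den (DESCEND v) x) (descend M s, out x).
Proof.
move=> ER Er Eg Es vp; rewrite /DESCEND denIf heval_var Es.
case: s Es => [|s] Es; first by split.
change (rep (den (HSet vphase HOne ;; HSet vtau (HSub (HVar v) HOne) ;; COPY aR aK ;;
     HSet vj HZero ;; HSet vfresh HOne) x) (Search s (0, R) None, out x)).
rewrite 4!denS 4!denSet; set y := setv (setv x _ _) _ _.
have yt : sc y vtau = s by rewrite /y /= (negPf vp) Es subn1.
have yR : cset (ar y aR) = R by []. have yr : sc y vr = #|R| by [].
have yg : sc y vgo = 1 by []. have yo : out y = out x by [].
have yp : sc y vphase = 1 by [].
move: y yt yR yr yg yo yp => y yt yR yr yg yo yp.
have zK : cset (ar (den (COPY aR aK) y) aK) = R by rewrite copy_ok.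
have zt : sc (den (COPY aR aK) y) vtau = s by frame.
have zR : cset (ar (den (COPY aR aK) y) aR) = R by frame.
have zr : sc (den (COPY aR aK) y) vr = #|R| by frame.
have zg : sc (den (COPY aR aK) y) vgo = 1 by frame.
have zp : sc (den (COPY aR aK) y) vphase = 1 by frame.
have zo : out (den (COPY aR aK) y) = out x by quiet.
by move: (den (COPY aR aK) y) zK zt zR zr zg zp zo => z zK zt zR zr zg zp zo.
Qed.

Lemma emit_ok x X : cset (ar x aR) = R -> sc x vr = #|R| -> sc x vgo = 1 -> sc x vphase = 0 ->
  cset (ar x aI) = X -> rep (den (COPY aI aK ;; HOut aK) x) (Flash X, rcons (out x) X).
Proof.
move=> ER Er Eg Ep EI; rewrite denS den_out.
have zK : cset (ar (den (COPY aI aK) x) aK) = X by rewrite copy_ok.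
have zR : cset (ar (den (COPY aI aK) x) aR) = R by frame.
have zr : sc (den (COPY aI aK) x) vr = #|R| by frame.
have zg : sc (den (COPY aI aK) x) vgo = 1 by frame.
have zp : sc (den (COPY aI aK) x) vphase = 0 by frame.
have zo : out (den (COPY aI aK) x) = out x by quiet.
move: (den (COPY aI aK) x) zK zR zr zg zp zo => z zK zR zr zg zp zo.
by split=> //=; rewrite zo zK.
Qed.

Lemma flash_ok B outs x : rep x (Flash B, outs) -> rep (den FLASH x) (cstep M (Flash B, outs)).
Proof.
case=> ER Er Eo [Eg Ep EK]; rewrite /FLASH denS /cstep /next_max.
rewrite [(_, _).1]/= [(_, _).2]/=; rewrite [(_, _).2]/= in Eo.
have B1 := branch_ok M EK Er.
have yR : cset (ar (den BRANCH x) aR) = R by frame.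
have yr : sc (den BRANCH x) vr = #|R| by frame.
have yK : cset (ar (den BRANCH x) aK) = B by frame.
have yg : sc (den BRANCH x) vgo = 1 by frame.
have yp : sc (den BRANCH x) vphase = 0 by frame.
have yo : out (den BRANCH x) = outs by quiet.
move: (den BRANCH x) B1 yR yr yK yg yp yo => y B1 yR yr yK yg yp yo.
rewrite denIf (_ : (heval _ _ != 0) = isSome (branch M #|R| B)); last first.
  by rewrite /= B1 eqb0 negbK; case: (branch _ _ _) => [i|] /=; rewrite ?ltnn ?ltn_ord.
case: (branch M #|R| B) B1 => [i|] B1; last first.
  by rewrite -yo; apply: descend_ok.
change (rep (den (PREFIX vpos ;; HSet vst (HInc (HVar vpos)) ;; FILL ;; COPY aI aK ;; HOut aK) y)
  (Flash (fill M #|R| i.+1 (i |: below B i)), rcons outs (fill M #|R| i.+1 (i |: below B i)))).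
rewrite 3!denS denSet; set z := setv _ vst _.
have zI : cset (ar z aI) = i |: below B i.
  change (cset (ar (den (PREFIX vpos) y) aI) = i |: below B i).
  by rewrite (@prefix_ok n M vpos y i) // yK.
have zs : sc z vst = i.+1.
  rewrite /z sc_setv; have E : sc (den (PREFIX vpos) y) vpos = i by frame.
  move: (den (PREFIX vpos) y) E => w E; rewrite /= E ltnS ltnW // addn1 //.
have zr : sc z vr = #|R| by change (sc (den (PREFIX vpos) y) vr = #|R|); frame.
have zR : cset (ar z aR) = R by change (cset (ar (den (PREFIX vpos) y) aR) = R); frame.
have zg : sc z vgo = 1 by change (sc (den (PREFIX vpos) y) vgo = 1); frame.
have zp : sc z vphase = 0 by change (sc (den (PREFIX vpos) y) vphase = 0); frame.
have zo : out z = outs by change (out (den (PREFIX vpos) y) = outs); quiet.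
move: z zI zs zr zR zg zp zo => z zI zs zr zR zg zp zo.
have F := fill_ok M zI zs zr.
have Fo : out (den FILL z) = outs by quiet.
rewrite -[in rcons outs]Fo; apply: emit_ok => //; by frame.
Qed.

Lemma init_ok x : sc x vphase = 0 -> out x = [::] -> rep (den INIT x) (cinit M).
Proof.
move=> Ep Eo; rewrite /INIT 5!denS.
set x1 := den (BUILD aW HZero) _.
have W1 : cset (ar x1 aW) = set0.
  rewrite (@build_ok _ _ _ _ _ pred0) //; by apply/setP=> i; rewrite !inE.
have G1 : cset (ar x1 aG) = setT.
  by rewrite /x1; frame1; rewrite (@build_ok _ _ _ _ _ predT) //; apply/setP=> i; rewrite !inE.
have p1 : sc x1 vphase = 0 by rewrite /x1; frame.
have o1 : out x1 = [::] by rewrite /x1; do 2 quiet.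
move: x1 W1 G1 p1 o1 => x1 W1 G1 p1 o1.
have A2 := augment_ok M W1 G1.
set x2 := den (CARD aR) _.
have R2 : cset (ar x2 aR) = R by rewrite /x2; frame1; rewrite copy_ok // A2.
have c2 : sc x2 vc = #|R| by rewrite /x2 card_ok copy_ok // A2.
have p2 : sc x2 vphase = 0 by rewrite /x2; frame.
have o2 : out x2 = [::] by rewrite /x2; do 3 quiet.
move: x2 R2 c2 p2 o2 => x2 R2 c2 p2 o2.
rewrite 3!denS 2!denSet heval_var c2; set x3 := setv _ vst _.
have I3 : cset (ar x3 aI) = set0.
  change (cset (ar (den (BUILD aI HZero) (setv x2 vr #|R|)) aI) = set0).
  rewrite (@build_ok _ _ _ _ _ pred0) //; by apply/setP=> i; rewrite !inE.
have s3 : sc x3 vst = 0 by rewrite /x3 sc_setv.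
have R3 : cset (ar x3 aR) = R.
  by change (cset (ar (den (BUILD aI HZero) (setv x2 vr #|R|)) aR) = R); frame.
have r3 : sc x3 vr = #|R|.
  by change (sc (den (BUILD aI HZero) (setv x2 vr #|R|)) vr = #|R|); frame; rewrite sc_setv.
have p3 : sc x3 vphase = 0.
  by change (sc (den (BUILD aI HZero) (setv x2 vr #|R|)) vphase = 0); frame.
have o3 : out x3 = [::].
  by change (out (den (BUILD aI HZero) (setv x2 vr #|R|)) = [::]); quiet.
move: x3 I3 s3 R3 r3 p3 o3 => x3 I3 s3 R3 r3 p3 o3.
have F := fill_ok M I3 s3 r3.
rewrite denS; set x4 := den FILL x3 in F *.
have R4 : cset (ar x4 aR) = R by rewrite /x4; frame.
have r4 : sc x4 vr = #|R| by rewrite /x4; frame.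
have p4 : sc x4 vphase = 0 by rewrite /x4; frame.
have o4 : out x4 = [::] by rewrite /x4; quiet.
move: x4 F R4 r4 p4 o4 => x4 F R4 r4 p4 o4.
rewrite 2!denS denSet den_out.
have zK : cset (ar (den (COPY aI aK) x4) aK) = fill M #|R| 0 set0 by rewrite copy_ok.
have zR : cset (ar (den (COPY aI aK) x4) aR) = R by frame.
have zr : sc (den (COPY aI aK) x4) vr = #|R| by frame.
have zp : sc (den (COPY aI aK) x4) vphase = 0 by frame.
have zo : out (den (COPY aI aK) x4) = [::] by quiet.
move: (den (COPY aI aK) x4) zK zR zr zp zo => z zK zR zr zp zo.
by split=> //=; rewrite zo zK.
Qed.

Lemma found_ok tau v x : cset (ar x aR) = R -> sc x vr = #|R| -> sc x vgo = 1 ->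
  sc x vphase = 1 -> sc x vtau = tau -> cset (ar x aN) = v.2 -> sc x vJN = v.1 ->
  rep (den FOUND x) (Search tau v None, out x ++ emitted tau (v, None)).
Proof.
case: v => J I ER Er Eg Ep Et EN EJ; rewrite [(_, _).2]/= in EN; rewrite [(_, _).1]/= in EJ.
rewrite /FOUND 3!denS 2!denSet.
have yK : cset (ar (den (COPY aN aK) x) aK) = I by rewrite copy_ok.
have yt : sc (den (COPY aN aK) x) vtau = tau by frame.
have yJ : sc (den (COPY aN aK) x) vJN = J by frame.
have yR : cset (ar (den (COPY aN aK) x) aR) = R by frame.
have yr : sc (den (COPY aN aK) x) vr = #|R| by frame.
have yg : sc (den (COPY aN aK) x) vgo = 1 by frame.
have yp : sc (den (COPY aN aK) x) vphase = 1 by frame.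
have yo : out (den (COPY aN aK) x) = out x by quiet.
move: (den (COPY aN aK) x) yK yt yJ yR yr yg yp yo => y yK yt yJ yR yr yg yp yo.
rewrite heval_var yJ; set z := setv _ _ _.
have Hz : rep z (Search tau (J, I) None, out x) by split.
have zj : sc z vj = J by []. have zK : cset (ar z aK) = I by [].
move: z Hz zj zK => z Hz zj zK.
rewrite denIf (_ : (heval _ _ != 0) = (J == n)); last by rewrite /= zj eqb0 negbK.
rewrite /emitted andTb [(_, _).1]/=; case: ifP => _; last by rewrite cats0.
have [zR zr zo [zg zp zE zf]] := Hz; have [_ _ _ zt _] := zE.
rewrite denS; have C := card_ok M aK z; rewrite zK in C.
have Hw : rep (den (CARD aK) z) (Search tau (J, I) None, out x).
  split; [by frame | by frame | by quiet |].
  by split; [by frame | by frame | apply: env_den | by frame].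
have wt : sc (den (CARD aK) z) vtau = tau by frame.
have wK : cset (ar (den (CARD aK) z) aK) = I by frame.
move: (den (CARD aK) z) C Hw wt wK => w C [wR wr wo HH] wt wK.
rewrite denIf (_ : (heval _ _ != 0) = (#|I| == tau)); last by rewrite /= C wt eqb0 negbK.
case: ifP => _; last by rewrite cats0.
by rewrite den_out; split=> //=; rewrite wo wK cats1.
Qed.

Lemma pop_ok tau j K x (v := parent M R tau (j, K)) : 0 < j <= n ->
  cset (ar x aR) = R -> sc x vr = #|R| -> sc x vgo = 1 ->
  sc x vphase = 1 -> sc x vtau = tau -> cset (ar x aK) = K -> sc x vj = j ->
  rep (den POP x) (Search tau v (Some (move_to v (j, K))), out x).
Proof.
move=> /andP[j0 jn] ER Er Eg Ep Et EK Ej; rewrite /POP 2!denS denSet heval_var.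
set y := setv _ _ _.
have EyJ : sc y vJ = j by rewrite /y sc_setv; frame.
have yI : cset (ar y aI) = K.
  by change (cset (ar (den (COPY aK aI) x) aI) = K); rewrite copy_ok.
have yR : cset (ar y aR) = R by change (cset (ar (den (COPY aK aI) x) aR) = R); frame.
have yr : sc y vr = #|R| by change (sc (den (COPY aK aI) x) vr = #|R|); frame.
have yg : sc y vgo = 1 by change (sc (den (COPY aK aI) x) vgo = 1); frame.
have yp : sc y vphase = 1 by change (sc (den (COPY aK aI) x) vphase = 1); frame.
have yt : sc y vtau = tau by change (sc (den (COPY aK aI) x) vtau = tau); frame.
have yo : out y = out x by change (out (den (COPY aK aI) x) = out x); quiet.
move: y EyJ yI yR yr yg yp yt yo => y EyJ yI yR yr yg yp yt yo.
rewrite denS; have P := parent_ok M yI yR EyJ yt j0 jn; rewrite -/v in P.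
pose keep z := [/\ sc z vJ = j, cset (ar z aI) = K, cset (ar z aR) = R &
  [/\ sc z vr = #|R|, sc z vgo = 1, sc z vphase = 1, sc z vtau = tau & out z = out x]].
have keep_den h z : all (fun k => k \notin modv h) [:: vJ; vr; vgo; vphase; vtau] ->
    all (fun b => b \notin moda h) [:: aI; aR] -> silent h -> keep z -> keep (den h z).
  move=> /= /and5P[k1 k2 k3 k4 /andP[k5 _]] /and3P[b1 b2 _] sh [? ? ? [? ? ? ? ?]].
  by split; [rewrite modvP|rewrite modaP|rewrite modaP|split; rewrite ?modvP ?silentP].
have K1 : keep (den PARENT y) by apply: keep_den => //; split.
move: (den PARENT y) P K1 => z P K1.
case: v P => vj' vK' [zj zW].
rewrite denS; have [A1 _] := first2_ok M aI aW z.
have zI : cset (ar z aI) = K by case: K1.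
rewrite zI zW in A1.
have K2 : keep (den (FIRST2 aI aW) z) by apply: keep_den.
have j2 : sc (den (FIRST2 aI aW) z) vpj = vj' by frame.
have W2 : cset (ar (den (FIRST2 aI aW) z) aW) = vK' by frame.
move: (den (FIRST2 aI aW) z) A1 K2 j2 W2 => z2 A1 K2 j2 W2.
rewrite denS denSet heval_var A1; set z3 := setv _ _ _.
have K3 : keep z3 by []. have j3 : sc z3 vpj = vj' by [].
have W3 : cset (ar z3 aW) = vK' by [].
have f3 : sc z3 vmf = oval (first2 (K :\: vK')).1 by [].
move: z3 K3 j3 W3 f3 => z3 K3 j3 W3 f3.
rewrite denS; have [B1 B2] := first2_ok M aW aI z3.
have I3 : cset (ar z3 aI) = K by case: K3.
rewrite I3 W3 in B1 B2.
have K4 : keep (den (FIRST2 aW aI) z3) by apply: keep_den.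
have j4 : sc (den (FIRST2 aW aI) z3) vpj = vj' by frame.
have f4 : sc (den (FIRST2 aW aI) z3) vmf = oval (first2 (K :\: vK')).1 by frame.
have W4 : cset (ar (den (FIRST2 aW aI) z3) aW) = vK' by frame.
move: (den (FIRST2 aW aI) z3) B1 B2 K4 j4 f4 W4 => z4 B1 B2 K4 j4 f4 W4.
rewrite 3!denS 3!denSet; set z5 := setv (setv (setv z4 _ _) _ _) _ _.
have K5 : keep z5 by []. have j5 : sc z5 vpj = vj' by [].
have f5 : sc z5 vmf = oval (first2 (K :\: vK')).1 by [].
have a5 : sc z5 vma = oval (first2 (vK' :\: K)).1 by [].
have b5 : sc z5 vmb = oval (first2 (vK' :\: K)).2 by [].
have l5 : sc z5 vml = (j == vj') by case: K4 => E _ _ _; rewrite /z5 /= E j4.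
have W5 : cset (ar z5 aW) = vK' by [].
move: z5 K5 j5 f5 a5 b5 l5 W5 => z5 K5 j5 f5 a5 b5 l5 W5.
rewrite denS; have C6 : cset (ar (den (COPY aW aK) z5) aK) = vK' by rewrite copy_ok.
have K6 : keep (den (COPY aW aK) z5) by apply: keep_den.
have j6 : sc (den (COPY aW aK) z5) vpj = vj' by frame.
have f6 : sc (den (COPY aW aK) z5) vmf = oval (first2 (K :\: vK')).1 by frame.
have a6 : sc (den (COPY aW aK) z5) vma = oval (first2 (vK' :\: K)).1 by frame.
have b6 : sc (den (COPY aW aK) z5) vmb = oval (first2 (vK' :\: K)).2 by frame.
have l6 : sc (den (COPY aW aK) z5) vml = (j == vj') by frame.
move: (den (COPY aW aK) z5) C6 K6 j6 f6 a6 b6 l6 => z6 C6 K6 j6 f6 a6 b6 l6.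
rewrite denS 2!denSet heval_var j6.
case: K6 => ? ? ? [? ? ? ? ?]; split=> //; split=> //; split=> // m [<-].
by split.
Qed.

Lemma search_ok tau v pos outs x : node M R tau v -> tau < #|R| ->
  rep x (Search tau v pos, outs) -> rep (den SEARCH x) (cstep M (Search tau v pos, outs)).
Proof.
case: v => j K nv tr [ER Er Eo [Eg Ep Hx Ef]].
have /and3P[jn _ _] := nv; rewrite [(_, _).1]/= in jn.
rewrite [(_, _).2]/= in Eo.
have := scanall_ok (top_cis M) jn Hx Ef; rewrite /SEARCH denS.
have Hfind := scan_found M R tau j K pos.
have yR : cset (ar (den SCANALL x) aR) = R by frame.
have yr : sc (den SCANALL x) vr = #|R| by frame.
have yg : sc (den SCANALL x) vgo = 1 by frame.
have yp : sc (den SCANALL x) vphase = 1 by frame.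
have yo : out (den SCANALL x) = outs by quiet.
move: (den SCANALL x) yR yr yg yp yo => y yR yr yg yp yo [Hy _ Fy Ny].
rewrite denIf heval_var Fy eqb0 negbK Hfind; rewrite Hfind in Ny.
rewrite /cstep [(_, _).1]/= [(_, _).2]/= /cnext /advance.
rewrite [(_, _).1]/= [(_, _).2]/=.
have [yK _ yj yt _] := Hy.
case: (ohead _) Ny => [m|] Ny.
  have [N1 N2] := Ny m erefl.
  by rewrite -yo; apply: found_ok.
rewrite (node_root_eq (top_cis M) nv) [(_, _).1]/= [isSome _]/=.
change (rep (den (HIf (HVar vj) POP (DESCEND vtau)) y)
  match (if j == 0 then None else Some (parent M R tau (j, K), Some (move_to (parent M R tau (j, K)) (j, K)))) with
  | Some (v', pos') => (Search tau v' pos', outs ++ emitted tau (v', pos'))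
  | None => (descend M tau, outs)
  end).
rewrite denIf heval_var yj; case: eqP => [j0|/eqP j0].
  by rewrite -yo; apply: descend_ok.
rewrite /emitted cats0 -yo; apply: pop_ok => //.
by rewrite lt0n j0.
Qed.

(** The trace invariant supplies what the program does not check: that the current position is a
    node and that the threshold is below the maximum cardinality. *)
Lemma body_ok k x c : trace_inv M k c -> c.1 <> Halt n -> rep x c -> rep (den BODY x) (cstep M c).
Proof.
case: c => -[B|tau v pos|] outs // Hi _ Hx; rewrite /BODY denIf heval_var.
  case: (Hx) => _ _ _ [_ -> _]; exact: flash_ok.
case: (Hx) => _ _ _ [_ -> _ _].
have [tr [t [l [O [H _ _ _]]]]] := Hi.
have nr : node M R tau (0, R) by apply: node_root => //; apply: top_cis.
have [nv _] := reach_nd (rank := rank M R tau) nr erefl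
  (fun u nu ur => parent_node (top_cis M) tr nu ur) H.
exact: search_ok.
Qed.

End Programs.

(** * The main theorem *)

Definition enumerator := program INIT BODY vgo.

Definition speed := konst INIT + 4 * ((esize (Cell (Const vgo.+1)) * w2).+1 + konst BODY).

Lemma vgo_lt : vgo < nscalars. Proof. by vm_compute. Qed.

Lemma leq_outputs_by n (s : state n) t u : t <= u -> outputs_by s t <= outputs_by s u.
Proof. by move=> tu; apply: sub_count => e /leq_trans; apply. Qed.

Section Run.

Variables (n : nat) (M1 M2 : matroid 'I_n) (Q : nat).
Hypothesis Q0 : 0 < Q.

Let M (b : bool) := if b then M2 else M1.
Let st := @state_at n (fun b => indep (M b)) INIT BODY.

Lemma rep_run k : (forall k', k' < k -> (crun M k').1 <> Halt n) -> rep M (st k) (crun M k).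
Proof.
elim: k => [|k IH] H; first exact: init_ok.
have Hk : rep M (st k) (crun M k) by apply: IH => k' lt; apply: H; apply: ltnW.
have Nk : (crun M k).1 <> Halt n by apply: H.
exact: (body_ok (trace_run Nk) Nk Hk).
Qed.

Lemma rep_go x c : rep M x c -> c.1 <> Halt n -> sc x vgo <> 0.
Proof. by case: c => -[B|tau v pos|] outs [_ _ _ H] //= _; case: H => ->. Qed.

Lemma enumerator_run : exists s, [/\ run enumerator M1 M2 Q s, good s, listed M 0 (outputs s) &
  forall i, i <= size (outputs s) -> i <= outputs_by s (speed * (i * (n.+2 ^ 7 * Q)))].
Proof.
have [K [HK Hlt L]] := run_halts M.
have repK k : k <= K -> rep M (st k) (crun M k).
  by move=> kK; apply: rep_run => k' lt; apply: Hlt; apply: leq_trans kK.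
have go k : k < K -> sc (st k) vgo <> 0.
  by move=> kK; apply: rep_go (repK k (ltnW kK)) _; apply: Hlt.
have goK : sc (st K) vgo = 0 by have [_ _ _] := repK K (leqnn K); rewrite HK.
have [s [e g o H]] := program_run Q0 init_wf body_wf vgo_lt go goK.
have oE k : k <= K -> out (st k) = (crun M k).2 by case/repK.
exists s; split=> //; first by rewrite o oE.
move=> i; rewrite o oE // => iK; case: i iK => [//|i] iK.
(* By [run_progress], a machine still running after [4 * (n.+1 ^ 2 * i.+1)] steps has at least
   [i.+1] outputs; one that has halted has all of them. *)
pose k := minn K (4 * (n.+1 ^ 2 * i.+1)).
have kK : k <= K by rewrite geq_minl.
have ik : i.+1 <= size (out (st k)).
  rewrite oE // /k; case: (leqP K (4 * (n.+1 ^ 2 * i.+1))) => [//|lt].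
  have [_] := run_progress (Hlt _ lt).
  by rewrite !ltn_pmul2l ?expn_gt0 // ltnS.
apply: leq_trans ik _; apply: leq_trans (H k kK) _; apply: leq_outputs_by.
rewrite /round_cost init_deg body_deg /speed; move: (konst INIT) (_.+1 + _) => c0 c1.
have E7 : n.+2 ^ 7 * Q = n.+2 ^ 2 * (n.+2 ^ 5 * Q) by rewrite mulnA -expnD.
rewrite E7 mulnDl leq_add //.
  by rewrite leq_mul2l; apply/orP; right; rewrite mulnA leq_pmull // muln_gt0 expn_gt0.
apply: (@leq_trans (4 * (n.+1 ^ 2 * i.+1) * (c1 * (n.+2 ^ 5 * Q)))).
  by rewrite leq_mul2r geq_minr orbT.
rewrite (_ : 4 * c1 * _ = 4 * (n.+2 ^ 2 * i.+1) * (c1 * (n.+2 ^ 5 * Q))); last first.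
  by move: (n.+2 ^ 2) (n.+2 ^ 5 * Q) => a b; lia.
by rewrite leq_mul2r !leq_mul2l leq_mul2r leq_exp2r // leqnSn !orbT.
Qed.

Lemma size_listed outs : listed M 0 outs -> size outs = #|mcis M1 M2|.
Proof.
case=> U E _; rewrite -(card_uniqP U); apply: eq_card => I.
by rewrite E inE unfold_in /mcis_ge andbT.
Qed.

End Run.

Theorem theorem6 :
  exists A : algorithm,
    [/\ enumerates_mcis_by_size A,
        exists c : nat,
          forall (n : nat) (M1 M2 : matroid 'I_n) (Q : nat) (s : state n),
          0 < n -> 0 < Q -> run A M1 M2 Q s ->
          forall i : nat, i <= #|mcis M1 M2| ->
          i <= outputs_by s (c * (i * n ^ 7 * Q)),
        polynomial_space A
      & linear_incremental_time A].
Proof.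
have fast n (M1 M2 : matroid 'I_n) Q s : 0 < Q -> run enumerator M1 M2 Q s ->
    good s /\ forall i, i <= #|mcis M1 M2| -> i <= outputs_by s (speed * (i * (n.+2 ^ 7 * Q))).
  move=> Q0 H; have [s' [H' g L T]] := enumerator_run M1 M2 Q0.
  have -> : s = s' by apply: exec_det H H'.
  by split=> // i iN; apply: T; rewrite (size_listed L).
exists enumerator; split.
- move=> n M1 M2 Q Q0; have [s [H _ [U E S] _]] := enumerator_run M1 M2 Q0.
  exists s => //; split=> // I; rewrite E inE unfold_in /mcis_ge andbT //.
(* The constant comes from [n.+2 <= 3 * n], which holds for positive [n]. *)
- exists (speed * 3 ^ 7) => n M1 M2 Q s n0 Q0 H i iN.
  have [_ T] := fast _ _ _ _ _ Q0 H; apply: leq_trans (T i iN) _; apply: leq_outputs_by.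
  have le : n.+2 ^ 7 <= 3 ^ 7 * n ^ 7.
    rewrite -expnMn leq_exp2r //; lia.
  move: speed (n.+2 ^ 7) (3 ^ 7) (n ^ 7) le => c a b d le.
  rewrite -mulnA leq_mul2l; apply/orP; right.
  rewrite -mulnA [b * _]mulnCA leq_mul2l; apply/orP; right.
  by rewrite mulnA leq_mul2r le orbT.
(* There are at most [(abase + narrays) * n.+2] cells of at most [n.+2] bits each, and [n.+2] is at
   most twice [(n + Qhat).+1], whence the 4; the summand 1 pays for [Qhat]. *)
- exists (4 * (abase + narrays) + 1), 2 => n M1 M2 Q Qhat s Q0 H.
  have [[_ _ gp _] _] := fast _ _ _ _ _ Q0 H; rewrite /space mulnDl mul1n leq_add //; last first.
    apply: (@leq_trans (n + Qhat).+1); first by rewrite leqW ?leq_addl.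
    by rewrite -mulnn leq_pmulr.
  apply: leq_trans gp _; rewrite /space_bound.
  move: abase narrays => a b.
  have le : n.+2 <= 2 * (n + Qhat).+1 by lia.
  apply: (@leq_trans ((a + b) * n.+2 * n.+2)).
    by rewrite leq_mul2r mulnDl leq_add2r leq_pmulr // orbT.
  rewrite -mulnA mulnn [4 * _]mulnC -mulnA leq_mul2l; apply/orP; right.
  by rewrite -[4]/(2 ^ 2) -expnMn leq_exp2r.
(* Seven factors bound [n.+2 ^ 7], using [n.+2 <= 2 * (n + Q).+1], and the eighth bounds [Q]. *)
exists (speed * 2 ^ 7), 8 => n M1 M2 Q s Q0 H i iN.
have [_ T] := fast _ _ _ _ _ Q0 H; apply: leq_trans (T i iN) _; apply: leq_outputs_by.
have le : n.+2 ^ 7 <= 2 ^ 7 * (n + Q).+1 ^ 7.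
  rewrite -expnMn leq_exp2r //; lia.
move: speed (n.+2 ^ 7) (2 ^ 7) le => c a b le.
rewrite mulnCA leq_mul2l; apply/orP; right; rewrite -mulnA leq_mul2l; apply/orP; right.
by rewrite [_ ^ 8]expnSr mulnA leq_mul // leqW ?leq_addl.
Qed.
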